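(* Let $k=\overline{\mathbb{F}_2}$. Assume that for every $\alpha\in k\setminus\{0\}$ and all integers $n\ge 1$ and $0\le j<2^n$ one has $$\langle n,j,\alpha\rangle=e_{n+1}\left(g_\alpha^{2j+1}\right)-\tfrac12\left(e_{n+1}\left(g_\alpha^{2j}\right)+e_{n+1}\left(g_\alpha^{2j+2}\right)\right).$$ Let $\alpha,\beta\in k\setminus\{0\}$ with $m_\alpha=[\mathbb{F}_2(\alpha):\mathbb{F}_2]>1$ and $m_\beta=[\mathbb{F}_2(\beta):\mathbb{F}_2]>1$. Let $g_\alpha=g_\alpha(x_1,y_1,z_1)$ and $g_\beta=g_\beta(x_2,y_2,z_2)$ be the quartics in the disjoint sets of variables $x_1,y_1,z_1$ and $x_2,y_2,z_2$ respectively. Then the seven-dimensional hypersurface $R_{\alpha,\beta}:=k[[x_1,y_1,z_1,x_2,y_2,z_2,u,v]]/(uv+g_\alpha+g_\beta)$ has Hilbert–Kunz multiplicity $$e_{HK}(R_{\alpha,\beta})=\frac{381}{248}+\frac{3}{2^{5m_\alpha+3}-8}+\frac{3}{2^{5m_\beta+3}-8}+\frac{1}{2^{5\operatorname{lcm}(m_\alpha,m_\beta)+3}-8}$$ and $F$-signature $$s(R_{\alpha,\beta})=\frac{115}{248}-\frac{3}{2^{5m_\alpha+3}-8}-\frac{3}{2^{5m_\beta+3}-8}-\frac{1}{2^{5\operatorname{lcm}(m_\alpha,m_\beta)+3}-8}.$$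
   Context: Let $k=\overline{\mathbb{F}_2}$; for $\beta\in k$ put $m_\beta=[\mathbb{F}_2(\beta):\mathbb{F}_2]$. For $0\ne\alpha\in k$ let $g_\alpha=g_\alpha(x,y,z)=\alpha x^2y^2+z^4+xyz^2+(x^3+y^3)z\in k[x,y,z]$ (the Brenner–Monsky quartic). For a polynomial $f\in k[x_1,\dots,x_d]$ and $n\ge 0$, $e_n(f)=\dim_k k[x_1,\dots,x_d]/(x_1^{2^n},\dots,x_d^{2^n},f)$ (so $e_n(1)=0$). Hilbert–Kunz multiplicity and $F$-signature: for a complete local $F$-finite domain $(R,\mathfrak m)$ of characteristic $p>0$, dimension $d$ and perfect residue field, $e_{HK}(R)=\lim_{e\to\infty}\ell_R(R/\mathfrak m^{[p^e]})/p^{ed}$ and $s(R)=\lim_{e\to\infty}\ell_R(R/I_e)/p^{ed}$, where $I_e=\{r\in R: \text{the }R\text{-linear map }R\to R^{1/p^e},\ 1\mapsto r^{1/p^e},\text{ does not split}\}$. Definition of $\langle n,j,\alpha\rangle$: let $0\neq\alpha\in k$, write $\alpha=\lambda^2+\lambda$ with $\lambda\in k$, and put $m=m_\alpha$. Let $P=$ ''even'', $Q=$ ''odd'' if $m_\lambda\ne m_\alpha$, and $P=$ ''odd'', $Q=$ ''even'' if $m_\lambda=m_\alpha$. Let $\Gamma$ be the free abelian group on symbols $A_n,B_n$ ($n\in\mathbb{N}$), $C$, $D$. Define homomorphisms $\sigma_0,\sigma_1:\Gamma\to\Gamma$ by: - $\sigma_0(A_n)=B_{n+1}$ if $m\mid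 n+1$ and $\frac{n+1}{m}$ has parity $P$; otherwise $\sigma_0(A_n)=A_{n+1}$. - $\sigma_1(A_n)=B_{n+1}$ if $m\mid n+1$ and $\frac{n+1}{m}$ has parity $Q$; otherwise $\sigma_1(A_n)=A_{n+1}$. - $\sigma_0(B_n)=0$ if $m\mid n$ and $\frac nm$ has parity $P$; otherwise $\sigma_0(B_n)=A_{n+1}+C$. - $\sigma_1(B_n)=0$ if $m\mid n$ and $\frac nm$ has parity $Q$; otherwise $\sigma_1(B_n)=A_{n+1}+C$. - $\sigma_0(C)=\sigma_1(C)=C$, $\sigma_0(D)=A_1$, $\sigma_1(D)=0$. For $n\ge0$ and $0\le j<2^n$ define $f(n,j)\in\Gamma$ recursively by $f(0,0)=2C+D$, $f(n+1,2j)=\sigma_0(f(n,j))$, $f(n+1,2j+1)=\sigma_1(f(n,j))$. Then $f(n,j)=aA_n+bB_n+cC+dD$ for some integers $a,b,c,d$, and $\langle n,j,\alpha\rangle:=(3a+5b+d)2^c$. *)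

(* Defs.v *)
From HB Require Import structures.
(* mpoly has to be imported before the analysis files: in the other order the
   levels of their notations clash. *)
From mathcomp Require Import all_boot all_order all_algebra ring_quotient.
From mathcomp Require Import freeg mpoly.
From mathcomp Require Import boolp classical_sets reals topology normedtype.
From mathcomp Require Import sequences.

Set Implicit Arguments.
Unset Strict Implicit.
Unset Printing Implicit Defensive.

Import Order.TTheory GRing.Theory Num.Theory numFieldNormedType.Exports.

Local Open Scope classical_set_scope.
Local Open Scope ring_scope.

Section CommutativeAlgebra.
Variable A : comNzRingType.

Definition is_ideal (I : set A) : Prop :=
  [/\ I 0, (forall x y, I x -> I y -> I (x + y)) &
      (forall a x, I x -> I (a * x))].

Definition is_prime_ideal (P : set A) : Prop :=
  [/\ is_ideal P, ~ P 1 & forall x y, P (x * y) -> P x \/ P y].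

(* A chain J_0 < J_1 < ... < J_n of members of C has length n. *)
Definition has_chain (C : set (set A)) (n : nat) : Prop :=
  exists J : nat -> set A,
    (forall i, (i <= n)%N -> C (J i)) /\
    (forall i, (i < n)%N -> J i `<` J i.+1).

Definition is_max_chain_length (C : set (set A)) (n : nat) : Prop :=
  has_chain C n /\ forall n', has_chain C n' -> (n' <= n)%N.

Definition is_krull_dim (d : nat) : Prop :=
  is_max_chain_length is_prime_ideal d.

(* The length of the A-module A / I: its submodules are the J / I, where J
   runs over the ideals of A that contain I. *)
Definition is_quotient_length (I : set A) (l : nat) : Prop :=
  is_max_chain_length [set J | is_ideal J /\ I `<=` J] l.

(* The set of nonunits: the maximal ideal when A is local. *)
Definition max_ideal : set A := [set x | forall y, x * y != 1].

Definition frobenius_power (I : set A) (q : nat) : set A :=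
  smallest is_ideal [set x ^+ q | x in I].

(* For A reduced of characteristic p and q = p ^ e, taking q-th roots
   identifies A^{1/q} with the abelian group A on which a in A acts as
   multiplication by a ^+ q.  The A-linear map A -> A^{1/q}, 1 |-> r^{1/q}, is
   then s |-> s ^+ q * r, and phi is an A-linear retraction of it. *)
Definition frobenius_splits (q : nat) (r : A) : Prop :=
  exists phi : A -> A,
    [/\ (forall x y, phi (x + y) = phi x + phi y),
        (forall a x, phi (a ^+ q * x) = a * phi x) &
        (forall s, phi (s ^+ q * r) = s)].

Definition splitting_ideal (q : nat) : set A :=
  [set r | ~ frobenius_splits q r].

Variables (R : realType) (p : nat).

Definition has_normalized_length_limit (I : nat -> set A) (v : R) : Prop :=
  exists (d : nat) (l : nat -> nat),
    [/\ is_krull_dim d, (forall e, is_quotient_length (I e) (l e)) &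
        (fun e => (l e)%:R / p%:R ^+ (e * d) : R^o) @ \oo --> (v : R^o)].

Definition is_HK_multiplicity (v : R) : Prop :=
  has_normalized_length_limit (fun e => frobenius_power max_ideal (p ^ e)) v.

Definition is_F_signature (v : R) : Prop :=
  has_normalized_length_limit (fun e => splitting_ideal (p ^ e)) v.

End CommutativeAlgebra.

Arguments is_HK_multiplicity A {R} p v.
Arguments is_F_signature A {R} p v.

Section PrincipalQuotient.
Variables (A : comNzRingType) (a : A).

Definition principal_ideal of (forall b, b * a != 1) : {pred A} :=
  fun x => `[< exists b, x = b * a >].

Hypothesis a_proper : forall b, b * a != 1.

Lemma principal_idealr_closed : idealr_closed (principal_ideal a_proper).
Proof.
split.
- by apply/asboolP; exists 0; rewrite mul0r.
- by apply/negP => /asboolP[b] /esym/eqP; apply/negP/a_proper.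
- move=> b x y /asboolP[c ->] /asboolP[d ->].
  by apply/asboolP; exists (b * c + d); rewrite mulrDl mulrA.
Qed.

HB.instance Definition _ :=
  isIdealr.Build A (principal_ideal a_proper) principal_idealr_closed.

Definition principal_quotient : comNzRingType :=
  {ideal_quot (principal_ideal a_proper)}.

End PrincipalQuotient.

Section PowerSeries.
Variables (n : nat) (k : comNzRingType).

Record powerseries := PowerSeries { pscoeff : 'X_{1..n} -> k }.

Implicit Types (f g h : powerseries) (m : 'X_{1..n}) (p q : {mpoly k[n]}).

HB.instance Definition _ := gen_eqMixin powerseries.
HB.instance Definition _ := gen_choiceMixin powerseries.

Lemma psP f g : (forall m, pscoeff f m = pscoeff g m) -> f = g.
Proof. by case: f g => f [g] fg; congr PowerSeries; apply/funext. Qed.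

Definition ps0 := PowerSeries (fun=> 0).
Definition psopp f := PowerSeries (fun m => - pscoeff f m).
Definition psadd f g := PowerSeries (fun m => pscoeff f m + pscoeff g m).

Lemma psaddA : associative psadd.
Proof. by move=> f g h; apply: psP => m /=; rewrite addrA. Qed.
Lemma psaddC : commutative psadd.
Proof. by move=> f g; apply: psP => m /=; rewrite addrC. Qed.
Lemma psadd0 : left_id ps0 psadd.
Proof. by move=> f; apply: psP => m /=; rewrite add0r. Qed.
Lemma psaddN : left_inverse ps0 psopp psadd.
Proof. by move=> f; apply: psP => m /=; rewrite addNr. Qed.

HB.instance Definition _ :=
  GRing.isZmodule.Build powerseries psaddA psaddC psadd0 psaddN.

Definition ps_of_mpoly p := PowerSeries (fun m => p@_m).

Definition ps1 := ps_of_mpoly 1.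

(* The sum ranges over all pairs with m = h.1 + h.2: the bound on the degrees
   of h.1 and h.2 only makes the index type finite. *)
Definition psmul f g := PowerSeries (fun m =>
  \sum_(h : 'X_{1..n < (mdeg m).+1, (mdeg m).+1} | m == (h.1 + h.2)%MM)
    pscoeff f h.1 * pscoeff g h.2).

Definition ps_agree (d : nat) p f :=
  forall m, (mdeg m <= d)%N -> p@_m = pscoeff f m.

Lemma psmulE f g p q m : ps_agree (mdeg m) p f -> ps_agree (mdeg m) q g ->
  pscoeff (psmul f g) m = (p * q)@_m.
Proof.
move=> pf qg; rewrite mcoeffM /=; apply: eq_bigr => h _.
by rewrite pf ?qg // -ltnS bmdeg.
Qed.

Lemma ps_agreeM d f g p q : ps_agree d p f -> ps_agree d q g ->
  ps_agree d (p * q) (psmul f g).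
Proof.
move=> pf qg m md; rewrite (@psmulE f g p q) // => m' /leq_trans/(_ md).
- exact: pf.
- exact: qg.
Qed.

Definition pstrunc d f : {mpoly k[n]} :=
  \sum_(m : 'X_{1..n < d.+1}) pscoeff f m *: 'X_[m].

Lemma pstruncP d f : ps_agree d (pstrunc d f) f.
Proof. by move=> m md; rewrite /pstrunc mcoeff_mpoly. Qed.

Lemma psmulA : associative psmul.
Proof.
move=> f g h; apply: psP => m; pose T := @pstruncP (mdeg m).
rewrite (psmulE (T f) (ps_agreeM (T g) (T h))).
by rewrite (psmulE (ps_agreeM (T f) (T g)) (T h)) mulrA.
Qed.

Lemma psmulC : commutative psmul.
Proof.
move=> f g; apply: psP => m; pose T := @pstruncP (mdeg m).
by rewrite (psmulE (T f) (T g)) (psmulE (T g) (T f)) mulrC.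
Qed.

Lemma psmul1 : left_id ps1 psmul.
Proof.
move=> f; apply: psP => m; have F := @pstruncP (mdeg m) f.
by rewrite (@psmulE ps1 f 1 _ m _ F) // mul1r F.
Qed.

Lemma psmulDl : left_distributive psmul psadd.
Proof.
move=> f g h; apply: psP => m /=; rewrite -big_split /=.
by apply: eq_bigr => u _; rewrite mulrDl.
Qed.

Lemma ps1_neq0 : ps1 != 0.
Proof.
apply/eqP => /(congr1 (pscoeff^~ 0%MM)) /= /eqP.
by rewrite mcoeff1 eqxx oner_eq0.
Qed.

HB.instance Definition _ := GRing.Zmodule_isComNzRing.Build powerseries
  psmulA psmulC psmul1 psmulDl ps1_neq0.

Lemma ps_of_mpoly_nonunit p : p@_0%MM = 0 -> forall f, f * ps_of_mpoly p != 1.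
Proof.
move=> p0 f; apply/eqP => /(congr1 (pscoeff^~ 0%MM)).
have P : ps_agree (mdeg (0%MM : 'X_{1..n})) p (ps_of_mpoly p) by [].
rewrite [LHS](psmulE (@pstruncP _ f) P) [LHS](rmorphM (mcoeff 0%MM)) /=.
by rewrite p0 mulr0 mcoeff1 eqxx => /esym/eqP; rewrite oner_eq0.
Qed.

End PowerSeries.

Section Dimension.
Variables (F : fieldType) (V : zmodType) (scale : F -> V -> V).

(* b induces a basis of the F-vector space U / W. *)
Definition is_dim (U W : set V) (d : nat) : Prop :=
  exists b : 'I_d -> V, (forall i, U (b i)) /\
    forall v, U v ->
      exists! c : {ffun 'I_d -> F}, W (v - \sum_i scale (c i) (b i)).

Definition dim (U W : set V) : nat := xget 0%N [set d | is_dim U W d].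

End Dimension.

Section BrennerMonsky.
Variable k : fieldType.

Definition quartic (d : nat) (alpha : k) (x y z : {mpoly k[d]}) :
    {mpoly k[d]} :=
  alpha *: (x ^+ 2 * y ^+ 2) + z ^+ 4 + x * y * z ^+ 2
    + (x ^+ 3 + y ^+ 3) * z.

Definition quartic_xyz (alpha : k) : {mpoly k[3]} :=
  quartic alpha 'X_(inord 0) 'X_(inord 1) 'X_(inord 2).

Definition e_ideal (d n : nat) (f : {mpoly k[d]}) : set {mpoly k[d]} :=
  smallest (@is_ideal {mpoly k[d]})
    ([set 'X_i ^+ (2 ^ n) | i in [set: 'I_d]] `|` [set f]).

Definition e_ (d n : nat) (f : {mpoly k[d]}) : nat :=
  dim (fun (c : k) (g : {mpoly k[d]}) => c *: g) setT (e_ideal n f).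

(* The variables x_1, y_1, z_1, x_2, y_2, z_2, u, v are 'X_0, ..., 'X_7. *)
Definition hypersurface_eq (alpha beta : k) : {mpoly k[8]} :=
  'X_(inord 6) * 'X_(inord 7)
    + quartic alpha 'X_(inord 0) 'X_(inord 1) 'X_(inord 2)
    + quartic beta 'X_(inord 3) 'X_(inord 4) 'X_(inord 5).

Lemma hypersurface_eq0 alpha beta : (hypersurface_eq alpha beta)@_0%MM = 0.
Proof.
rewrite /hypersurface_eq /quartic !mcoeffD !mcoeffZ.
rewrite !(rmorphM, rmorphXn, rmorphD) /= !mcoeffX.
have U0 i : (U_(i) == 0 :> 'X_{1..8})%MM = false by rewrite mnm1_eq0.
by rewrite !U0 !(mul0r, mulr0, addr0, expr0n) /=.
Qed.

(* k[[x_1, y_1, z_1, x_2, y_2, z_2, u, v]] / (uv + g_alpha + g_beta) *)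
Definition hypersurface (alpha beta : k) : comNzRingType :=
  principal_quotient (ps_of_mpoly_nonunit (hypersurface_eq0 alpha beta)).

End BrennerMonsky.

Section DegreeOverF2.
Variables (k : fieldType) (iota : {rmorphism 'F_2 -> k}).

Definition is_subfield (K : set k) : Prop :=
  [/\ K 1, (forall x y, K x -> K y -> K (x - y)) &
      (forall x y, K x -> K y -> K (x / y))].

Definition F2_adjoin (beta : k) : set k := smallest is_subfield [set beta].

(* [F_2(beta) : F_2] *)
Definition degF2 (beta : k) : nat :=
  dim (fun (c : 'F_2) (x : k) => iota c * x) (F2_adjoin beta) [set 0].

End DegreeOverF2.

Inductive symbol := SymA of nat | SymB of nat | SymC | SymD.

Definition symbol_encode (s : symbol) : (nat + nat) + bool :=
  match s with
  | SymA n => inl (inl n) | SymB n => inl (inr n)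
  | SymC => inr false | SymD => inr true
  end.

Definition symbol_decode (c : (nat + nat) + bool) : symbol :=
  match c with
  | inl (inl n) => SymA n | inl (inr n) => SymB n
  | inr false => SymC | inr true => SymD
  end.

Lemma symbol_encodeK : cancel symbol_encode symbol_decode.
Proof. by case. Qed.

HB.instance Definition _ := Countable.copy symbol (can_type symbol_encodeK).

Local Notation Gamma := {freeg symbol / int}.

Section Bracket.

(* m is m_alpha, and oddP tells whether P is "odd". *)
Variables (m : nat) (oddP : bool).

(* m divides n and n / m has parity P (i = false) or Q (i = true). *)
Definition parity_hit (i : bool) (n : nat) : bool :=
  (m %| n)%N && (odd (n %/ m) == (if i then ~~ oddP else oddP)).

Definition sigma_symbol (i : bool) (s : symbol) : Gamma :=
  match s with
  | SymA n => if parity_hit i n.+1 then << SymB n.+1 >> else << SymA n.+1 >>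
  | SymB n => if parity_hit i n then 0 else << SymA n.+1 >> + << SymC >>
  | SymC => << SymC >>
  | SymD => if i then 0 else << SymA 1 >>
  end.

(* sigma false and sigma true are sigma_0 and sigma_1. *)
Definition sigma (i : bool) : Gamma -> Gamma := fglift (sigma_symbol i).

Fixpoint bracket_word (n j : nat) : Gamma :=
  if n is n'.+1 then sigma (odd j) (bracket_word n' j./2)
  else << SymC >> *+ 2 + << SymD >>.

Definition bracket_value (n j : nat) : rat :=
  let w := bracket_word n j in
  (3 * coeff (SymA n) w + 5 * coeff (SymB n) w + coeff SymD w)%:~R
    * 2 ^ coeff SymC w.

End Bracket.

Section BracketOfAlpha.
Variables (k : fieldType) (iota : {rmorphism 'F_2 -> k}).

(* The two roots lambda, lambda + 1 generate the same field over F_2. *)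
Definition AS_root (alpha : k) : k :=
  xget 0 [set lambda | alpha = lambda ^+ 2 + lambda].

Definition bracket (n j : nat) (alpha : k) : rat :=
  let m := degF2 iota alpha in
  bracket_value m (degF2 iota (AS_root alpha) == m) n j.

End BracketOfAlpha.

(* Main.v *)
Require Import Defs.
From HB Require Import structures.
From mathcomp Require Import all_boot all_order all_algebra.
From mathcomp Require Import ring_quotient.
From mathcomp Require Import mxtens.
From mathcomp Require Import freeg mpoly.
From mathcomp Require Import boolp classical_sets reals topology normedtype.
From mathcomp Require Import sequences.
From mathcomp Require Import zify ring lra.

Set Implicit Arguments.
Unset Strict Implicit.
Unset Printing Implicit Defensive.

Import Order.TTheory GRing.Theory Num.Theory.

Local Open Scope ring_scope.

(** Put [q = 2 ^ e] and let [A] be the power series ring in eight variables, [f]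
    the equation of the hypersurface.  The series modulo the [q]-th powers of
    the variables form a space of dimension [q ^ 8], on which [f] acts by a
    nilpotent matrix, the Kronecker sum of the matrices of [u v], of [g_alpha]
    and of [g_beta].  Both invariants are
    asymptotic ranks of powers of this matrix.  The length of the quotient by
    the Frobenius power of the maximal ideal is its corank
    ([frobenius_power_length]).  By Fedder's criterion [r] belongs to the
    splitting ideal iff [f ^ (q - 1) r] vanishes modulo the [q]-th powers of
    the variables, so the other length is the rank of the [(q - 1)]-st power of
    the matrix ([splitting_length]).

    The Jordan type of [u v] is explicit.  Together with a duality between the
    blocks of sizes [a] and [q - a] it turns both lengths into expressions in
    one number, the weighted sum [E_e] of the ranks of the powers of
    [h = g_alpha + g_beta]: they are [E_e] and [2 q ^ 7 - E_e] ([rank_uv_top],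
    [corank_uv]).  In particular the two limits add up to 2.

    The numbers [E_e] satisfy a recursion ([rank_sum_ksum_rec]).  The even
    powers of [h] at level [e + 1] have 64 times the ranks of the powers at
    level [e], because squaring is the Frobenius endomorphism.  Hence
    [E_(e+1) = 128 E_e - N], where [N] is the alternating sum of the ranks,
    which counts the Jordan blocks of odd size.  This count is multiplicative
    on Kronecker sums ([odd_blocks_ksum]): the product of the blocks of sizes
    [a] and [b] has one odd block if [a] and [b] are odd and none otherwise, as
    follows by replacing a size by its complement in a power of 2.  For a
    single quartic at level [n + 1] the count is twice the sum of the brackets
    [<n, j, alpha>] over [j].  The words that define them form an automaton
    with two live states, and the sum is [2 ^ (n+1) (3 + [m_alpha | n])]
    ([bracket_sum]).

    So for [n >= 1] the difference of [E_n / 128 ^ n] and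
    [E_(n+1) / 128 ^ (n+1)] is
    [(1/8) 32 ^ (-n) (3 + [m_alpha | n]) (3 + [m_beta | n])].  As
    [E_1 = 64], the limit is [1/2] minus a sum of four geometric
    series, over the multiples of 1, [m_alpha], [m_beta] and their least common
    multiple ([recursion_limit]).

    The dimension is at most 7 because chains of primes in [A] have length at
    most 8, by induction on the number of variables: [A] modulo a nonzero series
    is finite over a power series ring in one variable less
    ([powerseries_chain]).  A chain of length 7 is visible on a chart of the
    blow-up of the origin, where the strict transform of the hypersurface is a
    graph ([hypersurface_krull_dim]). *)

(** * Splitting a square matrix into blocks *)

Section Splitting.
Variable F : fieldType.

(** [E1], [E2] embed and [D1], [D2] project the summands of an [A]-stable
    decomposition; the explicit maps transport along Kronecker products. *)
Definition splits m m1 m2 (A : 'M[F]_m) (A1 : 'M[F]_m1) (A2 : 'M[F]_m2) :=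
  exists (E1 : 'M[F]_(m, m1)) (E2 : 'M[F]_(m, m2))
         (D1 : 'M[F]_(m1, m)) (D2 : 'M[F]_(m2, m)),
  [/\ E1 *m D1 + E2 *m D2 = 1%:M,
      [/\ D1 *m E1 = 1%:M, D2 *m E2 = 1%:M, D1 *m E2 = 0 & D2 *m E1 = 0],
      A *m E1 = E1 *m A1 & A *m E2 = E2 *m A2].

Lemma intertwine_exp m n (A : 'M[F]_m) (B : 'M[F]_n) (E : 'M[F]_(m, n)) l :
  A *m E = E *m B -> A ^+ l *m E = E *m B ^+ l.
Proof.
move=> AE; elim: l => [|l IH]; first by rewrite !expr0 -!idmxE mul1mx mulmx1.
by rewrite !exprSr -!mulmxE -mulmxA AE mulmxA IH -mulmxA.
Qed.

Lemma mulmx_inj_rank m n p q (P : 'M[F]_(m, n)) (Q : 'M[F]_(p, q)) P' Q'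
    (B : 'M[F]_(n, p)) :
  P' *m P = 1%:M -> Q *m Q' = 1%:M -> \rank (P *m B *m Q) = \rank B.
Proof.
move=> PP QQ; apply/eqP; rewrite eqn_leq; apply/andP; split.
  by rewrite (leq_trans (mxrankM_maxl _ _)) // mxrankM_maxr.
have {1}-> : B = P' *m (P *m B *m Q) *m Q'.
  by rewrite !mulmxA PP mul1mx -mulmxA QQ mulmx1.
by rewrite (leq_trans (mxrankM_maxl _ _)) // mxrankM_maxr.
Qed.

Lemma similar_rank_exp m n (A : 'M[F]_m) (B : 'M[F]_n) E D l :
  D *m E = 1%:M -> E *m D = 1%:M -> A *m E = E *m B ->
  \rank (A ^+ l) = \rank (B ^+ l).
Proof.
move=> DE ED /(intertwine_exp l) AE.
have -> : A ^+ l = E *m B ^+ l *m D by rewrite -AE -mulmxA ED mulmx1.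
exact: (mulmx_inj_rank _ DE DE).
Qed.

Lemma splits_rank_exp m m1 m2 (A : 'M[F]_m) (A1 : 'M[F]_m1) (A2 : 'M[F]_m2) l :
  splits A A1 A2 -> (\rank (A ^+ l) = \rank (A1 ^+ l) + \rank (A2 ^+ l))%N.
Proof.
case=> E1 [E2 [D1 [D2 [ED [D11 D22 D12 D21] AE1 AE2]]]].
pose E := row_mx E1 E2; pose D := col_mx D1 D2.
have DE : D *m E = 1%:M.
  by rewrite mul_col_row D11 D12 D21 D22 -scalar_mx_block.
have AB : A ^+ l *m E = E *m block_mx (A1 ^+ l) 0 0 (A2 ^+ l).
  rewrite mul_mx_row !(intertwine_exp _ AE1, intertwine_exp _ AE2).
  by rewrite mul_row_block !mulmx0 add0r addr0.
have -> : A ^+ l = E *m block_mx (A1 ^+ l) 0 0 (A2 ^+ l) *m D.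
  by rewrite -AB -mulmxA mul_row_col ED mulmx1.
by rewrite (mulmx_inj_rank _ DE DE) rank_diag_block_mx.
Qed.

(** The nilpotent block that maps each basis vector to the next one. *)
Definition jordan n : 'M[F]_n := \matrix_(i, j) (i == j.+1 :> nat)%:R.

Lemma jordan_exp n l : jordan n ^+ l = \matrix_(i, j) (i == (j + l)%N :> nat)%:R.
Proof.
elim: l => [|l IH].
  by rewrite expr0; apply/matrixP => i j; rewrite !mxE addn0.
rewrite exprS -mulmxE IH; apply/matrixP => i j; rewrite !mxE.
case: (ltnP (j + l) n) => h.
  rewrite (bigD1 (Ordinal h)) //= !mxE /= eqxx mulr1 big1 ?addr0 ?addnS //.
  move=> k kn; rewrite !mxE (_ : (k == j + l :> nat)%N = false) ?mulr0 //.
  by apply/negbTE; apply: contra kn => /eqP kk; apply/eqP/val_inj.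
rewrite big1 => [|k _].
  case: eqP => // ij; move: (ltn_ord i); lia.
rewrite !mxE (_ : (k == j + l :> nat)%N = false) ?mulr0 //.
by apply/negbTE/eqP => kk; move: (ltn_ord k); lia.
Qed.

(** The partial identities that factor a power of the shift. *)
Definition jordan_in n a : 'M[F]_(n, a) :=
  \matrix_(i, j) (i == (j + (n - a))%N :> nat)%:R.
Definition jordan_out a n : 'M[F]_(a, n) := \matrix_(i, j) (i == j :> nat)%:R.

Lemma sum_delta n (G : 'I_n -> F) (k : nat) (H : 'I_n -> bool) :
  (forall i, H i = (i == k :> nat)) ->
  \sum_i (H i)%:R * G i = if insub k is Some j then G j else 0.
Proof.
move=> Hk; case: insubP => [j kn jk|kn].
  rewrite (bigD1 j) //= Hk -jk eqxx mul1r big1 ?addr0 // => i ij.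
  rewrite Hk -jk (_ : (i == j :> nat) = false) ?mul0r //.
  by apply/negbTE; apply: contra ij => /eqP/val_inj->.
rewrite big1 // => i _; rewrite Hk (_ : (i == k :> nat) = false) ?mul0r //.
by apply/negbTE; apply: contra kn => /eqP <-.
Qed.

Lemma jordan_inK n a : (a <= n)%N ->
  (\matrix_(i < a, j < n) (j == (i + (n - a))%N :> nat)%:R) *m jordan_in n a
    = 1%:M.
Proof.
move=> an; apply/matrixP => i j; rewrite !mxE.
under eq_bigr do rewrite !mxE.
rewrite (@sum_delta _ (fun k => (k == (j + (n - a))%N :> nat)%:R)
   (i + (n - a))%N (fun k => k == i + (n - a) :> nat)%N) //.
case: insubP => [k _ ->|]; first by rewrite eqn_add2r.
by move=> h; exfalso; move: h (ltn_ord i); lia.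
Qed.

Lemma jordan_outK a n : (a <= n)%N ->
  jordan_out a n *m (\matrix_(i < n, j < a) (i == j :> nat)%:R) = 1%:M.
Proof.
move=> an; apply/matrixP => i j; rewrite !mxE.
under eq_bigr do rewrite !mxE eq_sym.
rewrite (@sum_delta _ (fun k => (k == j :> nat)%:R)
   i (fun k => k == i :> nat)) //.
case: insubP => [k _ ->|] //.
by move=> h; exfalso; move: h (ltn_ord i); lia.
Qed.

Lemma jordan_exp_factor n a : (a <= n)%N ->
  jordan n ^+ (n - a) = jordan_in n a *m jordan_out a n.
Proof.
move=> an; rewrite jordan_exp; apply/matrixP => i j; rewrite !mxE.
under eq_bigr do rewrite !mxE mulrC.
rewrite (@sum_delta _ (fun k => (i == (k + (n - a))%N :> nat)%:R)
   j (fun k => k == j :> nat)) //.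
case: insubP => [k _ ->|] //.
by move=> h; case: eqP => // ij; exfalso; move: h (ltn_ord i); lia.
Qed.

Lemma jordan_in_comm n a : (a <= n)%N ->
  jordan n *m jordan_in n a = jordan_in n a *m jordan a.
Proof.
move=> an; apply/matrixP => i j; rewrite !mxE.
under eq_bigr do rewrite !mxE mulrC.
rewrite (@sum_delta _ (fun k => (i == k.+1 :> nat)%:R)
   (j + (n - a))%N (fun k => k == j + (n - a) :> nat)%N) //.
under [RHS]eq_bigr do rewrite !mxE mulrC.
rewrite (@sum_delta _ (fun k => (i == (k + (n - a))%N :> nat)%:R)
   j.+1 (fun k => k == j.+1 :> nat)%N) //.
case: insubP => [k _ ->|]; last by move: (ltn_ord j); lia.
case: insubP => [k' _ ->|h]; first by rewrite addSn.
by case: eqP => // ij; exfalso; move: h (ltn_ord i) (ltn_ord j); lia.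
Qed.

Lemma rank_jordan_exp n l : \rank (jordan n ^+ l) = (n - l)%N.
Proof.
case: (leqP l n) => ln; last first.
  have -> : jordan n ^+ l = 0.
    rewrite jordan_exp; apply/matrixP => i j; rewrite !mxE.
    by case: eqP => // ij; move: (ltn_ord i); lia.
  by rewrite mxrank0; lia.
rewrite -{1}(subKn ln) jordan_exp_factor ?leq_subr //.
rewrite -[jordan_in _ _]mulmx1.
rewrite (mulmx_inj_rank _ (jordan_inK _) (jordan_outK _)) ?leq_subr //.
by rewrite mxrank1.
Qed.

Lemma jordan_nilp n : jordan n ^+ n = 0.
Proof. by apply/eqP; rewrite -mxrank_eq0 rank_jordan_exp subnn. Qed.

(** Let [A ^ N] be the last nonzero power and [(i0, j0)] the position of a
    nonzero entry.  The cyclic space of the basis vector [j0] is paired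
    perfectly with the linear forms [v |-> (A ^ i v)_(i0)], whose common kernel
    is an [A]-stable complement. *)
Lemma nilpotent_splits m (A : 'M[F]_m.+1) L : A ^+ L = 0 ->
  exists a m' (A' : 'M[F]_m'), (0 < a)%N /\ splits A (jordan a) A'.
Proof.
move=> AL; have exN : exists N, A ^+ N == 0 by exists L; rewrite AL.
case: (ex_minnP exN) => -[|N].
  by rewrite expr0 => /eqP/matrixP/(_ 0 0); rewrite !mxE /= => /eqP; rewrite oner_eq0.
move=> /eqP AN minN.
have ANz s : (N < s)%N -> A ^+ s = 0.
  by move=> Ns; rewrite -(subnK Ns) exprD AN mulr0.
have /matrix0Pn [i0 [j0 c0]] : A ^+ N != 0.
  by apply/negP => /minN; rewrite ltnn.
pose g s := (A ^+ s) i0 j0.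
pose E1 : 'M[F]_(m.+1, N.+1) := \matrix_(i, j) (A ^+ j) i j0.
pose P : 'M[F]_(N.+1, m.+1) := \matrix_(i, j) (A ^+ i) i0 j.
have GE : P *m E1 = \matrix_(i, j) g (i + j)%N.
  apply/matrixP => i j; rewrite !mxE /g exprD -mulmxE !mxE.
  by apply: eq_bigr => k _; rewrite !mxE.
have Gfree : row_free (P *m E1).
  apply: inj_row_free => v; rewrite GE => v0; apply/rowP => i; rewrite mxE.
  (* The matrix is of Hankel type, zero below a nonzero anti-diagonal. *)
  have [k ik] := ubnP i; elim: k i ik => // k IH i ik.
  have iN : (i + rev_ord i = N)%N by have := ltn_ord i; rewrite /=; lia.
  move/rowP/(_ (rev_ord i)): v0; rewrite !mxE (bigD1 i) // big1.
    rewrite mxE iN [LHS]addr0 => /eqP.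
    by rewrite mulf_eq0 (negbTE c0) orbF => /eqP.
  move=> j ji; rewrite mxE; case: (ltnP j i) => h.
    by rewrite IH ?mul0r //; lia.
  rewrite /g ANz ?mxE ?mulr0 //; move: (ltn_ord i) iN.
  have : (j : nat) <> i by move=> /val_inj jj; rewrite jj eqxx in ji.
  lia.
have Gunit : P *m E1 \in unitmx by rewrite -row_free_unit.
pose D1 := invmx (P *m E1) *m P.
have DE1 : D1 *m E1 = 1%:M by rewrite -mulmxA mulVmx.
have AE1 : A *m E1 = E1 *m jordan N.+1.
  apply/matrixP => i j; rewrite !mxE.
  under [RHS]eq_bigr do rewrite !mxE mulrC.
  rewrite (@sum_delta _ (fun k => (A ^+ k) i j0) j.+1
    (fun k => k == j.+1 :> nat)) //.
  transitivity ((A ^+ j.+1) i j0).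
    by rewrite exprS -mulmxE mxE; apply: eq_bigr => k _; rewrite mxE.
  case: insubP => [k _ ->|h] //; rewrite ANz ?mxE //; lia.
pose R := 1%:M - E1 *m D1.
have DR : D1 *m R = 0 by rewrite mulmxBr mulmx1 mulmxA DE1 mul1mx subrr.
have RE : R *m E1 = 0 by rewrite mulmxBl mul1mx -mulmxA DE1 mulmx1 subrr.
have RR : R *m R = R.
  by rewrite {1}/R mulmxBl mul1mx -mulmxA DR mulmx0 subr0.
have PR : P *m R = 0.
  have -> : P = (P *m E1) *m D1 by rewrite mulmxA mulmxV // mul1mx.
  by rewrite -mulmxA DR mulmx0.
have PAR : P *m A *m R = 0.
  have -> : P *m A = (\matrix_(i, j) (j == i.+1 :> nat)%:R) *m P.
    apply/matrixP => i j; rewrite !mxE.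
    under [RHS]eq_bigr do rewrite !mxE.
    rewrite (@sum_delta _ (fun k => (A ^+ k) i0 j) i.+1
      (fun k => k == i.+1 :> nat)) //.
    transitivity ((A ^+ i.+1) i0 j).
      by rewrite exprSr -mulmxE mxE; apply: eq_bigr => k _; rewrite mxE.
    case: insubP => [k _ ->|h] //; rewrite ANz ?mxE //; lia.
  by rewrite -mulmxA PR mulmx0.
have [r [E2 [D2 [ED2 Efree Dfree]]]] :
    exists r (E2 : 'M_(m.+1, r)) (D2 : 'M_(r, m.+1)),
      [/\ E2 *m D2 = R, row_full E2 & row_free D2].
  exists (\rank R), (col_base R), (row_base R).
  by rewrite mulmx_base col_base_full row_base_free.
have canE p (X Y : 'M_(_, p)) : E2 *m X = E2 *m Y -> X = Y.
  by apply: row_full_inj.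
have canD p (X Y : 'M_(p, _)) : X *m D2 = Y *m D2 -> X = Y.
  by apply: row_free_inj.
have DE2 : D2 *m E2 = 1%:M.
  apply: canD; apply: canE; rewrite mul1mx.
  by rewrite -(mulmxA D2) (mulmxA E2) ED2 RR.
have RE2 : R *m E2 = E2 by rewrite -ED2 -mulmxA DE2 mulmx1.
exists N.+1, r, (D2 *m A *m E2); split=> //.
exists E1, E2, D1, D2; split.
- by rewrite ED2 /R addrC subrK.
- split=> //.
  + by rewrite -RE2 mulmxA DR mul0mx.
  + by apply: canE; rewrite mulmx0 mulmxA ED2 RE.
- exact: AE1.
- rewrite !mulmxA ED2 /R !mulmxBl mul1mx.
  rewrite -[X in _ - X]mulmxA -[X in _ - X]mulmxA /D1 -!mulmxA.
  have -> : P *m (A *m E2) = 0 by rewrite -RE2 !mulmxA PAR mul0mx.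
  by rewrite !mulmx0 subr0.
Qed.

Lemma telescope_second_difference (phi : nat -> int) b : phi 0%N = 0 ->
  \sum_(l < b.+1) (phi l.+1 - 2 * phi l + phi l.-1) = phi b.+1 - phi b.
Proof.
move=> phi0; elim: b => [|b IH]; first by rewrite big_ord_recr big_ord0 /= phi0; lia.
by rewrite big_ord_recr IH /=; lia.
Qed.

Lemma sum_second_difference (phi : nat -> int) a L :
  phi 0%N = 0 -> (a <= L)%N ->
  \sum_(l < L) (a - l)%:Z * (phi l.+1 - 2 * phi l + phi l.-1) = phi a.
Proof.
move=> phi0; pose psi l := phi l.+1 - 2 * phi l + phi l.-1.
have telescope b : \sum_(l < b.+1) psi l = phi b.+1 - phi b.
  exact: telescope_second_difference.
elim: a => [|a IH] aL.
  by rewrite phi0 big1 // => l _; rewrite sub0n mul0r.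
have -> : phi a.+1 = phi a + (phi a.+1 - phi a) by rewrite addrC subrK.
rewrite -telescope -IH ?(ltnW aL) //.
rewrite (big_ord_widen L psi aL) [X in _ + X]big_mkcond /= -big_split /=.
apply: eq_bigr => l _; case: ltnP => la; last first.
  have -> : (a.+1 - l = 0)%N by apply/eqP; rewrite subn_eq0.
  have -> : (a - l = 0)%N by apply/eqP; rewrite subn_eq0 ltnW.
  by rewrite addr0.
by rewrite subSn // -addn1 PoszD mulrDl mul1r.
Qed.

(** Since a nilpotent matrix is a sum of Jordan blocks and has
    [rank (A ^ (l - 1)) - 2 rank (A ^ l) + rank (A ^ (l + 1))] blocks of size
    [l], summation by parts evaluates every additive invariant on it. *)
Lemma additive_invariant (Phi : forall m, 'M[F]_m -> int)
    (PhiD : forall m m1 m2 (A : 'M_m) (A1 : 'M_m1) (A2 : 'M_m2),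
       splits A A1 A2 -> Phi m A = Phi m1 A1 + Phi m2 A2)
    (Phi0 : forall A : 'M_0, Phi 0%N A = 0)
    (phi := fun l => Phi l (jordan l)) m (A : 'M[F]_m) L : A ^+ L = 0 ->
  Phi m A = \sum_(l < L) (\rank (A ^+ l))%:Z
              * (phi l.+1 - 2 * phi l + phi l.-1).
Proof.
have phi0 : phi 0%N = 0 by apply: Phi0.
have [k mk] := ubnP m; elim: k m A mk => // k IH [|m] A mk AL.
  rewrite Phi0 big1 // => l _.
  by rewrite (_ : \rank (A ^+ l) = 0%N) ?mul0r //; apply/eqP; rewrite -leqn0 rank_leq_row.
have [a [m' [A' [a0 sA]]]] := nilpotent_splits AL.
have mE : m.+1 = (a + m')%N.
  by have := splits_rank_exp 0 sA; rewrite !expr0 -!idmxE !mxrank1.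
have := splits_rank_exp L sA; rewrite AL mxrank0 rank_jordan_exp => rL.
have [aL A'L] : (a <= L)%N /\ A' ^+ L = 0.
  move/esym/eqP: rL; rewrite addn_eq0 mxrank_eq0 subn_eq0.
  by case/andP=> ? /eqP.
rewrite (PhiD _ _ _ _ _ _ sA) (IH _ A' _ A'L); last first.
  by rewrite -ltnS (leq_trans _ mk) // ltnS mE -[X in (X < _)%N]add0n ltn_add2r.
rewrite -[Phi a _]/(phi a) -(sum_second_difference phi0 aL).
rewrite -big_split; apply: eq_bigr => l _.
by rewrite (splits_rank_exp l sA) rank_jordan_exp PoszD [RHS]mulrDl.
Qed.

End Splitting.
(** * Kronecker sums of nilpotent matrices in characteristic two *)

Local Arguments mxtens_index : simpl never.
Local Arguments mxtens_unindex : simpl never.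

Section KroneckerSum.
Variable F : fieldType.
Local Notation jordan := (@jordan F).

Lemma sum_pred1 (I : finType) (k : I) (G : I -> F) :
  \sum_i (i == k)%:R * G i = G k.
Proof.
rewrite (bigD1 k) //= eqxx mul1r big1 ?addr0 // => i /negbTE ->.
by rewrite mul0r.
Qed.

Lemma tens1 m n : (1%:M : 'M[F]_m) *t (1%:M : 'M[F]_n) = 1%:M.
Proof.
apply/matrixP => i j.
case: (mxtens_indexP i) => i0 i1; case: (mxtens_indexP j) => j0 j1.
rewrite tensmxE !mxE (can_eq (@mxtens_indexK _ _)) xpair_eqE.
by case: (i0 == j0); rewrite ?mul1r ?mul0r.
Qed.

Lemma tensDl m n p q (A B : 'M[F]_(m, n)) (C : 'M[F]_(p, q)) :
  (A + B) *t C = A *t C + B *t C.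
Proof. by apply/matrixP => i j; rewrite !mxE mulrDl. Qed.

Lemma tensDr m n p q (A B : 'M[F]_(m, n)) (C : 'M[F]_(p, q)) :
  C *t (A + B) = C *t A + C *t B.
Proof. by apply/matrixP => i j; rewrite !mxE mulrDr. Qed.

Lemma tensZl m n p q c (A : 'M[F]_(m, n)) (B : 'M[F]_(p, q)) :
  (c *: A) *t B = c *: (A *t B).
Proof. by apply/matrixP => i j; rewrite !mxE mulrA. Qed.

Lemma tensZr m n p q c (A : 'M[F]_(m, n)) (B : 'M[F]_(p, q)) :
  A *t (c *: B) = c *: (A *t B).
Proof. by apply/matrixP => i j; rewrite !mxE mulrCA. Qed.

Lemma tens_exp m n (A : 'M[F]_m) (B : 'M[F]_n) l :
  (A *t B) ^+ l = (A ^+ l) *t (B ^+ l).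
Proof.
elim: l => [|l IH]; first by rewrite !expr0 -!idmxE tens1.
by rewrite !exprS IH -!mulmxE tensmx_mul.
Qed.

Lemma mxrank_tens m n p q (A : 'M[F]_(m, n)) (B : 'M[F]_(p, q)) :
  \rank (A *t B) = (\rank A * \rank B)%N.
Proof.
have inv m' n' (C : 'M[F]_(m', n')) :
    exists D E, D *m col_base C = 1%:M /\ row_base C *m E = 1%:M.
  have /row_freeP [E HE] := row_base_free C.
  have /row_fullP [D HD] := col_base_full C.
  by exists D, E.
have [DA [EA [DA1 EA1]]] := inv _ _ A.
have [DB [EB [DB1 EB1]]] := inv _ _ B.
rewrite -{1}(mulmx_base A) -{1}(mulmx_base B) -tensmx_mul.
rewrite -[col_base A *t _]mulmx1.
rewrite (@mulmx_inj_rank _ _ _ _ _ _ _ (DA *t DB) (EA *t EB)).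
- by rewrite mxrank1.
- by rewrite tensmx_mul DA1 DB1 tens1.
- by rewrite tensmx_mul EA1 EB1 tens1.
Qed.

(** The action of the sum [X + Y] on a tensor product of a [k[X]]-module and
    a [k[Y]]-module. *)
Definition ksum m n (A : 'M[F]_m) (B : 'M[F]_n) : 'M[F]_(m * n) :=
  A *t 1%:M + 1%:M *t B.

Lemma splits_ksum m m1 m2 n (A : 'M[F]_m) (A1 : 'M_m1) (A2 : 'M_m2)
    (B : 'M_n) :
  splits A A1 A2 -> splits (ksum A B) (ksum A1 B) (ksum A2 B).
Proof.
case=> E1 [E2 [D1 [D2 [ED [D11 D22 D12 D21] AE1 AE2]]]].
exists (E1 *t 1%:M), (E2 *t 1%:M), (D1 *t 1%:M), (D2 *t 1%:M); split.
- by rewrite !tensmx_mul -tensDl ED mulmx1 tens1.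
- by rewrite !tensmx_mul D11 D22 D12 D21 !mulmx1 !tens1 !tens0mx.
- by rewrite mulmxDl mulmxDr !tensmx_mul AE1 !mul1mx !mulmx1.
- by rewrite mulmxDl mulmxDr !tensmx_mul AE2 !mul1mx !mulmx1.
Qed.

Lemma rank_exp_reindex m n (A : 'M[F]_m) (B : 'M[F]_n) f g l :
  cancel f g -> cancel g f -> (forall i j, A i j = B (f i) (f j)) ->
  \rank (A ^+ l) = \rank (B ^+ l).
Proof.
move=> fK gK AB.
pose M : 'M[F]_(m, n) := \matrix_(i, j) (j == f i)%:R.
pose D : 'M[F]_(n, m) := \matrix_(j, i) (i == g j)%:R.
have MX p (X : 'M[F]_(n, p)) i j : (M *m X) i j = X (f i) j.
  by rewrite mxE -(sum_pred1 (f i) (X^~ j)); apply: eq_bigr => k _; rewrite mxE.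
have DX p (X : 'M[F]_(m, p)) i j : (D *m X) i j = X (g i) j.
  by rewrite mxE -(sum_pred1 (g i) (X^~ j)); apply: eq_bigr => k _; rewrite mxE.
apply: (@similar_rank_exp _ _ _ _ _ M D).
- by apply/matrixP => i j; rewrite DX !mxE gK eq_sym.
- by apply/matrixP => i j; rewrite MX !mxE fK eq_sym.
apply/matrixP => i j; rewrite MX mxE -[j]gK -AB -(sum_pred1 (g j) (A i)).
apply: eq_bigr => k _; rewrite mxE mulrC gK; congr (_%:R * _).
by rewrite eq_sym (can2_eq fK gK).
Qed.

Lemma rank_ksumC m n (A : 'M[F]_m) (B : 'M[F]_n) l :
  \rank (ksum A B ^+ l) = \rank (ksum B A ^+ l).
Proof.
pose sw p q (k : 'I_(p * q)) :=
  mxtens_index ((mxtens_unindex k).2, (mxtens_unindex k).1).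
have swK p q : cancel (@sw p q) (@sw q p).
  by move=> k; case: (mxtens_indexP k) => i j; rewrite /sw !mxtens_indexK.
apply: (rank_exp_reindex _ (swK m n) (swK n m)) => i j.
case: (mxtens_indexP i) => i0 i1; case: (mxtens_indexP j) => j0 j1.
rewrite /sw !mxE !mxtens_indexK addrC.
by rewrite [A _ _ * _]mulrC [_ * B _ _]mulrC.
Qed.

Hypothesis char2 : 1 + 1 = 0 :> F.

Lemma mx_char2 m n (A : 'M[F]_(m, n)) : A + A = 0.
Proof.
by apply/matrixP => i j; rewrite !mxE -[A i j]mul1r -mulrDl char2 mul0r.
Qed.

Lemma mx_opp m n (A : 'M[F]_(m, n)) : - A = A.
Proof. by apply/esym/eqP; rewrite -addr_eq0 mx_char2. Qed.

Lemma exprD2_char2 m (A B : 'M[F]_m) : A * B = B * A ->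
  (A + B) ^+ 2 = A ^+ 2 + B ^+ 2.
Proof.
move=> AB; rewrite !expr2 mulrDl !mulrDr AB addrA -(addrA (A * A)).
by rewrite mx_char2 addr0.
Qed.

Lemma exprD_char2 m (A B : 'M[F]_m) n : A * B = B * A ->
  (A + B) ^+ (2 ^ n) = A ^+ (2 ^ n) + B ^+ (2 ^ n).
Proof.
move=> AB; elim: n => [|n IH]; first by rewrite !expn0 !expr1.
rewrite expnSr !exprM IH exprD2_char2 //.
exact: (commrX _ (commr_sym (commrX _ (commr_sym AB)))).
Qed.

Lemma ksum_comm m n (A : 'M[F]_m) (B : 'M[F]_n) :
  (A *t 1%:M) * (1%:M *t B) = (1%:M *t B) * (A *t 1%:M).
Proof. by rewrite -!mulmxE !tensmx_mul !mul1mx !mulmx1. Qed.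

Lemma ksum_exp m n (A : 'M[F]_m) (B : 'M[F]_n) e :
  ksum A B ^+ (2 ^ e) = ksum (A ^+ (2 ^ e)) (B ^+ (2 ^ e)).
Proof. by rewrite exprD_char2 ?ksum_comm // !tens_exp !expr1n. Qed.

Lemma ksum_nilp m n (A : 'M[F]_m) (B : 'M[F]_n) e :
  A ^+ (2 ^ e) = 0 -> B ^+ (2 ^ e) = 0 -> ksum A B ^+ (2 ^ e) = 0.
Proof. by move=> A0 B0; rewrite ksum_exp A0 B0 /ksum tens0mx tensmx0 addr0. Qed.

(** ** The free module over a truncated polynomial ring *)

(** If the last nonzero power of [Y] has rank at least [w], then by the
    convexity of the ranks all their successive differences are [w]. *)
Lemma rank_exp_free q w (Y : 'M[F]_(q * w)) l :
  Y ^+ q = 0 -> (0 < q -> w <= \rank (Y ^+ q.-1))%N -> (l <= q)%N ->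
  \rank (Y ^+ l) = ((q - l) * w)%N.
Proof.
move=> Yq Yw lq.
have drop i : (i < q)%N -> (\rank (Y ^+ i.+1) + w <= \rank (Y ^+ i))%N.
  move=> iq; have := mxrank_Frobenius Y (Y ^+ i) (Y ^+ (q.-1 - i)).
  rewrite !mulmxE -exprS -!exprD.
  have -> : (i + (q.-1 - i) = q.-1)%N by lia.
  have -> : (i.+1 + (q.-1 - i) = q)%N by lia.
  by rewrite Yq mxrank0 addn0; apply: leq_trans; rewrite leq_add2l Yw //; lia.
apply/eqP; rewrite eqn_leq; apply/andP; split.
  have : (\rank (Y ^+ l) + l * w <= q * w)%N.
    elim: l lq => [|l IH] lq; first by rewrite expr0 -idmxE mxrank1 addn0.
    rewrite mulSn addnA (leq_trans _ (IH (ltnW lq))) // leq_add2r.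
    exact: drop.
  by rewrite mulnBl leq_subRL ?leq_mul2r ?lq ?orbT // addnC.
have [d dq] : exists d, (q - l = d)%N by exists (q - l)%N.
elim: d l lq dq => [|d IH] l lq dq; first by rewrite dq.
have lq' : (l < q)%N by lia.
rewrite (leq_trans _ (drop _ lq')) // dq mulSn addnC leq_add2r.
by rewrite (_ : d = q - l.+1)%N ?IH //; lia.
Qed.

Section Reflection.
Variables (w e : nat) (T : 'M[F]_w).
Local Notation q := (2 ^ e)%N.
Hypothesis Tq : T ^+ q = 0.

Let X : 'M[F]_(q * w) := jordan q *t 1%:M.
Let Z : 'M[F]_(q * w) := ksum (jordan q) T.
Let T' : 'M[F]_(q * w) := 1%:M *t T.

Let q_gt0 : (0 < q)%N. Proof. by rewrite expn_gt0. Qed.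

Let ev i : 'M[F]_(1 * w, q * w) := (\row_j (j == i :> nat)%:R) *t 1%:M.
Let E0 : 'M[F]_(q * w, 1 * w) := (\col_j (j == 0 :> nat)%:R) *t 1%:M.

Let XZ : X * Z = Z * X.
Proof. by rewrite mulrDr mulrDl ksum_comm. Qed.

Let ZT : Z * T' = T' * Z. Proof. by rewrite mulrDr mulrDl -ksum_comm. Qed.

Let Xq : X ^+ q = 0.
Proof. by rewrite tens_exp jordan_nilp tens0mx. Qed.

Let Zq : Z ^+ q = 0.
Proof. by rewrite ksum_nilp ?jordan_nilp. Qed.

Let rankX l : (l <= q)%N -> \rank (X ^+ l) = ((q - l) * w)%N.
Proof. by move=> lq; rewrite tens_exp expr1n mxrank_tens mxrank1 rank_jordan_exp. Qed.

(* The expansion of (X + T)^j has degree j in X with leading coefficient 1. *)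
Let ev_top i j : (i < q)%N -> (j <= i)%N ->
  ev i *m Z ^+ j *m E0 = if i == j then 1%:M else 0.
Proof.
elim: j i => [|j IH] i iq ji.
  rewrite expr0 -idmxE mulmx1 tensmx_mul mulmx1.
  have -> : (\row_j (j == i :> nat)%:R : 'rV_q) *m (\col_j (j == 0 :> nat)%:R)
      = (i == 0%N)%:R%:M :> 'M[F]_1.
    apply/matrixP => a b; rewrite !mxE !ord1 /= mulr1n.
    under eq_bigr do rewrite !mxE.
    rewrite (@sum_delta _ _ (fun k : 'I_q => (k == 0 :> nat)%:R) i
      (fun k => k == i :> nat)) //.
    by case: insubP => [k _ ->|]; rewrite ?iq.
  case: (i == 0%N); first by rewrite tens1.
  by rewrite (_ : 0%:R%:M = 0) ?tens0mx //; apply/matrixP => a b; rewrite !mxE mul0rn.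
have i0 : (0 < i)%N by lia.
have evZ : ev i *m Z = ev i.-1 + (1%:M *t T) *m ev i.
  rewrite mulmxDr !tensmx_mul !mul1mx !mulmx1; congr (_ *t _ + _).
  apply/matrixP => a b; rewrite !mxE.
  under eq_bigr do rewrite !mxE.
  rewrite (@sum_delta _ _ (fun k : 'I_q => (k == b.+1 :> nat)%:R) i
      (fun k => k == i :> nat)) //.
  case: insubP => [k _ ->|]; last by rewrite iq.
  by rewrite -{1}(prednK i0) eqSS eq_sym.
rewrite exprS -mulmxE mulmxA evZ !mulmxDl -(mulmxA (1%:M *t T)) -(mulmxA (1%:M *t T)).
rewrite IH; [|lia|lia]; rewrite IH; [|lia|lia].
have -> : (i == j) = false by lia.
by rewrite mulmx0 addr0 -{2}(prednK i0) eqSS.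
Qed.

Let top_ev : ev q.-1 *m (Z ^+ q.-1 *m E0) = 1%:M.
Proof. by rewrite mulmxA ev_top ?eqxx // prednK. Qed.

Let rankZ l : (l <= q)%N -> \rank (Z ^+ l) = ((q - l) * w)%N.
Proof.
apply: rank_exp_free => // _.
apply: leq_trans (_ : \rank (ev q.-1 *m (Z ^+ q.-1 *m E0)) <= _)%N.
  by rewrite top_ev mxrank1 mul1n.
by rewrite (leq_trans (mxrankM_maxr _ _)) // mxrankM_maxl.
Qed.

Let rank_block a l : (a <= q)%N ->
  \rank (ksum (jordan a) T ^+ l) = \rank (Z ^+ l *m X ^+ (q - a)).
Proof.
move=> aq; rewrite tens_exp expr1n jordan_exp_factor // -idmxE.
have -> : jordan_in F q a *m jordan_out F a q *t 1%:M
    = (jordan_in F q a *t 1%:M) *m (jordan_out F a q *t (1%:M : 'M[F]_w)).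
  by rewrite tensmx_mul mulmx1.
rewrite mulmxA.
rewrite (@intertwine_exp _ _ _ Z (ksum (jordan a) T)); last first.
  by rewrite mulmxDl mulmxDr !tensmx_mul jordan_in_comm // !mul1mx !mulmx1.
set D := \matrix_(i < a, j < q) (j == (i + (q - a))%N :> nat)%:R : 'M[F]_(a, q).
set E := \matrix_(i < q, j < a) (i == j :> nat)%:R : 'M[F]_(q, a).
rewrite (@mulmx_inj_rank _ _ _ _ _ _ _ (D *t 1%:M) (E *t 1%:M)) //.
  by rewrite tensmx_mul jordan_inK // mulmx1 tens1.
by rewrite tensmx_mul jordan_outK // mulmx1 tens1.
Qed.

Let ker_exp (Y : 'M[F]_(q * w)) i :
  Y ^+ q = 0 -> (forall l, (l <= q)%N -> \rank (Y ^+ l) = ((q - l) * w)%N) ->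
  (i <= q)%N -> (Y ^+ (q - i) :=: kermx (Y ^+ i))%MS.
Proof.
move=> Yq rY iq; apply/eqmxP; rewrite -mxrank_leqif_eq.
  by rewrite mxrank_ker !rY ?leq_subr // subKn // -mulnBl subKn.
by apply/sub_kermxP; rewrite mulmxE -exprD subnK.
Qed.

(** The module [X ^ i F] of a free module [F] is isomorphic to a block, and
    passing to the kernels of both powers exchanges a block with the
    complementary one. *)
Lemma rank_ksum_reflect a l : (a <= q)%N -> (l <= q)%N ->
  (\rank (ksum (jordan a) T ^+ l) + l * w
     = a * w + \rank (ksum (jordan (q - a)) T ^+ (q - l)))%N.
Proof.
move=> aq lq; rewrite !rank_block ?leq_subr // subKn //.
have := mxrank_mul_ker (Z ^+ l) (X ^+ (q - a)).
have := mxrank_mul_ker (X ^+ a) (Z ^+ (q - l)).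
rewrite rankX // rankZ //.
have Ek := ker_exp Xq rankX (leq_subr a q); rewrite subKn // in Ek.
have El := ker_exp Zq rankZ (leq_subr l q); rewrite subKn // in El.
rewrite -(cap_eqmx (eqmx_refl (Z ^+ l)) Ek) -(cap_eqmx (eqmx_refl (X ^+ a)) El).
rewrite capmxC !mulmxE (commrX _ (commr_sym (commrX _ (commr_sym XZ)))).
rewrite !mulnBl; have := leq_mul aq (leqnn w); have := leq_mul lq (leqnn w); lia.
Qed.

(** Since [Z Z ^ (q - 1) = 0], multiplication by [X] is [- T] on the image of
    [Z ^ (q - 1)], and that image is a copy of the module on which [T] acts. *)
Lemma rank_ksum_top a : (a <= q)%N ->
  \rank (ksum (jordan a) T ^+ q.-1) = \rank (T ^+ (q - a)).
Proof.
move=> aq; rewrite rank_block //; set i := (q - a)%N.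
have ZX : Z ^+ q.-1 * X = Z ^+ q.-1 * T'.
  have : Z ^+ q.-1 * Z = 0 by rewrite -exprSr prednK.
  by rewrite mulrDr => /eqP; rewrite addr_eq0 mx_opp => /eqP.
have -> : Z ^+ q.-1 *m X ^+ i = T' ^+ i *m Z ^+ q.-1.
  rewrite !mulmxE.
  elim: i => [|i IH]; first by rewrite !expr0 mul1r mulr1.
  rewrite exprSr mulrA IH -mulrA ZX [T' ^+ i.+1]exprSr -mulrA; congr (_ * _).
  exact: (commr_sym (commrX _ (commr_sym ZT))).
set V := Z ^+ q.-1 *m E0; set L := ev q.-1.
have LV : L *m V = 1%:M by apply: top_ev.
have rV : \rank V = w.
  apply/eqP; rewrite eqn_leq; apply/andP; split.
    by rewrite (leq_trans (rank_leq_col _)) // mul1n.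
  apply: leq_trans (mxrankM_maxr L V).
  by rewrite LV mxrank1 mul1n.
have VY : Z ^+ q.-1 = V *m (L *m Z ^+ q.-1).
  have /submxP[D DV] : ((Z ^+ q.-1)^T <= V^T)%MS.
    rewrite -(mxrank_leqif_sup _).2.
      by rewrite !mxrank_tr rV rankZ ?leq_pred // -subn1 subKn // mul1n.
    by rewrite /V trmx_mul submxMl.
  have VD : Z ^+ q.-1 = V *m D^T by rewrite -[LHS]trmxK DV trmx_mul trmxK.
  by rewrite [in RHS]VD (mulmxA L) LV mul1mx.
have T'V : T' ^+ i *m V = V *m (1%:M *t T ^+ i).
  rewrite mulmxA -/(_ *m _) mulmxE.
  have -> : T' ^+ i * Z ^+ q.-1 = Z ^+ q.-1 * T' ^+ i.
    exact: (commrX _ (commr_sym (commrX _ ZT))).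
  rewrite -mulmxE -!mulmxA tens_exp expr1n; congr (_ *m _).
  by rewrite !tensmx_mul !mul1mx !mulmx1.
rewrite VY mulmxA T'V.
rewrite (mulmx_inj_rank _ LV (_ : _ *m E0 = 1%:M)).
  by rewrite mxrank_tens mxrank1 mul1n.
by rewrite -mulmxA LV.
Qed.

End Reflection.

End KroneckerSum.
(** * The alternating sum of the ranks *)

Section OddBlocks.

(** The number of Jordan blocks of size [q - l] of multiplication by [u v] on
    [k[u, v] / (u ^ q, v ^ q)]: the blocks are the diagonals of the square of
    monomials. *)
Definition mult (l : nat) : int := if l == 0%N then 1 else 2.

Definition rank_sum (q : nat) (r : nat -> nat) : int :=
  \sum_(l < q) mult l * (r l)%:Z.

(** When [r l] is the rank of the [l]-th power of a nilpotent matrix, this is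
    the number of its Jordan blocks of odd size. *)
Definition odd_blocks (q : nat) (r : nat -> nat) : int :=
  \sum_(l < q) (-1) ^+ l * mult l * (r l)%:Z.

Lemma rank_sum_rev q r : (0 < q)%N -> r q = 0%N ->
  rank_sum q r = (r 0%N)%:Z + \sum_(l < q) mult l * (r (q - l)%N)%:Z.
Proof.
case: q => // q _ rq; rewrite /rank_sum !big_ord_recl subn0 rq mulr0 add0r mul1r.
congr (_ + _); rewrite [RHS](reindex_inj rev_ord_inj); apply: eq_bigr => l _.
congr (_ * (r _)%:Z); rewrite /= /bump /=; have := ltn_ord l; lia.
Qed.

Lemma sum_mult q : \sum_(l < q.+1) mult l = 2 * q%:Z + 1.
Proof.
by elim: q => [|q IH]; rewrite big_ord_recr ?big_ord0 ?IH /mult //=; lia.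
Qed.

Lemma sum_mult_pred q : (0 < q)%N ->
  \sum_(l < q) mult l * (q - l).-1%:Z = (q%:Z - 1) ^+ 2.
Proof.
case: q => // q _; have -> : q.+1%:Z - 1 = q%:Z by lia.
elim: q => [|q IH]; first by rewrite big_ord_recr big_ord0.
rewrite big_ord_recr /= subSnn /= mulr0 addr0.
transitivity (\sum_(l < q.+1) (mult l * (q.+1 - l).-1%:Z + mult l)).
  apply: eq_bigr => l _; have := ltn_ord l; rewrite ltnS => lq.
  by rewrite !subSn //= 1?ltnW //; lia.
rewrite big_split /= IH sum_mult; lia.
Qed.

Lemma eq_odd_blocks q r1 r2 : r1 =1 r2 -> odd_blocks q r1 = odd_blocks q r2.
Proof. by move=> r12; apply: eq_bigr => l _; rewrite r12. Qed.

Lemma odd_blocks_trunc p q r : (p <= q)%N ->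
  (forall l, (p <= l)%N -> r l = 0%N) -> odd_blocks q r = odd_blocks p r.
Proof.
move=> pq r0; rewrite /odd_blocks.
rewrite (big_ord_widen q (fun l => (-1) ^+ l * mult l * (r l)%:Z) pq) [RHS]big_mkcond.
by apply: eq_bigr => l _; case: ltnP => // /r0 ->; rewrite mulr0.
Qed.

Lemma sign_double q : (-1) ^+ (q * 2) = 1 :> int.
Proof. by rewrite muln2 -signr_odd odd_double. Qed.

(** The odd terms cancel. *)
Lemma rank_sum_even q r :
  rank_sum (q * 2) r + odd_blocks (q * 2) r
    = 2 * rank_sum q (fun l => r (l * 2)%N).
Proof.
rewrite -big_split mulr_sumr; elim: q => [|q IH]; first by rewrite !big_ord0.
rewrite mulSn [(2 + _)%N]addnC !addnS addn0 !big_ord_recr IH /= -addrA.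
congr (_ + _); rewrite !exprS sign_double /mult muln_eq0 orbF.
by case: (q == 0%N); rewrite /=; lia.
Qed.

Lemma alternating_sum_odd q :
  \sum_(l < (q * 2).+1) (-1) ^+ l.+1 = -1 :> int.
Proof.
elim: q => [|q IH]; first by rewrite big_ord_recr big_ord0.
rewrite mulSn [(2 + _)%N]addnC !addnS addn0 2!big_ord_recr IH /=.
by rewrite !exprS sign_double; lia.
Qed.

Lemma alternating_sum_id_odd q :
  \sum_(l < (q * 2).+1) (-1) ^+ l.+1 * (l.+1)%:Z = - (q.+1)%:Z :> int.
Proof.
elim: q => [|q IH]; first by rewrite big_ord_recr big_ord0.
rewrite mulSn [(2 + _)%N]addnC !addnS addn0 2!big_ord_recr IH /=.
by rewrite !exprS sign_double; lia.
Qed.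

Lemma odd_blocks_recl q r :
  odd_blocks q.+1 r
    = (r 0%N)%:Z + 2 * \sum_(l < q) (-1) ^+ l.+1 * (r l.+1)%:Z.
Proof.
rewrite /odd_blocks big_ord_recl expr0 !mul1r mulr_sumr; congr (_ + _).
by apply: eq_bigr => l _; rewrite /mult -mulrA mulrCA.
Qed.

(** As [p] is even, the reversal [l |-> p - l] keeps the signs, and the affine
    terms [a w - l w] add up to the difference of the terms at 0. *)
Lemma odd_blocks_reflect p q w a b (r s : nat -> nat) :
  p = (q.+1 * 2)%N -> (a + b = p)%N -> r 0%N = (a * w)%N ->
  s 0%N = (b * w)%N ->
  (forall l, (0 < l < p)%N -> (r l + l * w = a * w + s (p - l))%N) ->
  odd_blocks p r = odd_blocks p s.
Proof.
move=> -> ab r0 s0 rs; rewrite [(q.+1 * 2)%N]mulSn add2n !odd_blocks_recl r0 s0.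
have -> : \sum_(l < (q * 2).+1) (-1) ^+ l.+1 * (r l.+1)%:Z =
    - (a * w)%:Z + (q.+1 * w)%:Z
      + \sum_(l < (q * 2).+1) (-1) ^+ l.+1 * (s (q.+1 * 2 - l.+1)%N)%:Z.
  transitivity (\sum_(l < (q * 2).+1) ((-1) ^+ l.+1 * (a * w)%:Z
      + ((-1) ^+ l.+1 * (l.+1)%:Z * - w%:Z
      + (-1) ^+ l.+1 * (s (q.+1 * 2 - l.+1)%N)%:Z)) : int).
    apply: eq_bigr => l _; rewrite -!mulrA -!mulrDr; congr (_ * _).
    have /rs/(congr1 Posz) : (0 < l.+1 < q.+1 * 2)%N by have := ltn_ord l; lia.
    by rewrite !PoszD => /(canRL (addrK _)) ->; rewrite !PoszM; ring.
  rewrite big_split big_split /= -!mulr_suml alternating_sum_odd.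
  by rewrite alternating_sum_id_odd !PoszM; ring.
have -> : \sum_(l < (q * 2).+1) (-1) ^+ l.+1 * (s (q.+1 * 2 - l.+1)%N)%:Z
    = \sum_(l < (q * 2).+1) (-1) ^+ l.+1 * (s l.+1)%:Z :> int.
  rewrite [LHS](reindex_inj rev_ord_inj); apply: eq_bigr => l _ /=.
  have lq := ltn_ord l.
  have -> : (q.+1 * 2 - ((q * 2).+1 - l.+1).+1 = l.+1)%N by lia.
  congr (_ * _); rewrite -[LHS]signr_odd -[RHS]signr_odd; congr (_ ^+ _).
  have -> : ((q * 2).+1 - l.+1 = q * 2 - l)%N by lia.
  by rewrite /= oddB ?muln2 ?odd_double //; lia.
have /(congr1 Posz) : (a + b = q.+1 * 2)%N by [].
rewrite PoszD PoszM => /(canRL (addKr _)) bE; rewrite !PoszM bE; ring.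
Qed.

(** The second difference of the parity: it identifies [odd_blocks] as the
    additive invariant that counts the blocks of odd size. *)
Lemma odd_second_difference l :
  (odd l.+1 : nat)%:Z - 2 * (odd l : nat)%:Z + (odd l.-1 : nat)%:Z
    = (-1) ^+ l * mult l.
Proof. by case: l => // l; rewrite /mult /= exprS -signr_odd; case: (odd l). Qed.

Lemma sum_square_second_difference (phi : nat -> int) q :
  phi 0%N = 0 ->
  \sum_(l < q) ((q - l) ^ 2)%:Z * (phi l.+1 - 2 * phi l + phi l.-1)
    = \sum_(l < q) mult l * phi (q - l)%N.
Proof.
move=> phi0; pose psi l := phi l.+1 - 2 * phi l + phi l.-1.
have telescope b : \sum_(l < b.+1) psi l = phi b.+1 - phi b.
  exact: telescope_second_difference.
have sumE p : \sum_(l < p.+1) mult l * phi (p.+1 - l)%N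
    = \sum_(l < p) mult l * phi (p - l)%N + phi p + phi p.+1.
  case: p => [|p].
    by rewrite big_ord_recl !big_ord0 /mult /= subn0 phi0; lia.
  rewrite big_ord_recl [in RHS]big_ord_recl big_ord_recl /mult /= !subn0.
  have -> : \sum_(i < p) 2 * phi (p.+2 - bump 0 (bump 0 i))%N
      = \sum_(i < p) 2 * phi (p.+1 - bump 0 i)%N by [].
  have -> : (p.+2 - bump 0 0 = p.+1)%N by [].
  ring.
elim: q => [|q IH]; first by rewrite !big_ord0.
rewrite sumE -IH.
have -> : phi q = \sum_(l < q) (q - l)%:Z * psi l.
  by rewrite sum_second_difference.
rewrite -[phi q.+1](subrK (phi q)) -telescope.
have -> : phi q = \sum_(l < q) (q - l)%:Z * psi l.
  by rewrite sum_second_difference.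
have ext (G : nat -> int) : \sum_(l < q) (q - l)%:Z * G l
    = \sum_(l < q.+1) (q - l)%:Z * G l.
  by rewrite big_ord_recr /= subnn mul0r addr0.
have ext2 (G : nat -> int) : \sum_(l < q) ((q - l) ^ 2)%:Z * G l
    = \sum_(l < q.+1) ((q - l) ^ 2)%:Z * G l.
  by rewrite big_ord_recr /= subnn mul0r addr0.
rewrite ext (ext2 psi) -!big_split /=; apply: eq_bigr => l _.
have lq : (l <= q)%N by rewrite -ltnS.
rewrite subSn // -/(psi l) -addn1 sqrnD !PoszD !PoszM; lia.
Qed.

End OddBlocks.
(** * Jordan blocks of odd size in a Kronecker sum *)

Section OddBlocksOfKroneckerSum.
Variable F : fieldType.
Hypothesis char2 : 1 + 1 = 0 :> F.
Local Notation jordan := (@jordan F).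
Local Notation rk A := (fun l => \rank (A ^+ l)).

Lemma expr_ge0 m (A : 'M[F]_m) p q : (p <= q)%N -> A ^+ p = 0 -> A ^+ q = 0.
Proof. by move=> pq Ap; rewrite -(subnK pq) exprD Ap mulr0. Qed.

Lemma jordan_nilp_le a q : (a <= q)%N -> jordan a ^+ q = 0.
Proof. by move=> aq; apply: expr_ge0 aq (jordan_nilp _ _). Qed.

Lemma odd_blocks_ksum_jordanC q a w (T : 'M[F]_w) :
  odd_blocks q (rk (ksum (jordan a) T)) = odd_blocks q (rk (ksum T (jordan a))).
Proof. by apply: eq_odd_blocks => l; rewrite rank_ksumC. Qed.

Lemma odd_blocks_complement e a w (T : 'M[F]_w) :
  T ^+ (2 ^ e.+1) = 0 -> (a <= 2 ^ e.+1)%N ->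
  odd_blocks (2 ^ e.+1) (rk (ksum (jordan a) T))
    = odd_blocks (2 ^ e.+1) (rk (ksum (jordan (2 ^ e.+1 - a)) T)).
Proof.
move=> Tq aq; have q2 : (2 ^ e.+1 = (2 ^ e).-1.+1 * 2)%N.
  by rewrite prednK ?expn_gt0 // expnSr.
apply: (odd_blocks_reflect (w := w) (a := a) (b := 2 ^ e.+1 - a) q2).
- by rewrite subnKC.
- by rewrite expr0 -idmxE mxrank1.
- by rewrite expr0 -idmxE mxrank1.
- by move=> l /andP[_ /ltnW lq]; apply: rank_ksum_reflect.
Qed.

(** Complementing the sizes that exceed half of the order reduces the product
    of two blocks to a smaller order; complements keep the parity. *)
Lemma odd_blocks_jordan e a b : (a <= 2 ^ e)%N -> (b <= 2 ^ e)%N ->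
  odd_blocks (2 ^ e) (rk (ksum (jordan a) (jordan b))) = (odd a && odd b)%:Z.
Proof.
elim: e a b => [|e IH] a b.
  rewrite expn0 /odd_blocks big_ord_recl big_ord0 /= !expr0 -idmxE mxrank1 /mult /=.
  by case: a b => [|[|a]] [|[|b]].
have half c : (c <= 2 ^ e.+1)%N ->
    exists2 d, (d <= 2 ^ e)%N /\ odd d = odd c &
      d = c \/ (2 ^ e.+1 - c = d)%N.
  move=> cq; case: (leqP c (2 ^ e)) => h; first by exists c; [|left].
  exists (2 ^ e.+1 - c)%N; last by right.
  split; last by rewrite oddB // oddX.
  by rewrite leq_subLR expnS mul2n -addnn leq_add2r ltnW.
move=> aq bq; have [a' [a'q <-] Ha] := half a aq.
have [b' [b'q <-] Hb] := half b bq.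
have -> : odd_blocks (2 ^ e.+1) (rk (ksum (jordan a) (jordan b)))
    = odd_blocks (2 ^ e.+1) (rk (ksum (jordan a') (jordan b))).
  case: Ha => [->|<-] //; apply: odd_blocks_complement => //.
  exact: jordan_nilp_le.
have -> : odd_blocks (2 ^ e.+1) (rk (ksum (jordan a') (jordan b)))
    = odd_blocks (2 ^ e.+1) (rk (ksum (jordan a') (jordan b'))).
  rewrite odd_blocks_ksum_jordanC [RHS]odd_blocks_ksum_jordanC.
  case: Hb => [->|<-] //; apply: odd_blocks_complement => //.
  by apply: jordan_nilp_le; rewrite (leq_trans a'q) // leq_exp2l.
rewrite (@odd_blocks_trunc (2 ^ e)) ?IH ?leq_exp2l // => l lq.
apply/eqP; rewrite mxrank_eq0; apply/eqP/(expr_ge0 lq).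
by rewrite ksum_nilp ?jordan_nilp_le.
Qed.

Lemma odd_blocksD m1 m2 m (A : 'M[F]_m) (A1 : 'M[F]_m1) (A2 : 'M[F]_m2) q :
  splits A A1 A2 ->
  odd_blocks q (rk A) = odd_blocks q (rk A1) + odd_blocks q (rk A2).
Proof.
move=> sA; rewrite -big_split; apply: eq_bigr => l _ /=.
by rewrite (splits_rank_exp _ sA) PoszD mulrDr.
Qed.

Lemma odd_blocks_jordan_ksum e a w (T : 'M[F]_w) :
  (a <= 2 ^ e)%N -> T ^+ (2 ^ e) = 0 ->
  odd_blocks (2 ^ e) (rk (ksum (jordan a) T))
    = (odd a)%:Z * odd_blocks (2 ^ e) (rk T).
Proof.
move=> aq Tq; rewrite odd_blocks_ksum_jordanC.
rewrite (additive_invariant (Phi := fun m (A : 'M[F]_m) =>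
  odd_blocks (2 ^ e) (rk (ksum A (jordan a)))) _ _ Tq) /=; first last.
- move=> A; rewrite /odd_blocks big1 // => l _.
  by rewrite (_ : \rank _ = 0%N) ?mulr0 //; apply/eqP; rewrite -leqn0 rank_leq_row.
- by move=> m m1 m2 A A1 A2 sA; apply: odd_blocksD; apply: splits_ksum.
rewrite [in RHS]/odd_blocks mulr_sumr; apply: eq_bigr => l _.
have lq := ltn_ord l; rewrite !odd_blocks_jordan //; try lia.
rewrite -odd_second_difference; case: (odd a); rewrite ?andbT ?andbF; lia.
Qed.

(** Both sides are additive in each matrix, so it suffices to compare them on
    blocks. *)
Theorem odd_blocks_ksum e m n (A : 'M[F]_m) (B : 'M[F]_n) :
  A ^+ (2 ^ e) = 0 -> B ^+ (2 ^ e) = 0 ->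
  odd_blocks (2 ^ e) (rk (ksum A B))
    = odd_blocks (2 ^ e) (rk A) * odd_blocks (2 ^ e) (rk B).
Proof.
move=> Aq Bq.
rewrite (additive_invariant (Phi := fun m (A : 'M[F]_m) =>
  odd_blocks (2 ^ e) (rk (ksum A B))) _ _ Aq) /=; first last.
- move=> A'; rewrite /odd_blocks big1 // => l _.
  by rewrite (_ : \rank _ = 0%N) ?mulr0 //; apply/eqP; rewrite -leqn0 rank_leq_row.
- by move=> ? ? ? A' A1 A2 sA; apply: odd_blocksD; apply: splits_ksum.
rewrite mulr_suml; apply: eq_bigr => l _.
have lq := ltn_ord l; rewrite !odd_blocks_jordan_ksum //; try lia.
rewrite -odd_second_difference; lia.
Qed.

(** By [additive_invariant] the left-hand side is linear in the ranks of the
    powers of [A]. *)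
Lemma rank_ksum_proportional m m' n (A : 'M[F]_m) (A' : 'M[F]_m')
    (B : 'M[F]_n) c L d :
  A ^+ L = 0 -> A' ^+ L = 0 ->
  (forall l, \rank (A ^+ l) = c * \rank (A' ^+ l))%N ->
  (\rank (ksum A B ^+ d) = c * \rank (ksum A' B ^+ d))%N.
Proof.
move=> AL AL' AA'; apply/eqP; rewrite -eqz_nat PoszM; apply/eqP.
pose Phi p (C : 'M[F]_p) := (\rank (ksum C B ^+ d))%:Z.
have PhiD p p1 p2 (C : 'M_p) (C1 : 'M_p1) (C2 : 'M_p2) :
    splits C C1 C2 -> Phi p C = Phi p1 C1 + Phi p2 C2.
  by move=> /(splits_ksum B)/splits_rank_exp sC; rewrite /Phi sC PoszD.
have Phi0 (C : 'M_0) : Phi 0%N C = 0.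
  by apply/eqP; rewrite eqz_nat -leqn0 rank_leq_row.
rewrite -/(Phi m A) -/(Phi m' A').
rewrite (additive_invariant PhiD Phi0 AL) (additive_invariant PhiD Phi0 AL').
by rewrite mulr_sumr; apply: eq_bigr => l _; rewrite AA' PoszM mulrA.
Qed.

Lemma rank_ksum_double m m' n n' (A : 'M[F]_m) (A' : 'M[F]_m')
    (B : 'M[F]_n) (B' : 'M[F]_n') c L l :
  A ^+ (L * 2) = 0 -> B ^+ (L * 2) = 0 -> A' ^+ L = 0 -> B' ^+ L = 0 ->
  (forall l, \rank (A ^+ (l * 2)) = c * \rank (A' ^+ l))%N ->
  (forall l, \rank (B ^+ (l * 2)) = c * \rank (B' ^+ l))%N ->
  (\rank (ksum A B ^+ (l * 2)) = c * (c * \rank (ksum A' B' ^+ l)))%N.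
Proof.
rewrite ![(_ * 2)%N]mulnC !exprM => AL BL AL' BL' rA rB.
rewrite (@ksum_exp _ char2 _ _ _ _ 1).
have {}rA i : (\rank ((A ^+ 2) ^+ i) = c * \rank (A' ^+ i))%N.
  by rewrite -exprM mulnC rA.
have {}rB i : (\rank ((B ^+ 2) ^+ i) = c * \rank (B' ^+ i))%N.
  by rewrite -exprM mulnC rB.
rewrite (rank_ksum_proportional _ _ AL AL' rA).
by rewrite rank_ksumC (rank_ksum_proportional _ _ BL BL' rB) rank_ksumC.
Qed.

(** The recursion between consecutive levels: the even powers come from the
    lower level and the odd ones are midpoints up to the odd blocks. *)
Lemma rank_sum_ksum_rec e m m' n n' (A : 'M[F]_m) (A' : 'M[F]_m')
    (B : 'M[F]_n) (B' : 'M[F]_n') (c : nat) :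
  A ^+ (2 ^ e.+1) = 0 -> B ^+ (2 ^ e.+1) = 0 ->
  A' ^+ (2 ^ e) = 0 -> B' ^+ (2 ^ e) = 0 ->
  (forall l, \rank (A ^+ (l * 2)) = c * \rank (A' ^+ l))%N ->
  (forall l, \rank (B ^+ (l * 2)) = c * \rank (B' ^+ l))%N ->
  rank_sum (2 ^ e.+1) (rk (ksum A B))
    = 2 * (c * c)%:Z * rank_sum (2 ^ e) (rk (ksum A' B'))
      - odd_blocks (2 ^ e.+1) (rk A) * odd_blocks (2 ^ e.+1) (rk B).
Proof.
move=> Aq Bq Aq' Bq' rA rB; rewrite -odd_blocks_ksum //.
apply/eqP; rewrite eq_sym subr_eq eq_sym expnSr rank_sum_even -mulrA.
apply/eqP; congr (_ * _); rewrite mulr_sumr; apply: eq_bigr => l _.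
rewrite (rank_ksum_double _ _ _ Aq' Bq' rA rB) -?expnSr //.
rewrite !PoszM; ring.
Qed.

(** * Adding the product of two further variables *)

Section Product.
Variables (e w : nat) (h : 'M[F]_w).
Local Notation q := (2 ^ e)%N.
Hypothesis hq : h ^+ q = 0.
Local Notation uv := (jordan q *t jordan q).

(** The powers of [uv] have ranks [(q - l) ^ 2], whose second differences are
    the numbers of blocks. *)
Lemma sum_rank_uv (Phi : forall m, 'M[F]_m -> int)
    (PhiD : forall m m1 m2 (A : 'M_m) (A1 : 'M_m1) (A2 : 'M_m2),
       splits A A1 A2 -> Phi m A = Phi m1 A1 + Phi m2 A2)
    (Phi0 : forall A : 'M_0, Phi 0%N A = 0) :
  Phi (q * q)%N uv = \sum_(l < q) mult l * Phi (q - l)%N (jordan (q - l)).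
Proof.
have uvq : uv ^+ q = 0 by rewrite tens_exp jordan_nilp tens0mx.
rewrite (additive_invariant PhiD Phi0 uvq).
rewrite -(sum_square_second_difference (phi := fun l => Phi l (jordan l))) //.
apply: eq_bigr => l _; rewrite tens_exp mxrank_tens rank_jordan_exp.
by rewrite mulnn.
Qed.

Lemma rank_uv_top :
  (\rank (ksum uv h ^+ q.-1))%:Z = rank_sum q (rk h).
Proof.
rewrite (sum_rank_uv (Phi := fun m A => (\rank (ksum A h ^+ q.-1))%:Z)).
- apply: eq_bigr => l _; rewrite rank_ksum_top ?leq_subr //.
  by rewrite subKn // ltnW.
- by move=> m m1 m2 A A1 A2 /(splits_ksum h)/splits_rank_exp ->; rewrite PoszD.
- by move=> A; apply/eqP; rewrite eqz_nat -leqn0 rank_leq_row.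
Qed.

(** The duality between complementary blocks reduces to a [(q - 1)]-st power. *)
Lemma rank_ksum1 a : (0 < a <= q)%N ->
  (\rank (ksum (jordan a) h) = a.-1 * w + \rank (h ^+ a))%N.
Proof.
case/andP=> a0 aq; have := @rank_ksum_reflect _ char2 _ _ _ hq a 1 aq.
rewrite expn_gt0 expr1 subn1 mul1n => /(_ isT).
rewrite rank_ksum_top ?leq_subr // subKn //.
set r := \rank (ksum _ _); move: r => r.
have -> : (a * w = w + a.-1 * w)%N by rewrite -mulSn prednK.
by rewrite addnC -addnA => /addnI.
Qed.

Lemma corank_uv :
  (q * q * w)%:Z - (\rank (ksum uv h))%:Z = 2 * (q * w)%:Z - rank_sum q (rk h).
Proof.
rewrite (sum_rank_uv (Phi := fun m A => (\rank (ksum A h))%:Z)); first last.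
- by move=> A; apply/eqP; rewrite eqz_nat -leqn0 rank_leq_row.
- move=> m m1 m2 A A1 A2 /(splits_ksum h)/(splits_rank_exp 1).
  by rewrite !expr1 => ->; rewrite PoszD.
have q0 : (0 < q)%N by rewrite expn_gt0.
have rE : rank_sum q (rk h)
    = w%:Z + \sum_(l < q) mult l * (\rank (h ^+ (q - l)))%:Z.
  rewrite (rank_sum_rev q0); last by rewrite hq mxrank0.
  by rewrite expr0 -idmxE mxrank1.
have -> : \sum_(l < q) mult l * (\rank (ksum (jordan (q - l)) h))%:Z
    = (\sum_(l < q) mult l * (q - l).-1%:Z) * w%:Z
      + \sum_(l < q) mult l * (\rank (h ^+ (q - l)))%:Z.
  rewrite mulr_suml -big_split; apply: eq_bigr => l _ /=.
  rewrite rank_ksum1 ?leq_subr ?subn_gt0 ?ltn_ord // PoszD PoszM; ring.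
rewrite sum_mult_pred //.
rewrite rE !PoszM; ring.
Qed.

End Product.
End OddBlocksOfKroneckerSum.
(** * The matrix of the quartic *)

Section QuarticMatrix.
Variable F : fieldType.
Local Notation jordan := (@jordan F).

(** Multiplication by [x ^ a * y ^ b * z ^ c] modulo the [q]-th powers of the
    variables. *)
Definition monomial_mx q a b c : 'M[F]_(q * (q * q)) :=
  (jordan q ^+ a) *t ((jordan q ^+ b) *t (jordan q ^+ c)).

Definition quartic_mx q (alpha : F) : 'M[F]_(q * (q * q)) :=
  alpha *: monomial_mx q 2 2 0 + monomial_mx q 0 0 4 + monomial_mx q 1 1 2
    + (monomial_mx q 3 0 1 + monomial_mx q 0 3 1).

Lemma monomial_mxM q a b c a' b' c' :
  monomial_mx q a b c * monomial_mx q a' b' c'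
    = monomial_mx q (a + a') (b + b') (c + c').
Proof. by rewrite -mulmxE !tensmx_mul !mulmxE -!exprD. Qed.

Lemma monomial_mxC q a b c a' b' c' :
  monomial_mx q a b c * monomial_mx q a' b' c'
    = monomial_mx q a' b' c' * monomial_mx q a b c.
Proof. by rewrite !monomial_mxM addnC (addnC b) (addnC c). Qed.

Lemma monomial_mxX q a b c l :
  monomial_mx q a b c ^+ l = monomial_mx q (a * l) (b * l) (c * l).
Proof. by rewrite !tens_exp -!exprM. Qed.

Lemma monomial_mx0 q a b c : (q <= maxn a (maxn b c))%N -> monomial_mx q a b c = 0.
Proof.
have J0 d : (q <= d)%N -> jordan q ^+ d = 0 by apply: jordan_nilp_le.
rewrite !leq_max => /or3P[] /J0 E; rewrite /monomial_mx E.
- by rewrite tens0mx.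
- by rewrite tens0mx tensmx0.
- by rewrite !tensmx0.
Qed.

Hypothesis char2 : 1 + 1 = 0 :> F.

Lemma quartic_mx_exp q alpha e : quartic_mx q alpha ^+ (2 ^ e) =
  alpha ^+ (2 ^ e) *: monomial_mx q (2 * 2 ^ e) (2 * 2 ^ e) 0
    + monomial_mx q 0 0 (4 * 2 ^ e) + monomial_mx q (2 ^ e) (2 ^ e) (2 * 2 ^ e)
    + (monomial_mx q (3 * 2 ^ e) 0 (2 ^ e) + monomial_mx q 0 (3 * 2 ^ e) (2 ^ e)).
Proof.
have C := monomial_mxC.
have CZ a b c a' b' c' : GRing.comm (alpha *: monomial_mx q a b c)
    (monomial_mx q a' b' c').
  by rewrite /GRing.comm -!mulmxE -scalemxAl -scalemxAr !mulmxE C.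
have scale_exp l (X : 'M[F]_(q * (q * q))) : (alpha *: X) ^+ l = alpha ^+ l *: X ^+ l.
  elim: l => [|l IH]; first by rewrite !expr0 scale1r.
  by rewrite !exprS IH -!mulmxE -scalemxAl -scalemxAr scalerA.
rewrite !exprD_char2 //.
- by rewrite scale_exp !monomial_mxX !mul0n !mul1n.
- exact: CZ.
- by apply/commr_sym/commrD; apply/commr_sym; [apply: CZ | apply: C].
- apply: commrD; apply/commr_sym; (apply: commrD; first apply: commrD).
  all: by apply/commr_sym; apply: CZ || apply: C.
Qed.

Lemma quartic_mx_nilp alpha e : quartic_mx (2 ^ e) alpha ^+ (2 ^ e) = 0.
Proof.
by rewrite quartic_mx_exp !monomial_mx0 ?scaler0 ?addr0 // !leq_max; lia.
Qed.

(** The truncation by the [(2 q)]-th powers of the variables is free of rank 8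
    over the subring generated by the squares of the variables, which is a copy
    of the truncation by the [q]-th powers.  The square of the quartic is the
    quartic with the coefficient [alpha ^ 2] in the squares of the variables,
    and the Frobenius endomorphism of [F] shows that [alpha ^ 2] gives the same
    ranks as [alpha]. *)
Lemma rank_quartic_mx_double q alpha l :
  (\rank (quartic_mx (q * 2) alpha ^+ (l * 2))
     = 8 * \rank (quartic_mx q alpha ^+ l))%N.
Proof.
have J2 a : jordan (q * 2) ^+ (2 * a) = (jordan q ^+ a) *t 1%:M.
  rewrite !jordan_exp; apply/matrixP => i j.
  case: (mxtens_indexP i) => i0 i1; case: (mxtens_indexP j) => j0 j1.
  rewrite tensmxE !mxE /= -natrM mulnb; congr (nat_of_bool _)%:R.
  have -> : (j0 * 2 + j1 + 2 * a = (j0 + a) * 2 + j1)%N by lia.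
  by rewrite eq_addl_mul // xpair_eqE.
pose f (k : 'I_((q * 2) * ((q * 2) * (q * 2)))) :=
  let: (k0, k') := mxtens_unindex k in
  let: (k1, k2) := mxtens_unindex k' in
  let: (a, a') := mxtens_unindex k0 in
  let: (b, b') := mxtens_unindex k1 in
  let: (c, c') := mxtens_unindex k2 in
  mxtens_index (mxtens_index (a, mxtens_index (b, c)),
                mxtens_index (a', mxtens_index (b', c'))).
pose g (k : 'I_((q * (q * q)) * (2 * (2 * 2)))) :=
  let: (k0, k') := mxtens_unindex k in
  let: (a, k1) := mxtens_unindex k0 in
  let: (b, c) := mxtens_unindex k1 in
  let: (a', k2) := mxtens_unindex k' in
  let: (b', c') := mxtens_unindex k2 in
  mxtens_index (mxtens_index (a, a'),
    mxtens_index (mxtens_index (b, b'), mxtens_index (c, c'))).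
have fK : cancel f g.
  move=> k; case: (mxtens_indexP k) => k0 k'; case: (mxtens_indexP k') => k1 k2.
  case: (mxtens_indexP k0) => a a'; case: (mxtens_indexP k1) => b b'.
  by case: (mxtens_indexP k2) => c c'; rewrite /f !mxtens_indexK /g !mxtens_indexK.
have gK : cancel g f.
  move=> k; case: (mxtens_indexP k) => k0 k'; case: (mxtens_indexP k0) => a k1.
  case: (mxtens_indexP k') => a' k2; case: (mxtens_indexP k1) => b c.
  by case: (mxtens_indexP k2) => b' c'; rewrite /g !mxtens_indexK /f !mxtens_indexK.
have mono a b c i j : monomial_mx (q * 2) (2 * a) (2 * b) (2 * c) i j
    = (monomial_mx q a b c *t (1%:M *t (1%:M *t 1%:M))) (f i) (f j).
  rewrite /monomial_mx !J2.
  case: (mxtens_indexP i) => k0 k'; case: (mxtens_indexP k') => k1 k2.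
  case: (mxtens_indexP k0) => i0 i0'; case: (mxtens_indexP k1) => i1 i1'.
  case: (mxtens_indexP k2) => i2 i2'.
  case: (mxtens_indexP j) => n0 n'; case: (mxtens_indexP n') => n1 n2.
  case: (mxtens_indexP n0) => j0 j0'; case: (mxtens_indexP n1) => j1 j1'.
  case: (mxtens_indexP n2) => j2 j2'.
  rewrite /f !mxtens_indexK !tensmxE; ring.
have addE m n (A B : 'M[F]_(m, n)) i j : (A + B) i j = A i j + B i j.
  by rewrite mxE.
have scaleE m n c (A : 'M[F]_(m, n)) i j : (c *: A) i j = c * A i j.
  by rewrite mxE.
have -> : \rank (quartic_mx (q * 2) alpha ^+ (l * 2))
    = \rank ((quartic_mx q (alpha ^+ 2) *t (1%:M : 'M[F]_(2 * (2 * 2)))) ^+ l).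
  rewrite [(l * 2)%N]mulnC exprM; apply: (rank_exp_reindex _ fK gK) => i j.
  have -> : quartic_mx (q * 2) alpha ^+ 2 =
      alpha ^+ 2 *: monomial_mx (q * 2) (2 * 2) (2 * 2) (2 * 0)
      + monomial_mx (q * 2) (2 * 0) (2 * 0) (2 * 4)
      + monomial_mx (q * 2) (2 * 1) (2 * 1) (2 * 2)
      + (monomial_mx (q * 2) (2 * 3) (2 * 0) (2 * 1)
         + monomial_mx (q * 2) (2 * 0) (2 * 3) (2 * 1)).
    exact: (quartic_mx_exp (q * 2) alpha 1).
  by rewrite /quartic_mx !tensDl tensZl !addE !scaleE !mono -!tens1.
rewrite tens_exp expr1n mxrank_tens mxrank1 mulnC; congr (8 * _)%N.
have pchar2 : 2%N \in [pchar F] by rewrite inE /= mulr2n char2 eqxx.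
pose phi : {rmorphism F -> F} := pFrobenius_aut pchar2.
have phiJ n a : map_mx phi (jordan n ^+ a) = jordan n ^+ a.
  by rewrite jordan_exp; apply/matrixP => i j; rewrite !mxE rmorph_nat.
have -> : quartic_mx q (alpha ^+ 2) = map_mx phi (quartic_mx q alpha).
  rewrite /quartic_mx !raddfD /= map_mxZ /monomial_mx !map_mxT !phiJ.
  by [].
have -> : map_mx phi (quartic_mx q alpha) ^+ l = map_mx phi (quartic_mx q alpha ^+ l).
  elim: l => [|l IH]; first by rewrite !expr0 -!idmxE map_mx1.
  by rewrite !exprS IH -!mulmxE map_mxM.
by rewrite mxrank_map.
Qed.

(** Every monomial of the quartic is divisible by the square of a variable. *)
Lemma quartic_mx2 alpha : quartic_mx 2 alpha = 0.
Proof. by rewrite /quartic_mx !monomial_mx0 ?scaler0 ?addr0. Qed.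

End QuarticMatrix.
(** * The words of the Brenner-Monsky automaton *)

Section BracketSum.
Variables (m : nat) (oddP : bool).

(** A word that has the form [c C], [A_n + c C] or [B_n + c C] is recorded by
    its head ([None], [Some false] or [Some true]) and by [c]. *)
Definition word_of_state (n : nat) (s : option bool * nat) : {freeg symbol / int} :=
  (if s.1 is Some b then << (if b then SymB n else SymA n) >> else 0)
    + << SymC >> *+ s.2.

Definition next_state (i : bool) (n : nat) (s : option bool * nat) :=
  match s with
  | (Some false, c) => (Some (parity_hit m oddP i n.+1), c)
  | (Some true, c) => if parity_hit m oddP i n then (None, c)
                      else (Some false, c.+1)
  | (None, c) => (None, c)
  end.

(** The symbol [D] occurs only in the initial word [2 C + D], which becomes
    [A_1 + 2 C] or [2 C] in one step; the states start there, so [state n]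
    encodes the words at level [n + 1]. *)
Fixpoint state (n j : nat) : option bool * nat :=
  if n is n'.+1 then next_state (odd j) n'.+1 (state n' j./2)
  else (if odd j then None else Some false, 2%N).

HB.instance Definition _ i :=
  GRing.isAdditive.Build {freeg symbol / int} {freeg symbol / int}
    (sigma m oddP i) (lift_is_additive (sigma_symbol m oddP i)).

Lemma sigmaU i s : sigma m oddP i << s >> = sigma_symbol m oddP i s.
Proof. by rewrite /sigma liftU scale1r. Qed.

Lemma bracket_word_state n j :
  bracket_word m oddP n.+1 j = word_of_state n.+1 (state n j).
Proof.
elim: n j => [|n IH] j /=.
  rewrite raddfD raddfMn /= !sigmaU /word_of_state /= addrC.
  by case: (odd j).
rewrite [LHS]/= -/(bracket_word _ _ n.+1 _) IH /word_of_state raddfD raddfMn /= sigmaU.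
case: (state n j./2) => [[[]|] c] /=.
- rewrite sigmaU /=; case: parity_hit => //=.
  by rewrite mulrS -addrA.
- by rewrite sigmaU /=; case: parity_hit.
- by rewrite raddf0.
Qed.

Definition state_weight (u v : nat) (s : option bool * nat) : nat :=
  (if s.1 is Some b then if b then v else u else 0) * 2 ^ s.2.

Lemma bracket_value_state n j :
  bracket_value m oddP n.+1 j = (state_weight 3 5 (state n j))%:R.
Proof.
rewrite /bracket_value bracket_word_state /word_of_state /state_weight.
case: (state n j) => [t c] /=.
rewrite !(coeffD, coeffMn).
have coefCA k : coeff (SymA k) << SymC >> = 0 :> int by rewrite coeffU mulr0.
have coefCB k : coeff (SymB k) << SymC >> = 0 :> int by rewrite coeffU mulr0.
have coefCC : coeff SymC << SymC >> = 1 :> int by rewrite coeffU.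
have coefCD : coeff SymD << SymC >> = 0 :> int by rewrite coeffU.
rewrite coefCA coefCB coefCC coefCD !mul0rn !addr0 natrM natrX.
have U x y : coeff x << y >> = (y == x)%:R :> int by rewrite coeffU mul1r.
case: t => [[]|]; rewrite ?coeff0 ?U !natz.
- by have -> : (SymB n.+1 == SymA n.+1) = false by []; rewrite eqxx.
- by have -> : (SymA n.+1 == SymB n.+1) = false by []; rewrite eqxx.
- by rewrite mul0r.
Qed.

Lemma parity_hit_compl n :
  parity_hit m oddP true n = (m %| n)%N && ~~ parity_hit m oddP false n.
Proof.
by rewrite /parity_hit; case: (m %| n)%N => //=; case: odd; case: oddP.
Qed.

Definition weight_sum (u v n : nat) : nat :=
  \sum_(j < 2 ^ n.+1) state_weight u v (state n j).

Lemma sum_by_parity (G : nat -> nat) n :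
  (\sum_(j < n * 2) G j = \sum_(j < n) (G j.*2 + G j.*2.+1))%N.
Proof.
elim: n => [|n IH]; first by rewrite !big_ord0.
by rewrite mulSn [(2 + _)%N]addnC !addnS addn0 !big_ord_recr IH /= muln2 addnA.
Qed.

Hypothesis m_gt1 : (1 < m)%N.

Lemma stateB_dvd n j c : state n j = (Some true, c) -> (m %| n.+1)%N.
Proof.
case: n => [|n] /=; first by case: (odd j).
case: (state n j./2) => [[[]|] d] //=; first by case: parity_hit.
by case=> /andP[].
Qed.

(** The total weight [2 ^ c] of the two successors of a live state is twice its
    own weight: a head [A] passes to two heads with the same [c], and a head
    [B] to one head with [c + 1].  A head [B] occurs only at the multiples of
    [m], where one of the successors of each [A] is a [B]. *)
Lemma weight_sumE n :
  weight_sum 1 1 n = (2 ^ n.+2)%N /\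
  weight_sum 0 1 n = (if m %| n.+1 then 2 ^ n.+1 else 0)%N.
Proof.
have step u v n' : weight_sum u v n'.+1
    = (\sum_(j < 2 ^ n'.+1) \sum_(i : bool)
        state_weight u v (next_state i n'.+1 (state n' j)))%N.
  rewrite /weight_sum [(2 ^ n'.+2)%N]expnSr.
  rewrite (sum_by_parity (fun j => state_weight u v (state n'.+1 j))).
  apply: eq_bigr => j _; rewrite big_bool /= odd_double uphalf_double doubleK.
  by rewrite addnC.
elim: n => [|n [IH1 IH2]].
  rewrite /weight_sum !big_ord_recl !big_ord0 /state_weight /= dvdn1.
  by case: eqP => // m1; move: m_gt1; rewrite m1.
split.
  rewrite step [(2 ^ n.+3)%N]expnS -IH1 big_distrr /=; apply: eq_bigr => j _.
  rewrite big_bool /=; case E: (state n j) => [[[]|] c]; rewrite /state_weight /=.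
  - rewrite parity_hit_compl (stateB_dvd E).
    by case: parity_hit => /=; rewrite expnS; lia.
  - by case: parity_hit; case: parity_hit; lia.
  - by [].
case: (boolP (m %| n.+2)%N) => mn.
  have mn' : (m %| n.+1)%N = false.
    apply/negP => mn'; have : (m %| 1)%N by rewrite -(dvdn_addr 1 mn') addn1.
    by rewrite dvdn1 => /eqP m1; move: m_gt1; rewrite m1.
  rewrite step -IH1 /weight_sum; apply: eq_bigr => j _.
  rewrite big_bool /=; case E: (state n j) => [[[]|] c]; rewrite /state_weight /=.
  - by rewrite (stateB_dvd E) in mn'.
  - by rewrite parity_hit_compl mn /=; case: parity_hit => /=; lia.
  - by [].
rewrite step big1 // => j _; rewrite big_bool /=.
case E: (state n j) => [[[]|] c]; rewrite /state_weight /=.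
- by case: parity_hit; case: parity_hit.
- by rewrite /parity_hit (negbTE mn).
- by [].
Qed.

Theorem bracket_sum n : (0 < n)%N ->
  \sum_(j < 2 ^ n) bracket_value m oddP n j
    = (2 ^ n.+1 * (3 + (m %| n)))%:R.
Proof.
case: n => // n _; under eq_bigr do rewrite bracket_value_state.
rewrite -natr_sum; congr _%:R; have [W1 W2] := weight_sumE n.
transitivity (3 * weight_sum 1 1 n + 2 * weight_sum 0 1 n)%N.
  rewrite /weight_sum !big_distrr -big_split; apply: eq_bigr => j _.
  rewrite /state_weight /=; case: (state n j).1 => [[]|]; lia.
rewrite W1 W2; case: (m %| n.+1)%N; rewrite !expnS; lia.
Qed.

End BracketSum.
(** * Power series *)

Section PowerSeriesBasics.
Variables (n : nat) (k : comNzRingType).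
Local Notation PS := (powerseries n k).
Implicit Types (f g : PS) (p : {mpoly k[n]}) (m : 'X_{1..n}).

Lemma pscoeffD f g m : pscoeff (f + g) m = pscoeff f m + pscoeff g m.
Proof. by []. Qed.

Lemma pscoeffN f m : pscoeff (- f) m = - pscoeff f m.
Proof. by []. Qed.

Lemma pscoeffB f g m : pscoeff (f - g) m = pscoeff f m - pscoeff g m.
Proof. by []. Qed.

Lemma pscoeff_sum (I : Type) (r : seq I) (P : pred I) (G : I -> PS) m :
  pscoeff (\sum_(i <- r | P i) G i) m = \sum_(i <- r | P i) pscoeff (G i) m.
Proof. by apply: (big_morph (fun f : PS => pscoeff f m)). Qed.

Lemma ps_agree_mpoly d p : ps_agree d p (ps_of_mpoly p).
Proof. by []. Qed.

Lemma pscoeffM_agree f g p q m : ps_agree (mdeg m) p f ->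
  ps_agree (mdeg m) q g -> pscoeff (f * g) m = (p * q)@_m.
Proof. exact: psmulE. Qed.

Fact ps_of_mpoly_is_additive : additive (@ps_of_mpoly n k).
Proof. by move=> p q; apply: psP => m /=; rewrite mcoeffB. Qed.

Fact ps_of_mpoly_is_multiplicative : multiplicative (@ps_of_mpoly n k).
Proof.
split=> // p q; apply: psP => m.
by rewrite (@pscoeffM_agree _ _ p q).
Qed.

HB.instance Definition _ := GRing.isAdditive.Build {mpoly k[n]} PS
  (@ps_of_mpoly n k) ps_of_mpoly_is_additive.
HB.instance Definition _ := GRing.isMultiplicative.Build {mpoly k[n]} PS
  (@ps_of_mpoly n k) ps_of_mpoly_is_multiplicative.

Lemma pscoeff1 m : pscoeff (1 : PS) m = (m == 0%MM)%:R.
Proof. by rewrite -[LHS]/(1@_m) mcoeff1. Qed.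

Lemma ps_of_mpoly1 : ps_of_mpoly 1 = 1 :> PS.
Proof. exact: rmorph1. Qed.

Definition psX m : PS := ps_of_mpoly 'X_[m].
Definition psC (c : k) : PS := ps_of_mpoly c%:MP.

Lemma psXD m1 m2 : psX (m1 + m2) = psX m1 * psX m2.
Proof. by rewrite /psX mpolyXD rmorphM. Qed.

Lemma psX0 : psX 0 = 1.
Proof. by rewrite /psX mpolyX0 ps_of_mpoly1. Qed.

Lemma psX_exp m d : psX (m *+ d) = psX m ^+ d.
Proof. by rewrite /psX -rmorphXn mpolyXn. Qed.

Lemma mcoeffXM m p l :
  ('X_[m] * p)@_l = if (m <= l)%MM then p@_(l - m) else 0.
Proof.
case: ifP => [ml|/negbT ml].
  by rewrite mulrC -{1}(submK ml) addmC mcoeffMX.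
apply/eqP; rewrite mcoeff_eq0; apply: contra ml.
move=> /msuppM_le/allpairsP[[a b] /= [ma mb ->]].
by move: ma; rewrite msuppX inE => /eqP ->; rewrite lem_addr.
Qed.

Lemma pscoeffXM m f l :
  pscoeff (psX m * f) l = if (m <= l)%MM then pscoeff f (l - m)%MM else 0.
Proof.
rewrite (pscoeffM_agree (@ps_agree_mpoly _ 'X_[m]) (@pstruncP _ _ _ f)).
rewrite mcoeffXM; case: ifP => // ml.
by rewrite (@pstruncP _ _ (mdeg l)) // mdegB ?leq_subr.
Qed.

Lemma pscoeffCM c f m : pscoeff (psC c * f) m = c * pscoeff f m.
Proof.
rewrite (pscoeffM_agree (@ps_agree_mpoly _ c%:MP) (@pstruncP _ _ _ f)).
by rewrite mcoeffCM pstruncP.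
Qed.

(** A series without monomials in the box of exponents less than [q] belongs to
    the ideal of the [q]-th powers of the variables: distribute its monomials
    according to the first exponent that is at least [q]. *)
Lemma ps_box_decomposition q f :
  (forall m, (forall i, m i < q)%N -> pscoeff f m = 0) ->
  exists g : 'I_n -> PS, f = \sum_i psX (U_(i) *+ q) * g i.
Proof.
move=> f0; pose first m := [pick i : 'I_n | (q <= m i)%N].
exists (fun i => PowerSeries (fun m =>
  if first (m + U_(i) *+ q)%MM == Some i
  then pscoeff f (m + U_(i) *+ q)%MM else 0)).
apply: psP => m; rewrite pscoeff_sum.
have Ule i : (U_(i) *+ q <= m)%MM = (q <= m i)%N.
  apply/mnm_lepP/idP => [/(_ i)|qm j].
    by rewrite mulmnE mnm1E eqxx mul1n.
  by rewrite mulmnE mnm1E; case: eqP => [<-|]; rewrite ?mul1n ?mul0n.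
under eq_bigr do rewrite pscoeffXM Ule /=.
have E i : (q <= m i)%N -> (m - U_(i) *+ q + U_(i) *+ q)%MM = m.
  by move=> qm; rewrite submK // Ule.
have firstS i : first m = Some i -> (q <= m i)%N.
  by rewrite /first; case: pickP => // j qj [<-].
have firstN : first m = None -> forall i, (m i < q)%N.
  by rewrite /first; case: pickP => // qF _ i; rewrite ltnNge qF.
case F : (first m) => [i|].
  rewrite (bigD1 i) //= (firstS _ F) (E i (firstS _ F)) F eqxx big1 ?addr0 //.
  move=> j ji; case: ifP => // /E ->; rewrite F; case: eqP => // -[ij].
  by rewrite ij eqxx in ji.
rewrite f0 ?big1 //; last exact: firstN.
by move=> i _; rewrite leqNgt firstN.
Qed.

(** * Coordinates on a finite set of monomials *)

Section Coordinates.
Variables (N : nat) (mon : 'I_N -> 'X_{1..n}).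

Definition coords f : 'cV[k]_N := \col_i pscoeff f (mon i).

Definition mon_mx m : 'M[k]_N := \matrix_(i, j) (mon i == (mon j + m)%MM)%:R.

Definition represents f (A : 'M[k]_N) := forall g, coords (f * g) = A *m coords g.

Lemma coordsD f g : coords (f + g) = coords f + coords g.
Proof. by apply/colP => i; rewrite !mxE. Qed.

Lemma coordsB f g : coords (f - g) = coords f - coords g.
Proof. by apply/colP => i; rewrite !mxE. Qed.

Lemma coordsC c f : coords (psC c * f) = c *: coords f.
Proof. by apply/colP => i; rewrite !mxE pscoeffCM. Qed.

Lemma representsD f g A B :
  represents f A -> represents g B -> represents (f + g) (A + B).
Proof. by move=> fA gB h; rewrite mulrDl coordsD fA gB mulmxDl. Qed.

Lemma representsM f g A B :
  represents f A -> represents g B -> represents (f * g) (A *m B).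
Proof. by move=> fA gB h; rewrite -mulrA fA gB mulmxA. Qed.

Lemma represents1 : represents 1 1%:M.
Proof. by move=> h; rewrite mul1r mul1mx. Qed.

Lemma representsX f A d : represents f A -> represents (f ^+ d) (A ^+ d).
Proof.
move=> fA; elim: d => [|d IH]; first exact: represents1.
by rewrite !exprS; apply: representsM.
Qed.

Lemma representsZ c f A :
  represents f A -> represents (psC c * f) (c *: A).
Proof. by move=> fA h; rewrite -mulrA coordsC fA scalemxAl. Qed.

Variable q : nat.
Hypothesis mon_inj : injective mon.
Hypothesis mon_box : forall i l, (mon i l < q)%N.
Hypothesis mon_surj : forall m, (forall l, m l < q)%N -> exists i, mon i = m.

Lemma represents_mon m : represents (psX m) (mon_mx m).
Proof.
move=> g; apply/colP => i; rewrite !mxE pscoeffXM.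
case: ifP => [mi|/negbT mi]; last first.
  rewrite big1 // => j _; rewrite !mxE; case: eqP => [E|_]; last by rewrite mul0r.
  by rewrite E lem_addl in mi.
have [|j jE] := mon_surj (m := (mon i - m)%MM).
  by move=> l; rewrite mnmBE (leq_ltn_trans (leq_subr _ _)).
rewrite (bigD1 j) //= !mxE jE submK // eqxx mul1r big1 ?addr0 // => j' jj'.
rewrite !mxE; case: eqP => [E|_]; last by rewrite mul0r.
case/negP: jj'; apply/eqP/mon_inj; rewrite jE E.
by apply/mnmP => l; rewrite mnmBE mnmDE addnK.
Qed.

Lemma coords_surj (v : 'cV[k]_N) : exists p, coords (ps_of_mpoly p) = v.
Proof.
exists (\sum_i v i 0 *: 'X_[mon i]); apply/colP => i; rewrite mxE /=.
rewrite raddf_sum (bigD1 i) //= mcoeffZ mcoeffX eqxx mulr1 big1 ?addr0 //.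
move=> j ji; rewrite mcoeffZ mcoeffX; case: eqP => [/mon_inj E|_].
  by rewrite E eqxx in ji.
by rewrite mulr0.
Qed.

Lemma coords0P f : coords f = 0 -> forall m, (forall l, m l < q)%N -> pscoeff f m = 0.
Proof. by move=> /colP f0 m /mon_surj[i <-]; have := f0 i; rewrite !mxE. Qed.

Lemma coords_decomposition f : coords f = 0 ->
  exists g : 'I_n -> PS, f = \sum_i psX (U_(i) *+ q) * g i.
Proof. by move/coords0P/ps_box_decomposition. Qed.

Lemma coords_power i f : coords (psX (U_(i) *+ q) * f) = 0.
Proof.
apply/colP => j; rewrite !mxE pscoeffXM; case: ifP => // /mnm_lepP/(_ i).
by rewrite mulmnE mnm1E eqxx mul1n leqNgt mon_box.
Qed.

End Coordinates.
End PowerSeriesBasics.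
(** * The lengths [e_n] as coranks *)

Section DimensionOfCokernel.
Variables (F : fieldType) (V : zmodType) (scale : F -> V -> V).

Lemma is_dim_kernel r (f : V -> 'cV[F]_r) (W : classical_sets.set V) d :
  {morph f : x y / x + y} -> {morph f : x y / x - y} ->
  (forall c v, f (scale c v) = c *: f v) ->
  (forall w, exists v, f v = w) -> (forall v, W v <-> f v = 0) ->
  is_dim scale classical_sets.setT W d <-> d = r.
Proof.
move=> fD fB fZ f_surj fW.
have f0 : f 0 = 0 by rewrite -(subrr 0) fB subrr.
have f_sum (I : Type) (s : seq I) (G : I -> V) :
    f (\sum_(i <- s) G i) = \sum_(i <- s) f (G i) by apply: (big_morph f fD f0).
split=> [[b [_ bP]]|->].
  pose B : 'M[F]_(r, d) := \matrix_(i, j) f (b j) i 0.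
  have BE (c : {ffun 'I_d -> F}) : f (\sum_i scale (c i) (b i)) = B *m (\col_i c i).
    rewrite f_sum; apply/colP => i; rewrite summxE mxE; apply: eq_bigr => j _.
    by rewrite fZ !mxE mulrC.
  have rBr : \rank B = r.
    apply/eqP/row_freeP; pose e (i : 'I_r) := delta_mx i 0 : 'cV[F]_r.
    have /choice [D DP] i : exists D : 'cV[F]_d, B *m D = e i.
      have [v vE] := f_surj (e i); have [//|c [/fW + _]] := bP v.
      by rewrite fB BE => /eqP; rewrite subr_eq0 vE => /eqP ->; exists (\col_i c i).
    exists (\matrix_(i, j) D j i 0).
    apply/matrixP => i j; move/colP/(_ i): (DP j); rewrite !mxE eqxx andbT => <-.
    by apply: eq_bigr => l _; rewrite !mxE.
  have rBd : \rank B = d.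
    rewrite -mxrank_tr; apply/eqP; apply: inj_row_free => v /(congr1 trmx).
    rewrite trmx_mul trmxK trmx0 => Bv.
    have [//|c [_ c_unique]] := bP 0.
    have zero (c' : {ffun 'I_d -> F}) : B *m (\col_i c' i) = 0 -> c' = c.
      by move=> B0; apply/esym/c_unique/fW; rewrite fB BE B0 f0 subr0.
    have E1 : [ffun i => v 0 i] = c.
      by apply: zero; rewrite -Bv; congr (_ *m _); apply/colP => i; rewrite !mxE ffunE.
    have E2 : [ffun=> 0] = c.
      by apply: zero; rewrite -[RHS](mulmx0 _ B); congr (_ *m _); apply/colP => i; rewrite !mxE ffunE.
    by apply/rowP => i; move/ffunP/(_ i): E1; rewrite -E2 !ffunE !mxE.
  by rewrite -rBd.
have /choice [b bE] (i : 'I_r) : exists v, f v = delta_mx i 0 by apply: f_surj.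
exists b; split=> // v _; exists [ffun i => f v i 0].
have fE (c : {ffun 'I_r -> F}) : f (\sum_i scale (c i) (b i)) = \col_i c i.
  rewrite f_sum; apply/colP => i; rewrite summxE mxE (bigD1 i) //= fZ bE !mxE.
  rewrite !eqxx mulr1 big1 ?addr0 // => j ji; rewrite fZ bE !mxE.
  by rewrite eq_sym (negbTE ji) mulr0.
split=> [|c /fW].
  by apply/fW/colP => i; rewrite fB fE !mxE ffunE subrr.
rewrite fB fE => /eqP; rewrite subr_eq0 => /eqP ->.
by apply/ffunP => i; rewrite ffunE mxE.
Qed.

Lemma dim_cokernel N (f : V -> 'cV[F]_N) (W : classical_sets.set V) (B : 'M[F]_N) :
  {morph f : x y / x + y} -> {morph f : x y / x - y} ->
  (forall c v, f (scale c v) = c *: f v) ->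
  (forall w, exists v, f v = w) ->
  (forall v, W v <-> exists w, f v = B *m w) ->
  Defs.dim scale classical_sets.setT W = (N - \rank B)%N.
Proof.
move=> fD fB fZ f_surj fW.
pose C := (col_base (cokermx B^T))^T.
have rC : \rank (cokermx B^T) = (N - \rank B)%N by rewrite mxrank_coker mxrank_tr.
have CP v : C *m v = 0 <-> exists w, v = B *m w.
  split=> [Cv|[w ->]].
    have /submxP[w vE] : (v^T <= B^T)%MS.
      rewrite submxE -(mulmx_base (cokermx B^T)) mulmxA.
      by rewrite -[v^T *m _]trmxK trmx_mul trmxK Cv trmx0 mul0mx.
    by exists w^T; rewrite -[LHS]trmxK vE trmx_mul trmxK.
  apply: trmx_inj; rewrite /C trmx_mul trmxK trmx0 trmx_mul.
  apply: (row_free_inj (row_base_free (cokermx B^T))).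
  by rewrite mul0mx -[LHS]mulmxA mulmx_base -mulmxA mulmx_coker mulmx0.
have Cfull : exists D, C *m D = 1%:M.
  have /row_fullP [D DE] := col_base_full (cokermx B^T).
  by exists D^T; rewrite -trmx_mul DE trmx1.
have isd d : is_dim scale classical_sets.setT W d <-> d = \rank (cokermx B^T).
  apply: (@is_dim_kernel _ (fun v => C *m f v)).
  - by move=> x y; rewrite fD mulmxDr.
  - by move=> x y; rewrite fB mulmxBr.
  - by move=> c v; rewrite fZ scalemxAr.
  - move=> w; have [D CD] := Cfull; have [v vE] := f_surj (D *m w).
    by exists v; rewrite vE mulmxA CD mul1mx.
  - by move=> v; split=> [/fW/CP|/CP/fW].
rewrite /Defs.dim; case: xgetP => [d _ /isd -> //|/(_ (\rank (cokermx B^T)))].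
by case; apply/isd.
Qed.

End DimensionOfCokernel.

Section IdealLength.
Variables (d N e : nat) (k : fieldType) (mon : 'I_N -> 'X_{1..d}).
Local Notation q := (2 ^ e)%N.
Hypothesis mon_inj : injective mon.
Hypothesis mon_box : forall i l, (mon i l < q)%N.
Hypothesis mon_surj :
  forall m : 'X_{1..d}, (forall l, m l < q)%N -> exists i, mon i = m.

Let c (p : {mpoly k[d]}) := coords mon (ps_of_mpoly p).

Let cM p r A : represents mon (ps_of_mpoly p) A -> c (p * r) = A *m c r.
Proof. by move=> pA; rewrite /c rmorphM pA. Qed.

Lemma e_idealP (f : {mpoly k[d]}) A : represents mon (ps_of_mpoly f) A ->
  forall p, e_ideal e f p <-> exists w, c p = A *m w.
Proof.
move=> fA p; split.
  have I_ideal : is_ideal (fun p => exists w, c p = A *m w).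
    split.
    - by exists 0; rewrite mulmx0 /c rmorph0; apply/colP => i; rewrite !mxE.
    - move=> x y [v vE] [w wE]; exists (v + w).
      by rewrite mulmxDr -vE -wE -coordsD -rmorphD.
    - move=> a x [v vE]; have [r rE] : exists r, c r = v := coords_surj mon_inj v.
      have x0 : c (x - f * r) = 0.
        by rewrite /c rmorphB coordsB -/(c _) -/(c _) (cM _ fA) rE vE subrr.
      exists (c (a * r)); rewrite -(cM _ fA).
      have -> : a * x = f * (a * r) + a * (x - f * r) by ring.
      rewrite /c rmorphD coordsD /=.
      have -> : ps_of_mpoly (a * (x - f * r)) = ps_of_mpoly a * ps_of_mpoly (x - f * r).
        exact: rmorphM.
      have [g ->] := coords_decomposition mon_surj x0.
      rewrite mulr_sumr; set S := \sum_i _.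
      suff -> : coords mon S = 0 by rewrite addr0.
      apply/colP => i; rewrite !mxE pscoeff_sum big1 // => j _.
      have /colP/(_ i) := coords_power mon_box j (ps_of_mpoly a * g j).
      by rewrite !mxE mulrCA.
  move=> Ip; apply: (Ip (fun p => exists w, c p = A *m w)); split=> // x [[i _ <-]|->].
    exists 0; rewrite mulmx0 mpolyXn.
    by have := coords_power mon_box i (1 : powerseries d k); rewrite mulr1.
  by exists (c 1); rewrite -(cM _ fA) mulr1.
move=> [w pE] I [[I0 ID IM] Igen].
have [r rE] : exists r, c r = w := coords_surj mon_inj w.
have -> : p = (p - r * f) + r * f by rewrite subrK.
apply: (ID _ _ _ (IM _ _ (Igen _ (or_intror erefl)))).
have x0 : c (p - r * f) = 0.
  by rewrite /c mulrC rmorphB coordsB -/(c _) -/(c _) (cM _ fA) rE pE subrr.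
rewrite [p - _]mpolyE; apply: (big_ind I) => // m _.
have [/forallP m0|] := boolP [forall l, m l < q]%N.
  by have := coords0P mon_surj x0 m0; rewrite /= => ->; rewrite scale0r.
rewrite negb_forall => /existsP[i]; rewrite -leqNgt => qm.
have -> : m = (m - U_(i) *+ q + U_(i) *+ q)%MM.
  rewrite submK //; apply/mnm_lepP => j.
  by rewrite mulmnE mnm1E; case: eqP => [<-|]; rewrite ?mul1n ?mul0n.
rewrite mpolyXD -mpolyXn scalerAl; apply: IM; apply: Igen; left.
by exists i.
Qed.

Lemma e_rank (f : {mpoly k[d]}) A : represents mon (ps_of_mpoly f) A ->
  e_ e f = (N - \rank A)%N.
Proof.
move=> fA; apply: (dim_cokernel (f := c)).
- by move=> x y; rewrite /c rmorphD coordsD.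
- by move=> x y; rewrite /c rmorphB coordsB.
- by move=> a v; rewrite /c -mul_mpolyC rmorphM coordsC.
- exact: coords_surj.
- exact: e_idealP.
Qed.

End IdealLength.
(** * Box monomials in three and in eight variables *)

Section BoxMonomials.

Lemma forall_ordS n (P : pred 'I_n.+1) :
  reflect (forall i, P i) (all (fun j => P (inord j)) (iota 0 n.+1)).
Proof.
apply: (iffP allP) => [H i|H j _]; last exact: H.
by rewrite -(inord_val i); apply: H; rewrite mem_iota /=.
Qed.

Lemma mnm_eq_addE n (a b m : 'X_{1..n.+1}) :
  (a == (b + m)%MM)
    = all (fun j => a (inord j) == b (inord j) + m (inord j))%N (iota 0 n.+1).
Proof.
apply/eqP/(forall_ordS (fun i => a i == b i + m i)%N) => [-> i|H].
  by rewrite mnmDE.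
by apply/mnmP => i; rewrite mnmDE; apply/eqP/H.
Qed.

Variable q : nat.

Definition index3 (i : 'I_(q * (q * q))) : seq nat :=
  let: (a, i') := mxtens_unindex i in
  let: (b, c) := mxtens_unindex i' in [:: a : nat; b : nat; c : nat].

Definition mon3 i : 'X_{1..3} := [multinom nth 0%N (index3 i) l | l < 3].

(** The exponents are listed in the order of the variables, while [u v] is the
    first factor of the Kronecker product. *)
Definition index8 (i : 'I_((q * q) * ((q * (q * q)) * (q * (q * q))))) : seq nat :=
  let: (i0, i') := mxtens_unindex i in
  let: (i1, i2) := mxtens_unindex i' in
  let: (u, v) := mxtens_unindex i0 in
  index3 i1 ++ index3 i2 ++ [:: u : nat; v : nat].

Definition mon8 i : 'X_{1..8} := [multinom nth 0%N (index8 i) l | l < 8].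

Lemma mon3E i j : (j < 3)%N -> mon3 i (inord j) = nth 0%N (index3 i) j.
Proof. by move=> j3; rewrite mnmE inordK. Qed.

Lemma mon8E i j : (j < 8)%N -> mon8 i (inord j) = nth 0%N (index8 i) j.
Proof. by move=> j8; rewrite mnmE inordK. Qed.

Lemma mon3_inj : injective mon3.
Proof.
move=> i j; case: (mxtens_indexP i) => a i'; case: (mxtens_indexP i') => b c.
case: (mxtens_indexP j) => a' j'; case: (mxtens_indexP j') => b' c' E.
have H l (l3 : (l < 3)%N) := congr1 (fun m : 'X_{1..3} => m (inord l)) E.
move: (H 0%N isT) (H 1%N isT) (H 2%N isT); rewrite /= !mon3E // /index3 !mxtens_indexK /=.
by move=> /val_inj -> /val_inj -> /val_inj ->.
Qed.

Lemma mon8_inj : injective mon8.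
Proof.
move=> i j; case: (mxtens_indexP i) => i0 i'; case: (mxtens_indexP i') => i1 i2.
case: (mxtens_indexP j) => j0 j'; case: (mxtens_indexP j') => j1 j2.
case: (mxtens_indexP i0) => u v; case: (mxtens_indexP j0) => u' v'.
case: (mxtens_indexP i1) => a k; case: (mxtens_indexP k) => b c.
case: (mxtens_indexP i2) => d k2; case: (mxtens_indexP k2) => e f.
case: (mxtens_indexP j1) => a' k'; case: (mxtens_indexP k') => b' c'.
case: (mxtens_indexP j2) => d' k2'; case: (mxtens_indexP k2') => e' f' E.
have H l (l8 : (l < 8)%N) := congr1 (fun m : 'X_{1..8} => m (inord l)) E.
move: (H 0%N isT) (H 1%N isT) (H 2%N isT) (H 3%N isT) (H 4%N isT) (H 5%N isT)
  (H 6%N isT) (H 7%N isT).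
rewrite /= !mon8E // /index8 !mxtens_indexK /index3 !mxtens_indexK /=.
by do 8 move=> /val_inj ->.
Qed.

Lemma index3_lt i l : (l < 3)%N -> (nth 0%N (index3 i) l < q)%N.
Proof.
case: (mxtens_indexP i) => a i'; case: (mxtens_indexP i') => b c.
by rewrite /index3 !mxtens_indexK; case: l => [|[|[|l]]] //=.
Qed.

Lemma size_index3 i : size (index3 i) = 3%N.
Proof. by rewrite /index3; case: mxtens_unindex => a k; case: mxtens_unindex. Qed.

Lemma mon3_box i l : (mon3 i l < q)%N.
Proof. by rewrite mnmE index3_lt. Qed.

Lemma mon8_box i l : (mon8 i l < q)%N.
Proof.
rewrite mnmE /index8; case: (mxtens_unindex i) => i0 i'.
case: (mxtens_unindex i') => i1 i2; case: (mxtens_unindex i0) => u v.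
rewrite !nth_cat !size_index3; case: (ltnP l 3) => l3; first exact: index3_lt.
case: (ltnP (l - 3) 3) => l6; first exact: index3_lt.
have : (l - 3 - 3 < 2)%N by have := ltn_ord l; lia.
by case: (l - 3 - 3)%N => [|[|d]] //=.
Qed.

Lemma mon3_surj (m : 'X_{1..3}) : (forall l, m l < q)%N -> exists i, mon3 i = m.
Proof.
move=> mq; exists (mxtens_index (Ordinal (mq (inord 0)),
  mxtens_index (Ordinal (mq (inord 1)), Ordinal (mq (inord 2))))).
apply/mnmP => l; apply/eqP; move: l; apply/forall_ordS.
by rewrite /= !mon3E // /index3 !mxtens_indexK /= !eqxx.
Qed.

Lemma mon8_surj (m : 'X_{1..8}) : (forall l, m l < q)%N -> exists i, mon8 i = m.
Proof.
move=> mq; pose o j := Ordinal (mq (inord j)).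
exists (mxtens_index (mxtens_index (o 6%N, o 7%N),
  mxtens_index (mxtens_index (o 0%N, mxtens_index (o 1%N, o 2%N)),
                mxtens_index (o 3%N, mxtens_index (o 4%N, o 5%N))))).
apply/mnmP => l; apply/eqP; move: l; apply/forall_ordS.
rewrite /= !mon8E // /index8 !mxtens_indexK /index3 !mxtens_indexK /=.
by rewrite !eqxx.
Qed.

Variable k : fieldType.

Lemma mon_mx3 m : mon_mx k mon3 m
  = monomial_mx k q (m (inord 0)) (m (inord 1)) (m (inord 2)).
Proof.
apply/matrixP => i j; rewrite mxE mnm_eq_addE /= !mon3E // /monomial_mx !jordan_exp.
case: (mxtens_indexP i) => a i'; case: (mxtens_indexP i') => b c.
case: (mxtens_indexP j) => a' j'; case: (mxtens_indexP j') => b' c'.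
by rewrite !tensmxE !mxE /index3 !mxtens_indexK /= andbT -!natrM !mulnb.
Qed.

Lemma mon_mx8 m : mon_mx k mon8 m
  = (jordan k q ^+ m (inord 6) *t jordan k q ^+ m (inord 7))
    *t (monomial_mx k q (m (inord 0)) (m (inord 1)) (m (inord 2))
        *t monomial_mx k q (m (inord 3)) (m (inord 4)) (m (inord 5))).
Proof.
apply/matrixP => i j; rewrite mxE mnm_eq_addE /= !mon8E // /monomial_mx !jordan_exp.
case: (mxtens_indexP i) => i0 i'; case: (mxtens_indexP i') => i1 i2.
case: (mxtens_indexP j) => j0 j'; case: (mxtens_indexP j') => j1 j2.
case: (mxtens_indexP i0) => u v; case: (mxtens_indexP j0) => u' v'.
case: (mxtens_indexP i1) => a n; case: (mxtens_indexP n) => b c.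
case: (mxtens_indexP i2) => d n2; case: (mxtens_indexP n2) => e f.
case: (mxtens_indexP j1) => a' n'; case: (mxtens_indexP n') => b' c'.
case: (mxtens_indexP j2) => d' n2'; case: (mxtens_indexP n2') => e' f'.
rewrite !tensmxE !mxE /index8 !mxtens_indexK /index3 !mxtens_indexK /= andbT.
rewrite -!natrM !mulnb; congr (nat_of_bool _)%:R; rewrite -!andbA.
by do 8 case: (_ == _); rewrite ?andbF ?andbT.
Qed.

Lemma represents_quartic d N (mon : 'I_N -> 'X_{1..d}) (alpha : k) (x y z : 'I_d)
    (M : nat -> nat -> nat -> 'M[k]_N) :
  (forall a b c, represents mon (psX k (U_(x) *+ a + U_(y) *+ b + U_(z) *+ c)%MM)
                   (M a b c)) ->
  represents mon (ps_of_mpoly (quartic alpha 'X_x 'X_y 'X_z))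
    (alpha *: M 2 2 0 + M 0 0 4 + M 1 1 2 + (M 3 0 1 + M 0 3 1)).
Proof.
move=> RM.
have E a b c : 'X_[(U_(x) *+ a + U_(y) *+ b + U_(z) *+ c)]
    = 'X_x ^+ a * 'X_y ^+ b * 'X_z ^+ c :> {mpoly k[d]}.
  by rewrite !mpolyXD -!mpolyXn.
have -> : quartic alpha 'X_x 'X_y 'X_z =
   alpha%:MP * 'X_[U_(x) *+ 2 + U_(y) *+ 2 + U_(z) *+ 0]
   + 'X_[U_(x) *+ 0 + U_(y) *+ 0 + U_(z) *+ 4]
   + 'X_[U_(x) *+ 1 + U_(y) *+ 1 + U_(z) *+ 2]
   + ('X_[U_(x) *+ 3 + U_(y) *+ 0 + U_(z) *+ 1]
      + 'X_[U_(x) *+ 0 + U_(y) *+ 3 + U_(z) *+ 1]) :> {mpoly k[d]}.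
  by rewrite !E mul_mpolyC /quartic !expr0 !expr1 !mulr1 !mul1r -mulrDl.
rewrite !rmorphD /= rmorphM.
by do !apply: representsD; [apply: representsZ| | | |]; apply: RM.
Qed.

Lemma represents_quartic_xyz (alpha : k) :
  represents mon3 (ps_of_mpoly (quartic_xyz alpha)) (quartic_mx q alpha).
Proof.
apply: represents_quartic => a b c.
have := represents_mon mon3_inj mon3_box mon3_surj.
move=> /(_ k (U_(inord 0) *+ a + U_(inord 1) *+ b + U_(inord 2) *+ c)%MM).
rewrite mon_mx3 !mnmDE !mulmnE !mnm1E -!val_eqE /= !inordK //=.
by rewrite !mul1n !mul0n !addn0 !add0n.
Qed.

Lemma represents_hypersurface (alpha beta : k) :
  represents mon8 (ps_of_mpoly (hypersurface_eq alpha beta))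
    (ksum (jordan k q *t jordan k q)
       (ksum (quartic_mx q alpha) (quartic_mx q beta))).
Proof.
have R8 := @represents_mon _ k _ mon8 q mon8_inj mon8_box mon8_surj.
pose M1 a b c : 'M[k]_((q * q) * ((q * (q * q)) * (q * (q * q)))) :=
  1%:M *t (monomial_mx k q a b c *t 1%:M).
pose M2 a b c : 'M[k]_((q * q) * ((q * (q * q)) * (q * (q * q)))) :=
  1%:M *t (1%:M *t monomial_mx k q a b c).
have -> : ps_of_mpoly (hypersurface_eq alpha beta)
    = ps_of_mpoly ('X_(inord 6) * 'X_(inord 7))
      + ps_of_mpoly (quartic alpha 'X_(inord 0) 'X_(inord 1) 'X_(inord 2))
      + ps_of_mpoly (quartic beta 'X_(inord 3) 'X_(inord 4) 'X_(inord 5))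
    :> powerseries 8 k.
  apply: etrans (rmorphD _ _ _) _; congr (_ + _); exact: rmorphD.
rewrite {1}/ksum [X in represents _ _ (_ + 1%:M *t X)]/ksum tensDr addrA.
apply: representsD; first apply: representsD.
- have := R8 (U_(inord 6) + U_(inord 7))%MM; rewrite /psX mpolyXD mon_mx8.
  rewrite !mnmDE !mnm1E -!val_eqE /= !inordK //= !addn0 !expr1 /monomial_mx !expr0.
  by rewrite -!idmxE !tens1.
- have -> : 1%:M *t (quartic_mx q alpha *t 1%:M) =
      alpha *: M1 2 2 0 + M1 0 0 4 + M1 1 1 2 + (M1 3 0 1 + M1 0 3 1).
    by rewrite /M1 /quartic_mx !(tensDr, tensDl, tensZl, tensZr).
  apply: represents_quartic => a b c; have := R8 (U_(inord 0) *+ a + U_(inord 1) *+ b + U_(inord 2) *+ c)%MM.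
  rewrite mon_mx8 !mnmDE !mulmnE !mnm1E -!val_eqE /= !inordK //=.
  by rewrite !mul1n !mul0n !addn0 !add0n /M1 /monomial_mx !expr0 -!idmxE !tens1.
- have -> : 1%:M *t (1%:M *t quartic_mx q beta) =
      beta *: M2 2 2 0 + M2 0 0 4 + M2 1 1 2 + (M2 3 0 1 + M2 0 3 1).
    by rewrite /M2 /quartic_mx !(tensDr, tensDl, tensZl, tensZr).
  apply: represents_quartic => a b c; have := R8 (U_(inord 3) *+ a + U_(inord 4) *+ b + U_(inord 5) *+ c)%MM.
  rewrite mon_mx8 !mnmDE !mulmnE !mnm1E -!val_eqE /= !inordK //=.
  by rewrite !mul1n !mul0n !addn0 !add0n /M2 /monomial_mx !expr0 -!idmxE !tens1.
Qed.

End BoxMonomials.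

Lemma e_quartic (k : fieldType) e (alpha : k) j :
  e_ e (quartic_xyz alpha ^+ j)
    = (8 ^ e - \rank (quartic_mx (2 ^ e) alpha ^+ j))%N.
Proof.
rewrite (e_rank (@mon3_inj _) (@mon3_box _) (@mon3_surj _)
  (A := quartic_mx (2 ^ e) alpha ^+ j)).
  by congr (_ - _)%N; rewrite -!expnMn.
by rewrite rmorphXn; apply: representsX; apply: represents_quartic_xyz.
Qed.
(** * The order filtration and substitution of power series *)

Section Order.
Variables (n : nat) (k : fieldType).
Local Notation PS := (powerseries n k).
Implicit Types (f g : PS) (m : 'X_{1..n}).

Definition has_order (N : nat) f := forall m, (mdeg m < N)%N -> pscoeff f m = 0.

Lemma has_order0 f : has_order 0 f. Proof. by []. Qed.

Lemma has_order_0 N : has_order N 0. Proof. by []. Qed.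

Lemma has_orderD N f g : has_order N f -> has_order N g -> has_order N (f + g).
Proof. by move=> fN gN m mN; rewrite pscoeffD fN ?gN ?addr0. Qed.

Lemma has_orderN N f : has_order N f -> has_order N (- f).
Proof. by move=> fN m mN; rewrite pscoeffN fN ?oppr0. Qed.

Lemma has_orderB N f g : has_order N f -> has_order N g -> has_order N (f - g).
Proof. by move=> fN gN; apply/has_orderD/has_orderN. Qed.

Lemma has_order_sum N (I : Type) (r : seq I) (P : pred I) (G : I -> PS) :
  (forall i, P i -> has_order N (G i)) -> has_order N (\sum_(i <- r | P i) G i).
Proof.
by move=> GN; apply: big_ind => //; apply: has_orderD.
Qed.

Lemma has_order_le M N f : (M <= N)%N -> has_order N f -> has_order M f.
Proof. by move=> MN fN m mM; apply/fN/(leq_trans mM). Qed.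

Lemma has_orderM M N f g :
  has_order M f -> has_order N g -> has_order (M + N) (f * g).
Proof.
move=> fM gN m mMN; apply: big1 => h /eqP mE.
have [/fM ->|h1] := ltnP (mdeg h.1) M; first by rewrite mul0r.
have [/gN ->|h2] := ltnP (mdeg h.2) N; first by rewrite mulr0.
have MN : (M + N <= mdeg m)%N by have := leq_add h1 h2; rewrite -mdegD -mE.
by rewrite ltnNge MN in mMN.
Qed.

Lemma has_orderMr N f g : has_order N f -> has_order N (f * g).
Proof. by move=> fN; have := has_orderM fN (has_order0 g); rewrite addn0. Qed.

Lemma has_orderMl N f g : has_order N g -> has_order N (f * g).
Proof. by move=> gN; rewrite mulrC; apply: has_orderMr. Qed.

Lemma has_orderX M f d : has_order M f -> has_order (d * M) (f ^+ d).
Proof.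
move=> fM; elim: d => [|d IH]; first exact: has_order0.
by rewrite exprS mulSn; apply: has_orderM.
Qed.

Lemma has_order_psX m : has_order (mdeg m) (psX k m).
Proof. by move=> l lm; rewrite /= mcoeffX; case: eqP lm => // ->; rewrite ltnn. Qed.

Lemma has_order1 f : has_order 1 f <-> pscoeff f 0%MM = 0.
Proof.
split=> [|f0 m]; first by apply; rewrite mdeg0.
by rewrite ltnS leqn0 mdeg_eq0 => /eqP ->.
Qed.

Lemma ps_order_eq f g : (forall N, has_order N (f - g)) -> f = g.
Proof.
move=> fg; apply: psP => m; apply/eqP; rewrite -subr_eq0 -pscoeffB.
by rewrite (fg (mdeg m).+1).
Qed.

Lemma pstrunc_order N f : has_order N.+1 (f - ps_of_mpoly (pstrunc N f)).
Proof. by move=> m mN; rewrite pscoeffB /= pstruncP ?subrr. Qed.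

Lemma ps_neq0_order f : f <> 0 ->
  exists N m, [/\ has_order N f, mdeg m = N & pscoeff f m != 0].
Proof.
move=> f0; have ex : exists N, `[< exists m, mdeg m = N /\ pscoeff f m != 0 >].
  apply: contrapT => no; apply: f0; apply: psP => m; apply: contrapT => /eqP fm.
  by apply: no; exists (mdeg m); apply/asboolP; exists m.
case: (ex_minnP ex) => N /asboolP[m [mN fm]] minN; exists N, m; split=> // l lN.
apply/eqP; apply: contraTT lN => fl; rewrite -leqNgt; apply: minN.
by apply/asboolP; exists l.
Qed.

(** The product of the initial forms of two nonzero series is nonzero. *)
Lemma ps_domain f g : f * g = 0 -> f = 0 \/ g = 0.
Proof.
move=> fg; apply: contrapT => /not_orP[/ps_neq0_order[d [m1 [fd m1d fm]]]].
move=> /ps_neq0_order[e [m2 [ge m2e gm]]].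
pose P := pstrunc d f; pose Q := pstrunc e g.
have P0 : P != 0.
  by apply: contra fm => /eqP P0; rewrite -(@pstruncP _ _ d f) ?m1d // -/P P0 mcoeff0.
have Q0 : Q != 0.
  by apply: contra gm => /eqP Q0; rewrite -(@pstruncP _ _ e g) ?m2e // -/Q Q0 mcoeff0.
have supp M (F : PS) m : has_order M F -> m \in msupp (pstrunc M F) -> mdeg m = M.
  move=> FM; rewrite mcoeff_msupp => mP; apply/eqP; rewrite eqn_leq.
  case: leqP => [mM|Mm] /=.
    by rewrite leqNgt; apply: contra mP => /FM F0; rewrite pstruncP // F0.
  move: mP; rewrite /pstrunc (raddf_sum (mcoeff m)) big1 ?eqxx //= => l _.
  rewrite mcoeffZ mcoeffX; case: eqP => [E|]; last by rewrite mulr0.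
  by move: Mm; rewrite -E ltnNge -ltnS bmdeg.
have : P * Q != 0 by rewrite mulf_neq0.
case/eqP/mpolyP => m; rewrite mcoeff0.
have [md|md] := eqVneq (mdeg m) (d + e)%N; last first.
  apply/eqP; rewrite mcoeff_eq0; apply: contra md => /msuppM_le/allpairsP[[a b]].
  by case=> /= /(supp _ _ _ fd) ad /(supp _ _ _ ge) be ->; rewrite mdegD ad be.
have <- : pscoeff (f * g) m = 0 by rewrite fg.
rewrite [LHS]mcoeffM [RHS]/=; apply: eq_bigr => h /eqP mE.
have hd : (mdeg h.1 + mdeg h.2 = d + e)%N by rewrite -mdegD -mE.
have trunc0 M (F : PS) l : has_order M F -> (mdeg l < M)%N -> (pstrunc M F)@_l = 0.
  by move=> FM lM; rewrite pstruncP ?FM // ltnW.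
have [h1|h1|h1] := ltngtP (mdeg h.1) d.
- by rewrite fd // trunc0 // !mul0r.
- have h2 : (mdeg h.2 < e)%N by lia.
  by rewrite ge // (trunc0 e) // !mulr0.
- have h2 : (mdeg h.2 = e)%N by apply: (@addnI d); rewrite -hd h1.
  by rewrite !pstruncP ?h1 ?h2.
Qed.

(** If [G i] has order at least [i], the terms with [i > mdeg m] have no
    monomial [m]. *)
Definition ps_series (G : nat -> PS) : PS :=
  PowerSeries (fun m => \sum_(i < (mdeg m).+1) pscoeff (G i) m).

Lemma ps_seriesP G N : (forall i, has_order i (G i)) ->
  has_order N (ps_series G - \sum_(i < N) G i).
Proof.
move=> GO m mN; rewrite pscoeffB pscoeff_sum /=.
rewrite (big_ord_widen N (fun i => pscoeff (G i) m) mN) big_mkcond /= -sumrB.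
apply: big1 => i _; case: ifP => [_|/negbT]; first by rewrite subrr.
by rewrite ltnS -ltnNge => /GO ->; rewrite subrr.
Qed.

Lemma ps_unit f : pscoeff f 0%MM != 0 -> exists g, g * f = 1.
Proof.
move=> f0; pose t : PS := 1 - psC n (pscoeff f 0%MM)^-1 * f.
have t1 : has_order 1 t.
  by apply/has_order1; rewrite pscoeffB pscoeffCM mulVf // pscoeff1 eqxx subrr.
have tO i : has_order i (t ^+ i) by have := has_orderX (d := i) t1; rewrite muln1.
pose s := ps_series (fun i => t ^+ i).
suff st : s * (1 - t) = 1.
  exists (s * psC n (pscoeff f 0%MM)^-1); rewrite -mulrA -[RHS]st; congr (_ * _).
  by rewrite /t opprB addrCA subrr addr0.
apply: ps_order_eq => N.
have -> : s * (1 - t) - 1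
    = (s - \sum_(i < N) t ^+ i) * (1 - t) - t ^+ N.
  have := subrX1 t N; move: (\sum_(i < N) _) => S E.
  have {}E : t ^+ N = 1 + (t - 1) * S by rewrite -E addrC subrK.
  rewrite E; ring.
exact/has_orderB/tO/has_orderMr/ps_seriesP.
Qed.

End Order.

Section Substitution.
Variables (r n : nat) (k : fieldType) (h : 'I_r -> powerseries n k).
Hypothesis h_order : forall i, has_order 1 (h i).
Local Notation PS := (powerseries n k).

Fact psC_is_additive : additive (@psC n k).
Proof. by move=> x y; rewrite /psC mpolyCB rmorphB. Qed.
Fact psC_is_multiplicative : multiplicative (@psC n k).
Proof. by split=> [x y|]; rewrite /psC ?mpolyCM ?rmorphM // mpolyC1 rmorph1. Qed.
HB.instance Definition _ := GRing.isAdditive.Build k PS (@psC n k) psC_is_additive.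
HB.instance Definition _ :=
  GRing.isMultiplicative.Build k PS (@psC n k) psC_is_multiplicative.

Definition poly_subst (p : {mpoly k[r]}) : PS := mmap (@psC n k) h p.

(** As the [h i] have no constant term, a coefficient of degree [d] only depends
    on the truncation of [f] in degree [d]. *)
Definition ps_subst (f : powerseries r k) : PS :=
  PowerSeries (fun m => pscoeff (poly_subst (pstrunc (mdeg m) f)) m).

Lemma poly_substB p q : poly_subst (p - q) = poly_subst p - poly_subst q.
Proof. exact: mmapB. Qed.

Lemma poly_substM p q : poly_subst (p * q) = poly_subst p * poly_subst q.
Proof. exact: rmorphM. Qed.

Lemma poly_substX i : poly_subst 'X_i = h i.
Proof. by rewrite /poly_subst mmapX mmap1U. Qed.

Lemma poly_substC c : poly_subst c%:MP = psC n c.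
Proof. exact: mmapC. Qed.

Lemma poly_subst_order N (p : {mpoly k[r]}) :
  (forall m, (mdeg m < N)%N -> p@_m = 0) -> has_order N (poly_subst p).
Proof.
move=> p0; rewrite /poly_subst /mmap; apply: has_order_sum => m _.
have [mN|mN] := ltnP (mdeg m) N; first by rewrite p0 // rmorph0 mul0r.
apply: has_orderMl; apply: has_order_le mN _; rewrite /mmap1 mdegE.
elim/big_rec2: _ => // i N' f _ fN; apply: has_orderM => //.
by have := has_orderX (d := m i) (h_order i); rewrite muln1.
Qed.

Lemma ps_subst_approx N f p : has_order N (f - ps_of_mpoly p) ->
  has_order N (ps_subst f - poly_subst p).
Proof.
move=> fp m mN; rewrite pscoeffB /= -pscoeffB -poly_substB.
apply: (@poly_subst_order (mdeg m).+1) => // l lm.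
rewrite mcoeffB pstruncP //; apply/eqP; rewrite subr_eq0; apply/eqP.
by have := fp l (leq_trans lm mN); rewrite pscoeffB /= => /eqP; rewrite subr_eq0 => /eqP.
Qed.

Lemma ps_subst_poly p : ps_subst (ps_of_mpoly p) = poly_subst p.
Proof.
by apply: ps_order_eq => N; apply: ps_subst_approx; rewrite subrr.
Qed.

Lemma ps_subst_order N f : has_order N f -> has_order N (ps_subst f).
Proof.
move=> fN; have -> : ps_subst f = ps_subst f - poly_subst 0.
  by rewrite /poly_subst mmap0 subr0.
by apply: ps_subst_approx; rewrite rmorph0 subr0.
Qed.

Fact ps_subst_is_additive : additive ps_subst.
Proof.
move=> f g; apply: ps_order_eq => N.
have F := @pstrunc_order _ _ N f; have G := @pstrunc_order _ _ N g.
set P := pstrunc N f in F; set Q := pstrunc N g in G.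
have FG : has_order N.+1 ((f - g) - ps_of_mpoly (P - Q)).
  have -> : (f - g) - ps_of_mpoly (P - Q) = (f - ps_of_mpoly P) - (g - ps_of_mpoly Q).
    by rewrite rmorphB; ring.
  exact: has_orderB.
apply: (has_order_le (leqnSn N)).
have -> : ps_subst (f - g) - (ps_subst f - ps_subst g) =
    (ps_subst (f - g) - poly_subst (P - Q))
    - ((ps_subst f - poly_subst P) - (ps_subst g - poly_subst Q)).
  by rewrite poly_substB; ring.
by apply: has_orderB; last apply: has_orderB; apply: ps_subst_approx.
Qed.

Fact ps_subst_is_multiplicative : multiplicative ps_subst.
Proof.
split=> [f g|]; last first.
  by rewrite -[X in ps_subst X]ps_of_mpoly1 ps_subst_poly -mpolyC1 poly_substC rmorph1.
apply: ps_order_eq => N.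
have F := @pstrunc_order _ _ N f; have G := @pstrunc_order _ _ N g.
set P := pstrunc N f in F; set Q := pstrunc N g in G.
have FG : has_order N.+1 (f * g - ps_of_mpoly (P * Q)).
  have -> : f * g - ps_of_mpoly (P * Q)
      = (f - ps_of_mpoly P) * g + ps_of_mpoly P * (g - ps_of_mpoly Q).
    by rewrite rmorphM; ring.
  by apply: has_orderD; [apply: has_orderMr | apply: has_orderMl].
apply: (has_order_le (leqnSn N)).
have -> : ps_subst (f * g) - ps_subst f * ps_subst g =
    (ps_subst (f * g) - poly_subst (P * Q))
    - ((ps_subst f - poly_subst P) * ps_subst g
       + poly_subst P * (ps_subst g - poly_subst Q)).
  by rewrite poly_substM; ring.
apply: has_orderB; first exact: ps_subst_approx.
by apply: has_orderD; [apply: has_orderMr | apply: has_orderMl];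
  apply: ps_subst_approx.
Qed.

HB.instance Definition _ :=
  GRing.isAdditive.Build (powerseries r k) PS ps_subst ps_subst_is_additive.
HB.instance Definition _ :=
  GRing.isMultiplicative.Build (powerseries r k) PS ps_subst ps_subst_is_multiplicative.

Definition ps_subst_rmorphism : {rmorphism powerseries r k -> PS} := ps_subst.

Lemma ps_substX i : ps_subst (psX k U_(i)) = h i.
Proof. by rewrite ps_subst_poly poly_substX. Qed.

Lemma ps_substC c : ps_subst (psC r c) = psC n c.
Proof. by rewrite ps_subst_poly poly_substC. Qed.

End Substitution.
(** * Finite extensions of power series rings *)

Section Finiteness.
Variables (r n : nat) (k : fieldType) (h : 'I_r -> powerseries n k).
Hypothesis h_order : forall i, has_order 1 (h i).
Variables (f : powerseries n k) (M : nat).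
Hypothesis span : forall p, has_order M p ->
  exists s (P : 'I_r -> powerseries n k), p = f * s + \sum_i h i * P i.

Local Notation PS := (powerseries n k).
Local Notation psi := (ps_subst h).

Let psiR : {rmorphism powerseries r k -> PS} := ps_subst_rmorphism h_order.

(** A power series ring is finite over another one modulo [f] as soon as the
    variables of the latter and [f] generate an ideal that contains a power of
    the maximal ideal: reducing repeatedly gives convergent coefficients. *)
Lemma finite_over_subst p : exists s (b : 'X_{1..n < M} -> powerseries r k),
  p = f * s + \sum_mu psi (b mu) * psX k mu.
Proof.
have /choice [SP SPE] q : exists SP : PS * ('I_r -> PS),
    q = f * SP.1 + \sum_(mu : 'X_{1..n < M}) psC n (pscoeff q mu) * psX k mu
        + \sum_i h i * SP.2 i.
  have [|s [P qE]] := span (p := q - \sum_(mu : 'X_{1..n < M})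
      psC n (pscoeff q mu) * psX k mu).
    move=> m mM; rewrite pscoeffB pscoeff_sum.
    under eq_bigr do rewrite pscoeffCM /psX /= mcoeffX.
    rewrite (bigD1 (BMultinom mM)) //= eqxx mulr1 big1 ?addr0 ?subrr // => mu mum.
    case: eqP => [E|]; last by rewrite mulr0.
    by case/eqP: mum; apply: val_inj.
  by exists (s, P); rewrite -[LHS](subrK (\sum_(mu : 'X_{1..n < M})
      psC n (pscoeff q mu) * psX k mu)) qE /=; ring.
pose b := fix b N q (mu : 'X_{1..n < M}) : powerseries r k :=
  if N is N'.+1 then psC r (pscoeff q mu)
    + \sum_i psX k U_(i) * b N' ((SP q).2 i) mu else 0.
pose s := fix s N q : PS :=
  if N is N'.+1 then (SP q).1 + \sum_i h i * s N' ((SP q).2 i) else 0.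
pose rem := fix rem N q : PS :=
  if N is N'.+1 then \sum_i h i * rem N' ((SP q).2 i) else q.
have step N q : q = f * s N q + \sum_mu psi (b N q mu) * psX k mu + rem N q.
  elim: N q => [|N IH] q /=.
    by rewrite mulr0 big1 ?add0r // => mu _; rewrite (rmorph0 psiR) mul0r.
  rewrite {1}[q]SPE mulrDr -!addrA; congr (_ + _).
  have -> : \sum_(mu : 'X_{1..n < M}) psi (psC r (pscoeff q mu)
      + \sum_i psX k U_(i) * b N ((SP q).2 i) mu) * psX k mu
    = \sum_(mu : 'X_{1..n < M}) psC n (pscoeff q mu) * psX k mu
      + \sum_i h i * \sum_mu psi (b N ((SP q).2 i) mu) * psX k mu.
    under [X in _ + X]eq_bigr do rewrite mulr_sumr.
    rewrite exchange_big -big_split; apply: eq_bigr => mu _ /=.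
    rewrite (rmorphD psiR) (rmorph_sum psiR) /= ps_substC // mulrDl mulr_suml.
    congr (_ + _); apply: eq_bigr => i _.
    by rewrite (rmorphM psiR) /= ps_substX // mulrA.
  rewrite -[in RHS]addrA addrCA; congr (_ + _); rewrite mulr_sumr -!big_split.
  apply: eq_bigr => i _ /=; rewrite {1}(IH ((SP q).2 i)); ring.
have rem_order N q : has_order N (rem N q).
  elim: N q => [|N IH] q /=; first exact: has_order0.
  by apply: has_order_sum => i _; apply: (@has_orderM _ _ 1).
have sS N q : s N.+1 q = (SP q).1 + \sum_i h i * s N ((SP q).2 i) by [].
have bS N q mu : b N.+1 q mu = psC r (pscoeff q mu)
    + \sum_i psX k U_(i) * b N ((SP q).2 i) mu by [].
have sC N q : has_order N (s N.+1 q - s N q).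
  elim: N q => [|N IH] q; first exact: has_order0.
  rewrite sS [s N.+1 q]sS opprD addrACA subrr add0r -sumrB.
  apply: has_order_sum => i _; rewrite -mulrBr.
  by apply: (@has_orderM _ _ 1).
have bC N q mu : has_order N (b N.+1 q mu - b N q mu).
  elim: N q => [|N IH] q; first exact: has_order0.
  rewrite bS [b N.+1 q mu]bS opprD addrACA subrr add0r -sumrB.
  apply: has_order_sum => i _; rewrite -mulrBr.
  apply: (@has_orderM _ _ 1) => //.
  by rewrite -(mdeg1 i); apply: has_order_psX.
have sum_s N q : \sum_(i < N) (s i.+1 q - s i q) = s N q.
  by rewrite -(big_mkord xpredT (fun i => s i.+1 q - s i q)) telescope_sumr // subr0.
have sum_b N q mu : \sum_(i < N) (b i.+1 q mu - b i q mu) = b N q mu.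
  by rewrite -(big_mkord xpredT (fun i => b i.+1 q mu - b i q mu)) telescope_sumr //
    subr0.
pose s' := ps_series (fun i => s i.+1 p - s i p).
pose b' mu := ps_series (fun i => b i.+1 p mu - b i p mu).
exists s', b'; apply: ps_order_eq => N.
have -> : p - (f * s' + \sum_mu psi (b' mu) * psX k mu)
   = rem N p - f * (s' - s N p) - \sum_mu psi (b' mu - b N p mu) * psX k mu.
  rewrite {1}[p](step N).
  under [X in _ = _ - X]eq_bigr do rewrite (rmorphB psiR) mulrBl /=.
  by rewrite sumrB; ring.
apply: has_orderB; first apply: has_orderB => //.
  by apply: has_orderMl; rewrite -sum_s; apply: ps_seriesP.
apply: has_order_sum => mu _; apply: has_orderMr; apply: ps_subst_order => //.
by rewrite -sum_b; apply: ps_seriesP.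
Qed.

Hypothesis M_gt0 : (0 < M)%N.

(** The Cayley-Hamilton theorem turns finiteness into integrality. *)
Lemma integral_over_subst a : exists2 c : {poly powerseries r k},
  c \is monic & exists s, (map_poly psi c).[a] = f * s.
Proof.
pose I : finType := 'X_{1..n < M}; pose N := #|I|.
have /choice [SB SBE] (mu : I) : exists SB : PS * (I -> powerseries r k),
    a * psX k mu = f * SB.1 + \sum_nu psi (SB.2 nu) * psX k nu.
  by have [s [b E]] := finite_over_subst (a * psX k mu); exists (s, b).
pose C : 'M[powerseries r k]_N :=
  \matrix_(i, j) (SB (enum_val i)).2 (enum_val j).
pose ev : {rmorphism {poly powerseries r k} -> PS} := horner_eval a \o map_poly psiR.
exists (char_poly C); first exact: char_poly_monic.
pose e : 'cV[PS]_N := \col_i psX k (enum_val i : I).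
pose X : 'M[PS]_N := map_mx ev (char_poly_mx C).
have XE i : (X *m e) i 0 = f * (SB (enum_val i)).1.
  have -> : X = a%:M - map_mx psi C.
    apply/matrixP => i' j'; rewrite !mxE /= /horner_eval.
    rewrite rmorphB /= map_polyC /= hornerD hornerN hornerC; congr (_ - _).
    case: (i' == j'); last exact: (rmorph0 ev).
    rewrite !mulr1n map_polyX; first exact: hornerX.
    exact: h_order.
  rewrite mulmxBl mul_scalar_mx !mxE SBE -addrA -[RHS]addr0; congr (_ + _).
  apply/eqP; rewrite subr_eq0; apply/eqP.
  rewrite (reindex (@enum_val I predT)) /=; last first.
    by apply: onW_bij; apply: enum_val_bij.
  by apply: eq_bigr => j _; rewrite !mxE.
have m0 : (mdeg (0%MM : 'X_{1..n}) < M)%N by rewrite mdeg0.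
exists (\sum_i (\adj X) (enum_rank (BMultinom m0)) i * (SB (enum_val i)).1).
have -> : (map_poly psi (char_poly C)).[a] = \det X by rewrite det_map_mx.
have := congr1 (fun Y : 'M_N => (Y *m e) (enum_rank (BMultinom m0)) 0) (mul_adj_mx X).
rewrite mul_scalar_mx -mulmxA !mxE enum_rankK /= psX0 mulr1 => <-.
by rewrite mulr_sumr; apply: eq_bigr => i _; rewrite XE mulrCA.
Qed.

End Finiteness.
(** * Contraction of primes along an integral map *)

Section ContractedPrimes.
Variables (A B : comNzRingType) (psi : {rmorphism B -> A}).

Lemma ideal0 (R : comNzRingType) (P : classical_sets.set R) : is_ideal P -> P 0.
Proof. by case. Qed.

Lemma idealB (R : comNzRingType) (P : classical_sets.set R) x y :
  is_ideal P -> P x -> P y -> P (x - y).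
Proof. by case=> _ PD PM Px Py; apply: PD => //; rewrite -mulN1r; apply: PM. Qed.

Lemma prime_preimage (P : classical_sets.set A) :
  is_prime_ideal P -> is_prime_ideal (fun b => P (psi b)).
Proof.
case=> -[P0 PD PM] P1 PP; split; [split| |].
- by rewrite rmorph0.
- by move=> x y Px Py; rewrite rmorphD; apply: PD.
- by move=> a x Px; rewrite rmorphM; apply: PM.
- by rewrite rmorph1.
- by move=> x y; rewrite rmorphM; apply: PP.
Qed.

(** The constant coefficient of an integral equation of minimal degree for an
    element of [P'] that is not in [P] separates the contractions. *)
Lemma integral_separates (P P' : classical_sets.set A) a (c : {poly B}) :
  is_prime_ideal P -> is_prime_ideal P' -> (forall x, P x -> P' x) ->
  P' a -> ~ P a -> c \is monic -> P (map_poly psi c).[a] ->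
  exists2 b, P' (psi b) & ~ P (psi b).
Proof.
move=> [PI P1 PP] [[P0' PD' PM'] _ _] PP' Pa' Pa.
have [N cN] := ubnP (size c); elim: N c cN => // N IH c cN c_monic Pc.
have c0 : c != 0 by apply: monic_neq0.
elim/poly_ind: c cN c_monic Pc c0 => [|q b _]; first by rewrite eqxx.
move=> cN c_monic Pc c0.
have E : (map_poly psi (q * 'X + b%:P)).[a] = (map_poly psi q).[a] * a + psi b.
  rewrite rmorphD rmorphM /= map_polyX map_polyC hornerD hornerC hornerM.
  by rewrite hornerX.
have [q0|q0] := eqVneq q 0.
  case: P1; move: Pc; rewrite E q0 rmorph0 horner0 mul0r add0r.
  suff -> : b = 1 by rewrite rmorph1.
  by move: c_monic; rewrite q0 mul0r add0r monicE lead_coefC => /eqP.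
have [Pb|nPb] := pselect (P (psi b)); last first.
  exists b => //; have -> : psi b = (map_poly psi (q * 'X + b%:P)).[a]
      - (map_poly psi q).[a] * a by rewrite E addrAC subrr add0r.
  by rewrite addrC; apply: PD'; [rewrite -mulNr; apply: PM' | apply: PP'].
have size_lt : (size b%:P < size (q * 'X)%R)%N.
  by rewrite size_mulX // ltnS (leq_trans (size_polyC_leq1 _)) // size_poly_gt0.
apply: (IH q).
- by move: cN; rewrite size_polyDl // size_mulX.
- by move: c_monic; rewrite !monicE lead_coefDl // lead_coefMX.
have : P ((map_poly psi q).[a] * a).
  have -> : (map_poly psi q).[a] * a = (map_poly psi (q * 'X + b%:P)).[a] - psi b.
    by rewrite E addrK.
  exact: idealB.
by case/PP.
Qed.

End ContractedPrimes.

(** * Power series rings modulo a nonzero series *)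

Section Weights.
Local Open Scope nat_scope.

(** A nonempty set of exponents has an element that is the only one of minimal
    weight for suitable weights: minimize the last exponent first and give it
    a large weight. *)
Lemma generic_weights n (S : classical_sets.set (nat -> nat)) :
  (exists m, S m) ->
  exists e : nat -> nat, [/\ forall i, (0 < e i)%N, e 0%N = 1%N &
    exists2 m0, S m0 & forall m, S m ->
      (\sum_(i < n) e i * m0 i < \sum_(i < n) e i * m i)%N \/
      (forall i, (i < n)%N -> m i = m0 i)].
Proof.
elim: n S => [|n IH] S [m Sm].
  by exists (fun=> 1%N); split=> //; exists m => // m' _; right.
have ex : exists a, `[< exists m, S m /\ m n = a >].
  by exists (m n); apply/asboolP; exists m.
case: (ex_minnP ex) => a /asboolP[m1 [Sm1 m1a]] min_a.
have [|e [e_gt0 e0 [m0 [Sm0 m0a] m0min]]] := IH (fun m => S m /\ m n = a).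
  by exists m1.
pose E := (\sum_(i < n) e i * m0 i).+1.
pose e' i := if i == n then (if n == 0%N then 1%N else E) else e i.
have e'n : \sum_(i < n) e i * m0 i < e' n.
  by rewrite /e' eqxx /E; case: (n) => [|?] /=; rewrite ?big_ord0.
have sumE (m' : nat -> nat) :
    (\sum_(i < n.+1) e' i * m' i = \sum_(i < n) e i * m' i + e' n * m' n)%N.
  rewrite big_ord_recr; congr (_ + _)%N; apply: eq_bigr => i _.
  by rewrite /e' /= ltn_eqF.
exists e'; split.
- by move=> i; rewrite /e'; case: eqP => // _; case: ifP.
- by rewrite /e'; case: eqP => // <-.
exists m0 => // m' Sm'; rewrite !sumE m0a.
have : (a <= m' n)%N by apply: min_a; apply/asboolP; exists m'.
rewrite leq_eqVlt => /orP[/eqP m'a|lt_a].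
  have [lt|eq] := m0min m' (conj Sm' (esym m'a)).
    by left; rewrite -m'a ltn_add2r.
  right=> i; rewrite ltnS leq_eqVlt => /orP[/eqP ->|/eq //].
  by rewrite m0a.
left; apply: (@leq_trans (e' n * a.+1)).
  by rewrite mulnS ltn_add2r.
by apply: leq_trans (leq_addl _ _); rewrite leq_mul2l lt_a orbT.
Qed.

End Weights.
Section RegularSequence.
Variables (n : nat) (k : fieldType).
Local Notation PS := (powerseries n.+1 k).
Implicit Types (f p : PS).

Lemma psX_prod m : psX k m = \prod_(i < n.+1) psX k U_(i) ^+ m i :> PS.
Proof.
rewrite /psX [in LHS]mpolyXE_id rmorph_prod; apply: eq_bigr => i _.
by rewrite rmorphXn.
Qed.

(** A nonzero series [f] is regular along a generic monomial curve
    [t |-> (t, t ^ e_1, t ^ e_2, ...)], so [f] and the equations of that curve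
    generate an ideal that contains a power of the maximal ideal. *)
Lemma regular_parameters f : f <> 0 ->
  exists (h : 'I_n -> PS) M, [/\ forall i, has_order 1 (h i), (0 < M)%N &
    forall p, has_order M p -> exists s P, p = f * s + \sum_i h i * P i].
Proof.
move=> f0.
have [|e [e_gt0 e0 [m0' [m0 [fm0 ->] m0_min]]]] := @generic_weights n.+1
    (fun m' => exists m : 'X_{1..n.+1}, pscoeff f m != 0 /\ m' = fun i => m (inord i)).
  have [N [m [_ _ fm]]] := ps_neq0_order f0.
  by exists (fun i => m (inord i)), m.
pose w (m : 'X_{1..n.+1}) := (\sum_(i < n.+1) e i * m i)%N.
have wE (m : 'X_{1..n.+1}) : (\sum_(i < n.+1) e i * m (inord i) = w m)%N.
  by apply: eq_bigr => i _; rewrite inord_val.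
have {}m0_min m : pscoeff f m != 0 -> m != m0 -> (w m0 < w m)%N.
  move=> fm mm0; have [|lt|eq] := m0_min (fun i => m (inord i)); first by exists m.
    by rewrite -!wE.
  by case/eqP: mm0; apply/mnmP => i; have := eq i (ltn_ord i); rewrite inord_val.
pose T := psX k U_(ord0) : PS.
have T_order d : has_order d (T ^+ d).
  suff T1 : has_order 1 T by have := has_orderX (d := d) T1; rewrite muln1.
  by rewrite -(mdeg1 (ord0 : 'I_n.+1)); apply: has_order_psX.
pose h (i : 'I_n) : PS := psX k U_(fintype.lift ord0 i) - T ^+ e (fintype.lift ord0 i).
pose I p := exists P : 'I_n -> PS, p = \sum_i h i * P i.
have I0 : I 0 by exists (fun=> 0); rewrite big1 // => i _; rewrite mulr0.
have ID x y : I x -> I y -> I (x + y).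
  move=> [P ->] [Q ->]; exists (fun i => P i + Q i).
  by rewrite -big_split; apply: eq_bigr => i _; rewrite mulrDr.
have IM a x : I x -> I (a * x).
  move=> [P ->]; exists (fun i => a * P i).
  by rewrite mulr_sumr; apply: eq_bigr => i _; rewrite mulrCA.
have I_sum (J : finType) (G H : J -> PS) :
    (forall j, I (G j - H j)) -> I (\sum_j G j - \sum_j H j).
  by move=> GH; rewrite -sumrB; apply: big_ind => // j _; apply: GH.
have I_mul a b c d : I (a - b) -> I (c - d) -> I (a * c - b * d).
  move=> ab cd; have -> : a * c - b * d = c * (a - b) + b * (c - d) by ring.
  by apply: ID; apply: IM.
have I_exp a b j : I (a - b) -> I (a ^+ j - b ^+ j).
  move=> ab; elim: j => [|j IH]; first by rewrite subrr.
  by rewrite !exprS; apply: I_mul.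
have I_var (i : 'I_n.+1) : I (psX k U_(i) - T ^+ e i).
  case: (unliftP ord0 i) => [j ->|->]; last by rewrite e0 expr1 subrr.
  exists (fun l => (l == j)%:R); rewrite (bigD1 j) //= eqxx mulr1 big1 ?addr0 //.
  by move=> l /negbTE ->; rewrite mulr0.
have I_mon m : I (psX k m - T ^+ w m).
  have -> : T ^+ w m = \prod_(i < n.+1) (T ^+ e i) ^+ m i.
    rewrite /w; elim/big_rec2: _ => // i x y _ <-.
    by rewrite exprD exprM.
  rewrite psX_prod; elim/big_rec2: _ => [|i x y _ xy]; first by rewrite subrr.
  by apply: I_mul => //; apply: I_exp.
pose Q := (w m0).+1; pose M := (n.+1 * Q)%N.
have high p : has_order M p -> exists b, I (p - T ^+ Q * b).
  move=> pM; have [m mQ|g ->] := @ps_box_decomposition _ _ Q p.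
    apply: pM; rewrite mdegE /M.
    have : (\sum_(i < n.+1) m i <= \sum_(i < n.+1) w m0)%N.
      by apply: leq_sum => i _; have := mQ i.
    rewrite sum_nat_const card_ord => /leq_ltn_trans; apply.
    by rewrite ltn_mul2l /=.
  exists (\sum_(i < n.+1) T ^+ (e i * Q - Q) * g i).
  rewrite mulr_sumr; apply: I_sum => i; rewrite psX_exp mulrA -exprD.
  rewrite subnKC; last by rewrite leq_pmull.
  by rewrite exprM -mulrBl mulrC; apply: IM; apply: I_exp.
have [u [b fE]] : exists u b, [/\ has_order 1 b, u * psC n.+1 (pscoeff f m0) = 1 &
    I (f - T ^+ w m0 * (psC n.+1 (pscoeff f m0) + b))].
  have [b Ib] := high _ (has_order_le (leqnSn M) (@pstrunc_order _ _ M f)).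
  pose c (m : 'X_{1..n.+1 < M.+1}) : PS := psC n.+1 (pscoeff f m).
  have truncE : ps_of_mpoly (pstrunc M f) = \sum_m c m * psX k m.
    rewrite /pstrunc rmorph_sum; apply: eq_bigr => m _.
    by rewrite -mul_mpolyC rmorphM.
  have m0M : (mdeg m0 < M.+1)%N.
    rewrite ltnS mdegE (@leq_trans (w m0)) //.
      by apply: leq_sum => i _; rewrite leq_pmull.
    by rewrite /M /Q mulSn (leq_trans (leqnSn _)) // leq_addr.
  exists (psC n.+1 (pscoeff f m0)^-1), (T * b + \sum_(m | m != BMultinom m0M)
    c m * T ^+ (w m - w m0)); split.
  - apply: has_orderD.
      by apply: has_orderMr; rewrite -[T]expr1.
    apply: has_order_sum => m mm0; have [->|fm] := eqVneq (c m) 0.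
      by rewrite mul0r; apply: has_order_0.
    apply: has_orderMl; apply: (@has_order_le _ _ _ (w m - w m0)).
      rewrite subn_gt0; apply: m0_min => //.
      by apply: contra fm => /eqP fm; rewrite /c fm rmorph0.
    exact: T_order.
  - by rewrite -rmorphM mulVf // rmorph1.
  have -> : f - T ^+ w m0 * (psC n.+1 (pscoeff f m0)
      + (T * b + \sum_(m | m != BMultinom m0M) c m * T ^+ (w m - w m0)))
    = (f - ps_of_mpoly (pstrunc M f) - T ^+ Q * b)
      + (\sum_m c m * psX k m - \sum_m c m * T ^+ w m).
    rewrite truncE [\sum_m c m * T ^+ w m](bigD1 (BMultinom m0M)) //=.
    have -> : \sum_(m | m != BMultinom m0M) c m * T ^+ w m
        = T ^+ w m0 * \sum_(m | m != BMultinom m0M) c m * T ^+ (w m - w m0).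
      rewrite mulr_sumr; apply: eq_bigr => m mm0.
      have [->|fm] := eqVneq (c m) 0; first by rewrite !mul0r mulr0.
      rewrite mulrCA -exprD subnKC // ltnW // m0_min //.
      by apply: contra fm => /eqP fm; rewrite /c fm rmorph0.
    rewrite /c /Q exprS /=; ring.
  apply: ID => //; apply: I_sum => m; rewrite -mulrBr.
  by apply: IM.
have [b1 u1 fI] := fE.
have [v vE] : exists v, v * (psC n.+1 (pscoeff f m0) + b) = 1.
  apply: ps_unit; rewrite pscoeffD (has_order1 b).1 // addr0.
  by rewrite -[psC _ _]mulr1 pscoeffCM pscoeff1 eqxx mulr1.
exists h, M; split=> //.
- move=> i; apply: has_orderB; first by rewrite -(mdeg1 (fintype.lift ord0 i)); apply: has_order_psX.
  by apply: has_order_le (T_order _).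
move=> p pM; have [b2 Ib2] := high p pM.
have [P PE] : I (p - f * (v * T * b2)).
  have -> : p - f * (v * T * b2) = (p - T ^+ Q * b2)
    + (- (v * T * b2)) * (f - T ^+ w m0 * (psC n.+1 (pscoeff f m0) + b)).
    rewrite /Q exprS -[T * T ^+ w m0]mulr1 -vE; ring.
  by apply: ID => //; apply: IM.
by exists (v * T * b2), P; rewrite -PE addrC subrK.
Qed.

End RegularSequence.
(** * Chains of primes in power series rings and their quotients *)

Section PrimeChains.
Variable k : fieldType.
Import classical_sets.
Local Open Scope classical_set_scope.

Lemma subset_strict (T : Type) (X Y : set T) : X `<` Y ->
  (forall x, X x -> Y x) /\ exists2 x, Y x & ~ X x.
Proof.
move=> [XY YX]; split=> //; apply: contrapT => no; apply: YX => y Yy.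
by apply: contrapT => nXy; apply: no; exists y.
Qed.

Lemma strict_subset (T : Type) (X Y : set T) x :
  (forall x, X x -> Y x) -> Y x -> ~ X x -> X `<` Y.
Proof. by move=> XY Yx nXx; split=> // YX; apply/nXx/YX. Qed.

Lemma prime_has_order1 n (P : set (powerseries n k)) f :
  is_prime_ideal P -> P f -> has_order 1 f.
Proof.
move=> [[_ _ PM] P1 _] Pf; apply/has_order1; apply: contrapT => /eqP /ps_unit[g gf].
by apply: P1; rewrite -gf; apply: PM.
Qed.

(** A nonzero member of the second prime of a chain makes the ring finite over
    a power series ring in one variable less, and the contraction of the rest
    of the chain remains strict. *)
Theorem powerseries_chain n d : has_chain (@is_prime_ideal (powerseries n k)) d ->
  (d <= n)%N.
Proof.
elim: n d => [|n IH] [//|d] [J [Jp Jlt]].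
  have [_ [a Ja nJa]] := subset_strict (Jlt 0%N isT).
  have [/ps_neq0_order[N [m [aN mN am]]]|a0] := pselect (a <> 0); last first.
    by case: nJa; move/contrapT: a0 => ->; apply: ideal0; case: (Jp 0%N isT).
  have m0 : m = 0%MM by apply/mnmP => -[].
  have := prime_has_order1 (Jp 1%N isT) Ja; move/has_order1.
  by rewrite m0 in am => a0; rewrite a0 eqxx in am.
have [_ [f Jf nJf]] := subset_strict (Jlt 0%N isT).
have f0 : f <> 0.
  by move=> f0; apply: nJf; rewrite f0; apply: ideal0; case: (Jp 0%N isT).
have [h [M [h1 M0 span]]] := regular_parameters f0.
pose psi := ps_subst_rmorphism h1.
have Jmono i j : (i <= j <= d.+1)%N -> forall x, J i x -> J j x.
  elim: j => [|j IHj]; first by rewrite leqn0 => /andP[/eqP ->].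
  rewrite leq_eqVlt => /andP[/orP[/eqP <- //|ij] jd] x Jx.
  have [+ _] := subset_strict (Jlt j jd); apply.
  by apply: IHj => //; rewrite -ltnS ij ltnW.
rewrite ltnS; apply: IH; exists (fun i b => J i.+1 (psi b)); split=> i id.
  by apply: prime_preimage; apply: Jp.
have [sub [a Ja nJa]] := subset_strict (Jlt i.+1 id).
have [c c_monic [s cE]] := integral_over_subst h1 span M0 a.
have Jfi : J i.+1 f by apply: Jmono Jf; rewrite /= ltnW.
have [|b Jb nJb] := integral_separates (psi := psi) (Jp i.+1 (ltnW id)) (Jp i.+2 id) sub Ja nJa c_monic.
  have [[_ _ IM] _ _] := Jp i.+1 (ltnW id).
  by rewrite /= cE mulrC; apply: IM.
by apply: (strict_subset _ Jb nJb) => x; apply: sub.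
Qed.

End PrimeChains.

Section Quotient.
Variables (A : comNzRingType) (a : A) (a_proper : forall b, b * a != 1).
Import classical_sets.
Local Open Scope classical_set_scope.
Local Open Scope quotient_scope.
Local Notation R := (principal_quotient a_proper).
Local Notation Q := {ideal_quot (principal_ideal a_proper)}.

Definition quot : {rmorphism A -> R} := \pi_Q.

Lemma quot_surj (y : R) : exists x, quot x = y.
Proof. by exists (repr (y : Q)); apply: reprK. Qed.

Lemma quot_eq0 x : quot x = 0 <-> exists b, x = b * a.
Proof.
have E : (x \in principal_ideal a_proper) = (\pi_Q x == \pi_Q 0).
  by rewrite -Quotient.idealrBE subr0.
have q0 : \pi_Q (0 : A) = 0 by apply: (rmorph0 quot).
split=> [x0|xb].
  apply/asboolP; rewrite -[`[< _ >]]/(x \in principal_ideal a_proper) E q0.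
  exact/eqP.
by apply/eqP; rewrite -q0 -E; apply/asboolP.
Qed.

Lemma quot_eq x y : quot x = quot y <-> exists b, x - y = b * a.
Proof.
rewrite -quot_eq0 rmorphB; split=> [->|/eqP]; first by rewrite subrr.
by rewrite subr_eq0 => /eqP.
Qed.

Lemma ideal_lift (I : set A) : is_ideal I -> I a ->
  is_ideal (quot @` I) /\ forall x, (quot @` I) (quot x) <-> I x.
Proof.
move=> II Ia; have [I0 ID IM] := II; split; first split.
- by exists 0 => //; rewrite rmorph0.
- move=> _ _ [x Ix <-] [y Iy <-]; exists (x + y); first exact: ID.
  by rewrite rmorphD.
- move=> b _ [x Ix <-]; have [c <-] := quot_surj b.
  by exists (c * x); [apply: IM | rewrite rmorphM].
move=> x; split=> [[y Iy /quot_eq[b yx]]|Ix]; last by exists x.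
have -> : x = y - b * a by rewrite -yx opprB addrC subrK.
by apply: idealB => //; apply: IM.
Qed.

Lemma prime_ideal_lift (P : set A) :
  is_prime_ideal P -> P a -> is_prime_ideal (quot @` P).
Proof.
move=> [PI P1 PP] Pa; have [qPI qP] := ideal_lift PI Pa.
split=> //; first by rewrite -(rmorph1 quot) => /qP.
move=> x y; have [x' <-] := quot_surj x; have [y' <-] := quot_surj y.
by rewrite -rmorphM => /qP/PP[] ?; [left | right]; apply/qP.
Qed.

(** The zero ideal of a domain extends the preimage of a chain in the quotient
    by one step. *)
Lemma is_krull_dim_quotient (d : nat) :
  (forall n, has_chain (@is_prime_ideal A) n -> (n <= d.+1)%N) ->
  is_prime_ideal [set (0 : A)] -> a <> 0 ->
  (exists J : nat -> set A, [/\ J 0%N a, forall i, (i <= d)%N -> is_prime_ideal (J i) &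
     forall i, (i < d)%N -> J i `<` J i.+1]) ->
  is_krull_dim R d.
Proof.
move=> bound P0 a0 [J [J0a Jp Jlt]]; split.
  have Ja i : (i <= d)%N -> J i a.
    elim: i => // i IH id; have [sub _] := subset_strict (Jlt i id).
    exact/sub/IH/ltnW.
  exists (fun i => quot @` J i); split=> i id.
    by apply: prime_ideal_lift; [apply: Jp | apply: Ja].
  have [sub [x Jx nJx]] := subset_strict (Jlt i id).
  apply: (strict_subset (x := quot x)).
  - by move=> _ [y Jy <-]; exists y => //; apply: sub.
  - by exists x.
  - by move/(ideal_lift _ (Ja i (ltnW id))).2 => /(_ (let: And3 H _ _ := Jp i (ltnW id) in H)).
move=> n' [K [Kp Klt]]; rewrite -ltnS; apply: bound.
exists (fun i => if i is i'.+1 then [set x | K i' (quot x)] else [set 0]).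
split=> -[|i] //= id.
- by apply: (prime_preimage quot); apply: Kp.
- apply: (strict_subset (x := a)) => [x ->||] //=.
    by rewrite rmorph0; apply: ideal0; case: (Kp 0%N isT).
  have -> : quot a = 0 by apply/quot_eq0; exists 1; rewrite mul1r.
  by apply: ideal0; case: (Kp 0%N isT).
- have [sub [y Ky nKy]] := subset_strict (Klt i id).
  have [x xy] := quot_surj y.
  by apply: (strict_subset (x := x)) => [z /= /sub||] //=; rewrite xy.
Qed.

End Quotient.
(** * The dimension of the hypersurface *)

Section Restriction.
Variables (n : nat) (k : fieldType).
Local Notation PS := (powerseries n k).
Implicit Types (f g : PS) (m : 'X_{1..n}).

Definition avoids i m := [forall j : 'I_n, (j < i)%N ==> (m j == 0%N)].

(** The series obtained by setting the first [i] variables to zero. *)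
Definition restr i f : PS :=
  PowerSeries (fun m => if avoids i m then pscoeff f m else 0).

Lemma avoidsD i m1 m2 : avoids i (m1 + m2)%MM = avoids i m1 && avoids i m2.
Proof.
apply/forallP/andP => [m12|[/forallP m1i /forallP m2i] j].
  by split; apply/forallP => j; have := m12 j; case: (j < i)%N => //=;
     rewrite mnmDE addn_eq0 => /andP[].
have := m1i j; have := m2i j; case: (j < i)%N => //= /eqP j2 /eqP j1.
by rewrite mnmDE j1 j2.
Qed.

Lemma restr_X i (j : 'I_n) : restr i (psX k U_(j)) = if (j < i)%N then 0 else psX k U_(j).
Proof.
apply: psP => m /=; rewrite mcoeffX.
have [<-|mj] := eqVneq U_(j)%MM m; last first.
  by rewrite if_same; case: ifP => //= _; rewrite mcoeffX (negbTE mj).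
have -> : avoids i U_(j)%MM = ~~ (j < i)%N.
  apply/forallP/idP => [/(_ j)|ij l]; first by rewrite mnm1E eqxx /=; case: (j < i)%N.
  by rewrite mnm1E; case: (j =P l) => [<-|] /=; [rewrite implybF | rewrite implybT].
by case: (j < i)%N => //=; rewrite mcoeffX eqxx.
Qed.

Lemma restr0 i : restr i 0 = 0.
Proof. by apply: psP => m /=; rewrite if_same. Qed.

Lemma restr1 i : restr i 1 = 1.
Proof.
apply: psP => m /=; rewrite mcoeff1; have [->|_] := eqVneq m 0%MM.
  by case: ifP => // /negP[]; apply/forallP => j; rewrite mnm0E eqxx implybT.
by rewrite if_same.
Qed.

Lemma restrD i f g : restr i (f + g) = restr i f + restr i g.
Proof. by apply: psP => m; rewrite pscoeffD /=; case: ifP; rewrite ?addr0. Qed.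

Lemma restrM i f g : restr i (f * g) = restr i f * restr i g.
Proof.
apply: psP => m; rewrite [LHS]/= [in RHS]/GRing.mul /=; case: ifP => mi.
  apply: eq_bigr => h /eqP /(congr1 (avoids i)).
  by rewrite mi avoidsD => /esym/andP[-> ->].
rewrite big1 // => h /eqP /(congr1 (avoids i)); rewrite mi avoidsD.
by case: (avoids i h.1) => /= [<-|_]; rewrite ?mulr0 ?mul0r.
Qed.

Lemma restr_le i j f : (i <= j)%N -> restr i f = 0 -> restr j f = 0.
Proof.
move=> ij fi; apply: psP => m /=; case: ifP => // /forallP mj.
have := congr1 (fun g => pscoeff g m) fi; rewrite /= ifT //.
apply/forallP => l; apply/implyP => li.
by have := mj l; rewrite (leq_trans li ij).
Qed.

End Restriction.

Lemma psX_neq0 n (k : fieldType) m : psX k m <> 0 :> powerseries n k.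
Proof.
move/(congr1 (fun f => pscoeff f m)); rewrite /= mcoeffX eqxx.
by move/eqP; rewrite oner_eq0.
Qed.

Lemma has_order_var n (k : fieldType) (j : 'I_n) :
  has_order 1 (psX k U_(j) : powerseries n k).
Proof. by have := @has_order_psX n k U_(j); rewrite mdeg1. Qed.

Section HypersurfaceDimension.
Variables (k : fieldType) (alpha beta : k).
Local Notation PS := (powerseries 8 k).
Import classical_sets.
Local Open Scope classical_set_scope.

Definition ps_quartic (a : k) (x y z : PS) : PS :=
  psC 8 a * (x ^+ 2 * y ^+ 2) + z ^+ 4 + x * y * z ^+ 2 + (x ^+ 3 + y ^+ 3) * z.

Definition blowup_var (i : nat) : PS := psX k U_(inord i).

(** The chart [x_j = u x'_j] of the blow-up of the origin: as the quartics are
    homogeneous of degree 4, the equation becomes [v = - u ^ 3 g(x')]. *)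
Definition blowup (j : 'I_8) : PS :=
  if (j < 6)%N then blowup_var 6 * psX k U_(j) else
  if j == 6%N :> nat then blowup_var 6 else
  - (blowup_var 6 ^+ 3 * (ps_quartic alpha (blowup_var 0) (blowup_var 1) (blowup_var 2)
       + ps_quartic beta (blowup_var 3) (blowup_var 4) (blowup_var 5))).

Lemma blowup_order j : has_order 1 (blowup j).
Proof.
have u1 : has_order 1 (blowup_var 6) by apply: has_order_var.
rewrite /blowup; case: ifP => _; first exact: has_orderMr.
case: ifP => _ //; apply: has_orderN; apply: has_orderMr.
by rewrite exprS; apply: has_orderMr.
Qed.

Let theta := ps_subst_rmorphism blowup_order.

Lemma poly_subst_hypersurface h : poly_subst h (hypersurface_eq alpha beta)
  = h (inord 6) * h (inord 7)
    + ps_quartic alpha (h (inord 0)) (h (inord 1)) (h (inord 2))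
    + ps_quartic beta (h (inord 3)) (h (inord 4)) (h (inord 5)).
Proof.
have PD p q : poly_subst h (p + q) = poly_subst h p + poly_subst h q.
  exact: rmorphD.
have PX p d : poly_subst h (p ^+ d) = poly_subst h p ^+ d.
  exact: rmorphXn.
have PZ c p : poly_subst h (c *: p) = psC 8 c * poly_subst h p.
  by rewrite -mul_mpolyC poly_substM poly_substC.
by rewrite /hypersurface_eq /quartic !(PD, PX, PZ, poly_substM, poly_substX).
Qed.

Lemma blowup_hypersurface : theta (ps_of_mpoly (hypersurface_eq alpha beta)) = 0.
Proof.
have hj i : (i < 6)%N -> blowup (inord i) = blowup_var 6 * blowup_var i.
  by move=> i6; rewrite /blowup inordK ?i6 // (ltn_trans i6).
have h6 : blowup (inord 6) = blowup_var 6 by rewrite /blowup inordK.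
have h7 : blowup (inord 7) = - (blowup_var 6 ^+ 3 *
   (ps_quartic alpha (blowup_var 0) (blowup_var 1) (blowup_var 2)
       + ps_quartic beta (blowup_var 3) (blowup_var 4) (blowup_var 5))).
  by rewrite /blowup inordK.
rewrite /= (ps_subst_poly blowup_order) poly_subst_hypersurface h6 h7 !hj //.
rewrite /ps_quartic; ring.
Qed.

Lemma powerseries_zero_prime : is_prime_ideal [set (0 : PS)].
Proof.
split; first split => //=.
- by move=> x y -> ->; rewrite addr0.
- by move=> a x ->; rewrite mulr0.
- by move/eqP; rewrite oner_eq0.
- by move=> x y /= /ps_domain.
Qed.

(** Setting the six variables of the quartics to zero leaves [u v]. *)
Lemma hypersurface_eq_neq0 : ps_of_mpoly (hypersurface_eq alpha beta) <> 0.
Proof.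
pose h (j : 'I_8) : PS := if (j < 6)%N then 0 else psX k U_(j).
have h_order j : has_order 1 (h j).
  rewrite /h; case: ifP => _ //; exact: has_order_var.
move/(congr1 (ps_subst_rmorphism h_order)).
rewrite rmorph0 /= (ps_subst_poly h_order) poly_subst_hypersurface.
have -> : h (inord 6) * h (inord 7)
    + ps_quartic alpha (h (inord 0)) (h (inord 1)) (h (inord 2))
    + ps_quartic beta (h (inord 3)) (h (inord 4)) (h (inord 5))
  = psX k U_(inord 6) * psX k U_(inord 7).
  by rewrite /h !inordK //= /ps_quartic; ring.
by case/ps_domain; apply: psX_neq0.
Qed.

(** The series that vanish where the first [i] coordinates of the blow-up
    vanish form a prime ideal that contains the equation. *)
Lemma hypersurface_krull_dim : is_krull_dim (hypersurface alpha beta) 7.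
Proof.
apply: is_krull_dim_quotient => [d|||]; first exact: powerseries_chain.
- exact: powerseries_zero_prime.
- exact: hypersurface_eq_neq0.
exists (fun i => [set p | restr i (theta p) = 0]); split.
- by have := restr0 8 k 0; rewrite -blowup_hypersurface.
- move=> i i7; split; first split.
  + by have := restr0 8 k i; rewrite -[X in restr i X](rmorph0 theta).
  + move=> x y; rewrite /mkset => x0 y0; rewrite (congr1 (restr i) (rmorphD theta x y)).
    by rewrite restrD x0 y0 addr0.
  + move=> a x; rewrite /mkset => x0; rewrite (congr1 (restr i) (rmorphM theta a x)).
    by rewrite restrM x0 mulr0.
  + rewrite /mkset (congr1 (restr i) (rmorph1 theta)) restr1 => /eqP.
    by rewrite oner_eq0.
  + move=> x y; rewrite /mkset (congr1 (restr i) (rmorphM theta x y)) restrM.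
    exact: ps_domain.
move=> i i7; have i8 : (i < 8)%N by apply: ltnW.
have tX : theta (psX k U_(inord i)) = blowup (inord i).
  exact: (ps_substX blowup_order).
apply: (strict_subset (x := psX k U_(inord i))).
- by move=> x; apply: restr_le.
- rewrite /mkset tX /blowup (inordK i8); case: ifP => i6.
    by rewrite restrM restr_X (inordK i8) leqnn mulr0.
  by case: eqP => [i6'|]; [rewrite /blowup_var restr_X inordK // i6' | lia].
rewrite /mkset tX /blowup (inordK i8); case: ifP => i6.
  rewrite restrM !restr_X !inordK // ltnn ifF; last by apply/negbTE; rewrite -leqNgt; lia.
  by case/ps_domain; apply: psX_neq0.
case: eqP => [i6'|]; last by lia.
by rewrite restr_X inordK // i6'; apply: psX_neq0.
Qed.

End HypersurfaceDimension.
(** * Lengths as dimensions of spaces of truncated series *)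

Section Lengths.
Variables (n : nat) (k : fieldType) (q N : nat) (mon : 'I_N -> 'X_{1..n}).
Hypothesis mon_inj : injective mon.
Hypothesis mon_box : forall i l, (mon i l < q)%N.
Local Notation A := (powerseries n k).
Import classical_sets.
Local Open Scope classical_set_scope.

(** Row vectors, so that subspaces are row spaces. *)
Definition rcoords (p : A) : 'rV[k]_N := (coords mon p)^T.

Definition in_span (W : 'M[k]_N) : set A := [set p | (rcoords p <= W)%MS].

Lemma rcoordsD p p' : rcoords (p + p') = rcoords p + rcoords p'.
Proof. by rewrite /rcoords coordsD raddfD. Qed.

Lemma rcoordsB p p' : rcoords (p - p') = rcoords p - rcoords p'.
Proof. by rewrite /rcoords coordsB raddfB. Qed.

Lemma rcoordsC c p : rcoords (psC n c * p) = c *: rcoords p.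
Proof. by rewrite /rcoords coordsC linearZ. Qed.

Lemma rcoords_surj v : exists p, rcoords p = v.
Proof.
have [p pv] := coords_surj mon_inj v^T.
by exists (ps_of_mpoly p); rewrite /rcoords pv trmxK.
Qed.

(** An ideal that contains the [q]-th powers of the variables is the preimage of
    a space of coordinates: take a space of maximal rank whose preimage is
    contained in the ideal. *)
Lemma ideal_span (J : set A) : is_ideal J -> (forall p, rcoords p = 0 -> J p) ->
  exists U, forall p, J p <-> in_span U p.
Proof.
move=> [J0 JD JM] Jker.
pose P r := `[< exists U : 'M[k]_N, \rank U = r /\ forall p, in_span U p -> J p >].
have P_ex : exists r, P r.
  exists 0%N; apply/asboolP; exists 0; split; first exact: mxrank0.
  by move=> p; rewrite /in_span /= submx0 => /eqP; apply: Jker.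
have P_le r : P r -> (r <= N)%N.
  by move=> /asboolP[U [<- _]]; apply: rank_leq_row.
case: (ex_maxnP P_ex P_le) => r /asboolP[U [Ur UJ]] r_max.
exists U => p; split; last exact: UJ.
move=> Jp; apply: contrapT => /negP pU.
pose V := (U + <<rcoords p>>)%MS.
suff VJ : forall p', in_span V p' -> J p'.
  have : (\rank V <= r)%N by apply: r_max; apply/asboolP; exists V.
  rewrite leqNgt -Ur => /negP[].
  apply: rank_ltmx; rewrite ltmxE addsmxSl /=; apply/negP => VU.
  case/negP: pU; apply: submx_trans VU.
  by apply: submx_trans (addsmxSr _ _); rewrite genmxE.
move=> p' /sub_addsmxP[[u1 u2] /= E].
have /sub_rVP[c cE] : (u2 *m <<rcoords p>> <= rcoords p)%MS.
  by apply: submx_trans (submxMl _ _) _; rewrite genmxE.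
have -> : p' = (p' - psC n c * p) + psC n c * p by rewrite subrK.
apply: JD; last exact: JM.
by apply: UJ; rewrite /in_span /= rcoordsB rcoordsC -cE E addrK submxMl.
Qed.

Lemma in_span_le U V : in_span U `<=` in_span V <-> (U <= V)%MS.
Proof.
split=> [UV|UV p]; last by move=> pU; apply: submx_trans UV.
apply/row_subP => i; have [p pE] := rcoords_surj (row i U).
by rewrite -pE; apply: UV; rewrite /in_span /= pE row_sub.
Qed.

Lemma rcoords0P W p : rcoords p = 0 -> in_span W p.
Proof. by rewrite /in_span /= => ->; apply: sub0mx. Qed.

Lemma length_upper W d : is_ideal (in_span W) ->
  has_chain [set J | is_ideal J /\ in_span W `<=` J] d -> (d <= N - \rank W)%N.
Proof.
move=> _ [J [JC Jlt]].
have JU i : (i <= d)%N -> exists U, forall p, J i p <-> in_span U p.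
  move=> id; have [Ji JW] := JC i id; apply: ideal_span => // p p0.
  exact/JW/rcoords0P.
suff H i : (i <= d)%N -> exists U, (forall p, J i p <-> in_span U p) /\
    (\rank W + i <= \rank U)%N.
  have [U [_ WU]] := H d (leqnn d).
  by rewrite leq_subRL ?rank_leq_row // (leq_trans WU) ?rank_leq_row.
elim: i => [|i IH] id.
  have [U UE] := JU 0%N id; exists U; split=> //; rewrite addn0 mxrankS //.
  by apply/in_span_le => p pW; apply/UE; have [_] := JC 0%N id; apply.
have [U [UE Ur]] := IH (ltnW id); have [V VE] := JU i.+1 id.
exists V; split=> //; rewrite addnS (leq_ltn_trans Ur) //.
have [sub [p Jp nJp]] := subset_strict (Jlt i id).
apply: rank_ltmx; rewrite ltmxE; apply/andP; split.
  by apply/in_span_le => x /UE/sub/VE.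
apply/negP => /in_span_le VU; apply/nJp/UE/VU; exact/VE.
Qed.

Lemma rcoords_high p : has_order (n * q).+1 p -> rcoords p = 0.
Proof.
move=> pO; apply/rowP => i; rewrite !mxE; apply: pO; rewrite ltnS mdegE.
apply: leq_trans (_ : \sum_(l < n) q <= _)%N.
  by apply: leq_sum => l _; rewrite ltnW.
by rewrite sum_nat_const card_ord.
Qed.

(** Among the monomials whose product with a given series is not in the ideal,
    one of maximal degree gives an element of the socle. *)
Lemma socle W : is_ideal (in_span W) -> (\rank W < N)%N ->
  exists2 p, ~ in_span W p & forall i, in_span W (psX k U_(i) * p).
Proof.
move=> WI WN; have [p pW] : exists p, ~ in_span W p.
  apply: contrapT => no; move: WN; rewrite ltnNge => /negP; apply.
  rewrite -[X in (X <= _)%N](mxrank1 k N) mxrankS //; apply/in_span_le => p _.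
  by apply: contrapT => pW; apply: no; exists p.
pose P d := `[< exists m, mdeg m = d /\ ~ in_span W (psX k m * p) >].
have P_ex : exists d, P d.
  by exists 0%N; apply/asboolP; exists 0%MM; rewrite mdeg0 psX0 mul1r.
have P_le d : P d -> (d <= n * q)%N.
  move=> /asboolP[m [<- mW]]; rewrite leqNgt; apply/negP => mq; apply: mW.
  apply/rcoords0P/rcoords_high/has_orderMr/(has_order_le mq)/has_order_psX.
case: (ex_maxnP P_ex P_le) => d /asboolP[m [md mW]] d_max.
exists (psX k m * p) => // i; apply: contrapT => iW.
suff /d_max : P d.+1 by rewrite ltnn.
apply/asboolP; exists (U_(i) + m)%MM; rewrite mdegD mdeg1 md add1n; split=> //.
by rewrite psXD -mulrA.
Qed.

(** Modulo the ideal a series acts on [p] through its constant coefficient, so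
    adding the line of [p] gives an ideal again. *)
Lemma span_extend W p : is_ideal (in_span W) -> ~ in_span W p ->
  (forall i, in_span W (psX k U_(i) * p)) ->
  exists V, [/\ is_ideal (in_span V), \rank V = (\rank W).+1 & in_span W `<` in_span V].
Proof.
move=> [W0 WD WM] pW xpW; exists (W + <<rcoords p>>)%MS.
have VE p' : in_span (W + <<rcoords p>>)%MS p' <->
    exists c, in_span W (p' - psC n c * p).
  split=> [/sub_addsmxP[[u1 u2] /= E]|[c cW]].
    have /sub_rVP[c cE] : (u2 *m <<rcoords p>> <= rcoords p)%MS.
      by apply: submx_trans (submxMl _ _) _; rewrite genmxE.
    by exists c; rewrite /in_span /= rcoordsB rcoordsC -cE E addrK submxMl.
  rewrite /in_span /= -[p'](subrK (psC n c * p)) rcoordsD.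
  apply: addmx_sub; first exact: submx_trans cW (addsmxSl _ _).
  by rewrite rcoordsC; apply/scalemx_sub/(submx_trans _ (addsmxSr _ _)); rewrite genmxE.
split.
- split.
  + by apply/VE; exists 0; rewrite rmorph0 mul0r subr0.
  + move=> x y /VE[c cW] /VE[d dW]; apply/VE; exists (c + d).
    rewrite rmorphD; have -> : x + y - (psC n c + psC n d) * p
      = (x - psC n c * p) + (y - psC n d * p) by ring.
    exact: WD.
  + move=> a x /VE[c cW]; apply/VE; exists (c * pscoeff a 0%MM).
    pose b : A := a - psC n (pscoeff a 0%MM).
    have [|g gE] := @ps_box_decomposition _ _ 1 b.
      move=> m m0; have -> : m = 0%MM by apply/mnmP => i; rewrite mnm0E; have := m0 i; case: (m i).
      by rewrite pscoeffB -[psC _ _]mulr1 pscoeffCM pscoeff1 eqxx mulr1 subrr.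
    rewrite rmorphM; have -> : a * x - psC n c * psC n (pscoeff a 0%MM) * p
      = a * (x - psC n c * p) + psC n c * (b * p) by rewrite /b; ring.
    apply: (WD); first exact: WM.
    apply: (WM); rewrite gE mulr_suml.
    apply: (big_ind (in_span W)); [exact: W0 | exact: WD | move=> i _].
    by rewrite mulm1n mulrAC mulrC; apply: WM.
- apply/eqP; rewrite eqn_leq; apply/andP; split.
    apply: leq_trans (mxrank_adds_leqif _ _) _.
    by rewrite -[X in (_ <= X)%N]addn1 leq_add2l mxrank_gen rank_leq_row.
  apply: rank_ltmx; rewrite ltmxE addsmxSl /=; apply/negP => sub; apply: pW.
  apply: submx_trans sub; apply: submx_trans (addsmxSr _ _); by rewrite genmxE.
- apply: (strict_subset (x := p)) => //.
    by move=> x /submx_trans; apply; apply: addsmxSl.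
  by apply/VE; exists 1; rewrite rmorph1 mul1r subrr.
Qed.

Lemma length_lower W : is_ideal (in_span W) ->
  has_chain [set J | is_ideal J /\ in_span W `<=` J] (N - \rank W).
Proof.
move E : (N - \rank W)%N => l; elim: l W E => [|l IH] W E WI.
  by exists (fun=> in_span W); split=> // i _; split.
have WN : (\rank W < N)%N by rewrite -subn_gt0 E.
have [p pW xpW] := socle WI WN.
have [V [VI Vr WV]] := span_extend WI pW xpW.
have [|J [JC Jlt]] := IH V _ VI; first by rewrite Vr subnS E.
exists (fun i => if i is i'.+1 then J i' else in_span W).
have [sub [x Vx nWx]] := subset_strict WV.
have VJ i : (i <= l)%N -> in_span V `<=` J i by move=> /JC[].
split=> -[|i] //= il.
- by split.
- have [Ji _] := JC i il; split=> //.
  by apply: subset_trans (VJ i il); case: WV.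
- by apply: (strict_subset (x := x)) => // [y /sub|]; apply: VJ.
exact: Jlt.
Qed.

Variables (a : A) (a_proper : forall b, b * a != 1).

Theorem quotient_length W : is_ideal (in_span W) -> in_span W a ->
  is_quotient_length (quot a_proper @` in_span W) (N - \rank W).
Proof.
move=> WI Wa; split.
  have [J [JC Jlt]] := length_lower WI.
  exists (fun i => quot a_proper @` J i); split=> i il.
    have [Ji WJ] := JC i il; split; last exact: image_subset.
    by apply: (ideal_lift a_proper Ji _).1; apply: WJ.
  have [Ji WJ] := JC i (ltnW il).
  have [sub [x Jx nJx]] := subset_strict (Jlt i il).
  apply: (strict_subset (x := quot a_proper x)).
  - by move=> _ [y Jy <-]; exists y => //; apply: sub.
  - by exists x.
  - by move/(ideal_lift a_proper Ji (WJ _ Wa)).2.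
move=> d [K [KC Klt]]; apply: length_upper => //.
exists (fun i => [set x | K i (quot a_proper x)]); split=> i id.
  have [[K0 KD KM] WK] := KC i id; split; first split.
  - by rewrite /mkset rmorph0.
  - by move=> x y; rewrite /mkset rmorphD; apply: KD.
  - by move=> b x; rewrite /mkset rmorphM; apply: KM.
  by move=> x Wx; apply: WK; exists x.
have [sub [y Ky nKy]] := subset_strict (Klt i id).
have [x xy] := quot_surj y.
by apply: (strict_subset (x := x)) => [z /sub||]; rewrite /mkset ?xy.
Qed.

End Lengths.
(** * Frobenius powers of the maximal ideal *)

Section FreshmansDream.
Variables (A : comNzRingType) (char2 : 1 + 1 = 0 :> A) (e : nat).

Lemma char2_pow_add (x y : A) : (x + y) ^+ (2 ^ e) = x ^+ (2 ^ e) + y ^+ (2 ^ e).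
Proof.
elim: e x y => [|e' IH] x y; first by rewrite !expr1.
rewrite expnS !exprM -IH sqrrD; congr (_ ^+ _).
by rewrite -[x * y]mul1r -mulrnAl mulr2n char2 mul0r addr0.
Qed.

Lemma char2_pow_sum (I : Type) (r : seq I) (P : pred I) (F : I -> A) :
  (\sum_(i <- r | P i) F i) ^+ (2 ^ e) = \sum_(i <- r | P i) F i ^+ (2 ^ e).
Proof.
apply: (big_morph (fun x => x ^+ (2 ^ e)) char2_pow_add).
by rewrite expr0n expn_eq0.
Qed.

Lemma char2_opp (x : A) : - x = x.
Proof. by apply/eqP; rewrite eq_sym -addr_eq0 -[x]mul1r -mulrDl char2 mul0r. Qed.

End FreshmansDream.

Section FrobeniusPower.
Variables (n : nat) (k : fieldType) (e N : nat) (mon : 'I_N -> 'X_{1..n}).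
Local Notation q := (2 ^ e)%N.
Hypothesis char2 : 1 + 1 = 0 :> k.
Hypothesis mon_inj : injective mon.
Hypothesis mon_box : forall i l, (mon i l < q)%N.
Hypothesis mon_surj : forall m : 'X_{1..n}, (forall l, m l < q)%N -> exists i, mon i = m.
Local Notation A := (powerseries n k).
Import classical_sets.
Local Open Scope classical_set_scope.

Lemma ps_char2 : 1 + 1 = 0 :> A.
Proof. by rewrite -(rmorph1 (@psC n k)) -rmorphD char2 rmorph0. Qed.

Lemma coords_power_sum (g : 'I_n -> A) :
  coords mon (\sum_i psX k (U_(i) *+ q) * g i) = 0.
Proof.
apply/colP => i; rewrite !mxE pscoeff_sum big1 // => j _.
by have /colP/(_ i) := coords_power mon_box j (g j); rewrite !mxE.
Qed.

Lemma coordsM0 (b p : A) : coords mon p = 0 -> coords mon (b * p) = 0.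
Proof.
move=> /(coords_decomposition mon_surj)[g ->]; rewrite mulr_sumr.
by under eq_bigr do rewrite mulrCA; apply: coords_power_sum.
Qed.

Lemma nonunit_power (p : A) : pscoeff p 0%MM = 0 -> coords mon (p ^+ q) = 0.
Proof.
move=> p0; have [|g ->] := @ps_box_decomposition _ _ 1 p.
  move=> m m0; have -> : m = 0%MM.
    by apply/mnmP => i; rewrite mnm0E; have := m0 i; case: (m i).
  by [].
rewrite (char2_pow_sum ps_char2); under eq_bigr do rewrite exprMn -psX_exp mulm1n.
exact: coords_power_sum.
Qed.

Variables (a : A) (a_proper : forall b, b * a != 1) (Z : 'M[k]_N).
Hypothesis a_order : pscoeff a 0%MM = 0.
Hypothesis aZ : represents mon a Z.
Local Notation R := (principal_quotient a_proper).
Local Notation pi := (quot a_proper).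

Lemma pscoeff_mul0 (p p' : A) : pscoeff (p * p') 0%MM = pscoeff p 0%MM * pscoeff p' 0%MM.
Proof.
rewrite (pscoeffM_agree (@pstruncP _ _ _ p) (@pstruncP _ _ _ p')).
by rewrite [LHS](rmorphM (mcoeff 0%MM)) /= !pstruncP.
Qed.

Lemma max_ideal_quotient p : @max_ideal R (pi p) <-> pscoeff p 0%MM = 0.
Proof.
split=> [mp|p0 y].
  apply: contrapT => /eqP/ps_unit[g gp]; case/eqP: (mp (pi g)).
  by rewrite mulrC -rmorphM gp rmorph1.
have [g <-] := quot_surj y; apply/eqP; rewrite -rmorphM -(rmorph1 pi).
move/quot_eq => [b /(congr1 (fun f : A => pscoeff f 0%MM))].
rewrite pscoeffB !pscoeff_mul0 p0 a_order mul0r mulr0 pscoeff1 eqxx sub0r.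
by move/eqP; rewrite oppr_eq0 oner_eq0.
Qed.

Lemma in_span_image p : in_span mon Z^T p <->
  exists b s, p = a * b + s /\ coords mon s = 0.
Proof.
split=> [/submxP[u uE]|[b [s [-> s0]]]].
  have [b bE] := rcoords_surj mon_inj u.
  exists b, (p - a * b); split; first by rewrite addrC subrK.
  apply: trmx_inj; rewrite trmx0 -[LHS]/(rcoords mon _) rcoordsB uE -bE.
  by rewrite /rcoords aZ trmx_mul subrr.
rewrite /in_span /= rcoordsD /rcoords s0 trmx0 addr0 aZ trmx_mul.
exact: submxMl.
Qed.

Lemma image_ideal : is_ideal (in_span mon Z^T).
Proof.
split.
- by apply: rcoords0P; apply/rowP => i; rewrite !mxE.
- by move=> x y Wx Wy; rewrite /in_span /= rcoordsD addmx_sub.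
- move=> c x /in_span_image[b [s [-> s0]]]; apply/in_span_image.
  exists (c * b), (c * s); split; last exact: coordsM0.
  by rewrite mulrDr mulrCA.
Qed.

(** The coordinates of the ideal generated by [a] and the [q]-th powers of the
    variables form the image of [Z], and the [q]-th power of a nonunit is a
    combination of these powers since raising to the power [q] is additive. *)
Lemma frobenius_power_quotient :
  frobenius_power (@max_ideal R) q = pi @` in_span mon Z^T.
Proof.
have Wa : in_span mon Z^T a.
  apply/in_span_image; exists 1, 0; rewrite mulr1 addr0; split=> //.
  by apply/colP => i; rewrite !mxE.
apply/seteqP; split=> [x|_ [p /in_span_image[b [s [-> s0]]] <-] J [JI Jq]].
  apply; split; first exact: (ideal_lift a_proper image_ideal Wa).1.
  move=> _ [y + <-]; have [p <-] := quot_surj y => /max_ideal_quotient p0.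
  exists (p ^+ q); last by rewrite rmorphXn.
  by apply: rcoords0P; rewrite /rcoords nonunit_power // trmx0.
have [J0 JD JM] := JI.
have [g ->] := coords_decomposition mon_surj s0.
rewrite rmorphD rmorphM; have -> : pi a = 0 by apply/quot_eq0; exists 1; rewrite mul1r.
rewrite mul0r add0r rmorph_sum; apply: (big_ind J); [exact: J0 | exact: JD |].
move=> i _; rewrite rmorphM mulrC psX_exp rmorphXn; apply: (JM); apply: Jq.
exists (pi (psX k U_(i))) => //; apply/max_ideal_quotient.
by rewrite /= mcoeffX mnm1_eq0.
Qed.

Lemma frobenius_power_length :
  is_quotient_length (frobenius_power (@max_ideal R) q) (N - \rank Z).
Proof.
rewrite frobenius_power_quotient -mxrank_tr.
apply: (quotient_length mon_inj mon_box); first exact: image_ideal.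
apply/in_span_image; exists 1, 0; rewrite mulr1 addr0; split=> //.
by apply/colP => i; rewrite !mxE.
Qed.

End FrobeniusPower.
(** * Coordinates over the subring of powers *)

Section Roots.
Variables (k : closedFieldType) (e : nat).
Local Notation q := (2 ^ e)%N.
Hypothesis char2 : 1 + 1 = 0 :> k.

Lemma pow_inj (x y : k) : x ^+ q = y ^+ q -> x = y.
Proof.
move=> xy; apply/eqP; rewrite -subr_eq0 (char2_opp char2).
suff : (x + y) ^+ q == 0 by rewrite expf_eq0 => /andP[].
by rewrite (char2_pow_add char2) xy -[X in _ + X](char2_opp char2) subrr.
Qed.

Lemma root_ex (x : k) : exists y, y ^+ q == x.
Proof.
have q0 : (0 < q)%N by rewrite expn_gt0.
have /closed_rootP[y] : size ('X^q - x%:P) != 1%N.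
  by rewrite size_XnsubC // eqSS -lt0n.
by rewrite rootE hornerD hornerN hornerXn hornerC subr_eq0 => yx; exists y.
Qed.

Definition froot (x : k) : k := xchoose (root_ex x).

Lemma frootK x : froot x ^+ q = x.
Proof. exact: (eqP (xchooseP (root_ex x))). Qed.

Lemma powK x : froot (x ^+ q) = x.
Proof. by apply: pow_inj; rewrite frootK. Qed.

Lemma frootD x y : froot (x + y) = froot x + froot y.
Proof. by apply: pow_inj; rewrite (char2_pow_add char2) !frootK. Qed.

Lemma frootM x y : froot (x * y) = froot x * froot y.
Proof. by apply: pow_inj; rewrite exprMn !frootK. Qed.

Lemma froot0 : froot 0 = 0.
Proof. by rewrite -[X in froot X](_ : 0 ^+ q = 0) ?powK // expr0n expn_eq0. Qed.

Lemma froot1 : froot 1 = 1.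
Proof. by rewrite -[X in froot X](expr1n _ q) powK. Qed.

Lemma froot_eq0 x : froot x = 0 -> x = 0.
Proof. by move=> x0; rewrite -[x]frootK x0 expr0n expn_eq0. Qed.

End Roots.

Section Cartier.
Variables (n : nat) (k : closedFieldType) (e : nat).
Local Notation q := (2 ^ e)%N.
Hypothesis char2 : 1 + 1 = 0 :> k.
Local Notation A := (powerseries n k).
Implicit Types (p : A) (m : 'X_{1..n}).

(** The coordinate of [x^m] with respect to the basis of the ring over its
    subring of [q]-th powers, read through the isomorphism of the ring with
    this subring. *)
Definition cartier m p : A :=
  PowerSeries (fun l => froot e (pscoeff p (m + l *+ q)%MM)).

Lemma cartierE m p l : pscoeff (cartier m p) l = froot e (pscoeff p (m + l *+ q)%MM).
Proof. by []. Qed.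

Lemma cartierD m p p' : cartier m (p + p') = cartier m p + cartier m p'.
Proof. by apply: psP => l; rewrite pscoeffD /= frootD. Qed.

Lemma cartier0 m : cartier m 0 = 0.
Proof. by apply: psP => l /=; rewrite froot0. Qed.

Lemma cartier_sum m (I : Type) (r : seq I) (P : pred I) (F : I -> A) :
  cartier m (\sum_(i <- r | P i) F i) = \sum_(i <- r | P i) cartier m (F i).
Proof. exact: (big_morph _ (cartierD m) (cartier0 m)). Qed.

Lemma cartier_order m N p : has_order (mdeg m + N * q) p -> has_order N (cartier m p).
Proof.
move=> pO l lN; rewrite /= pO ?froot0 // mdegD ltn_add2l mdegMn.
by rewrite ltn_pmul2r // expn_gt0.
Qed.

Lemma cartier_monomial m c l p : (forall i, m i < q)%N ->
  cartier m ((psC n c * psX k l) ^+ q * p) = psC n c * psX k l * cartier m p.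
Proof.
move=> mq; apply: psP => l'; rewrite exprMn -psX_exp -!mulrA.
have -> : psC n c ^+ q = psC n (c ^+ q) by rewrite rmorphXn.
rewrite cartierE !pscoeffCM !pscoeffXM cartierE frootM // powK //; congr (_ * _).
have -> : (l *+ q <= m + l' *+ q)%MM = (l <= l')%MM.
  apply/mnm_lepP/mnm_lepP => H i; have := H i; rewrite mnmDE !mulmnE.
    move=> lq; rewrite -ltnS -(ltn_pmul2r (m := q)) ?expn_gt0 //.
    apply: leq_ltn_trans lq _; rewrite mulSn ltn_add2r; exact: mq.
  by move=> li; rewrite (leq_trans _ (leq_addl _ _)) // leq_mul2r li orbT.
case: ifP => [/mnm_lepP ll'|_]; last by rewrite froot0.
congr (froot e (pscoeff p _)); apply/mnmP => i; rewrite mnmBE !mnmDE !mulmnE mnmBE.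
by rewrite mulnBl addnBA // leq_mul2r ll' orbT.
Qed.

(** By additivity of the [q]-th power map this holds for the polynomials that
    truncate [x]; the remainder has high order. *)
Lemma cartierM m (x p : A) : (forall i, m i < q)%N ->
  cartier m (x ^+ q * p) = x * cartier m p.
Proof.
move=> mq; apply: ps_order_eq => N; pose M := (mdeg m + N)%N.
pose t : A := ps_of_mpoly (pstrunc M x).
have xt : has_order M.+1 (x - t) by apply: pstrunc_order.
have tE : cartier m (t ^+ q * p) = t * cartier m p.
  have -> : t = \sum_(l : 'X_{1..n < M.+1}) psC n (pscoeff x l) * psX k l.
    rewrite /t /pstrunc rmorph_sum; apply: eq_bigr => l _.
    by rewrite -mul_mpolyC rmorphM.
  rewrite (char2_pow_sum (ps_char2 n char2)) !mulr_suml cartier_sum.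
  by apply: eq_bigr => l _; apply: cartier_monomial.
have -> : x ^+ q * p = (x - t) ^+ q * p + t ^+ q * p.
  by rewrite -mulrDl -(char2_pow_add (ps_char2 n char2)) subrK.
rewrite cartierD tE -addrA -mulrBl.
have q0 : (0 < q)%N by rewrite expn_gt0.
apply: has_orderD; last first.
  apply: has_orderMr; rewrite -opprB; apply: has_orderN.
  by apply: has_order_le xt; rewrite /M; lia.
apply/cartier_order/has_orderMr.
apply: has_order_le (has_orderX (d := q) xt); rewrite /M.
rewrite mulnS mulnDr [(q * N)%N]mulnC; apply: leq_trans (leq_addl _ _).
by rewrite leq_add2r leq_pmull.
Qed.

Variables (N : nat) (mon : 'I_N -> 'X_{1..n}).
Hypothesis mon_inj : injective mon.
Hypothesis mon_box : forall i l, (mon i l < q)%N.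
Hypothesis mon_surj : forall m : 'X_{1..n}, (forall l, m l < q)%N -> exists i, mon i = m.

Lemma cartier_mon i j : cartier (mon i) (psX k (mon j)) = (i == j)%:R.
Proof.
apply: psP => l; rewrite /= mcoeffX.
have -> : (mon j == mon i + l *+ q)%MM = (i == j) && (l == 0%MM).
  apply/eqP/andP => [E|[/eqP -> /eqP ->]]; last by apply/mnmP => t; rewrite mnmDE mulmnE mnm0E addn0.
  have l0 : l = 0%MM.
    apply/mnmP => t; rewrite mnm0E; move/mnmP: E => /(_ t); rewrite mnmDE mulmnE.
    have := mon_box j t; case: (l t) => // u; rewrite mulSn => jq E.
    by move: jq; rewrite E addnCA ltnNge leq_addr.
  rewrite l0 eqxx; split=> //; apply/eqP/mon_inj; rewrite E l0.
  by apply/mnmP => t; rewrite mnmDE mulmnE mnm0E addn0.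
case: (i == j) => /=; last by rewrite froot0.
by rewrite mcoeff1; case: (l == 0%MM); rewrite ?froot1 ?froot0.
Qed.

Lemma cartier_inj p : (forall i, cartier (mon i) p = 0) -> p = 0.
Proof.
move=> p0; apply: psP => m; pose r : 'X_{1..n} := [multinom (m i %% q)%N | i < n].
have [|i iE] := mon_surj (m := r).
  by move=> l; rewrite mnmE ltn_mod expn_gt0.
have /(congr1 (fun f => pscoeff f [multinom (m i %/ q)%N | i < n])) := p0 i.
rewrite /= iE => /froot_eq0.
suff -> : (r + [multinom (m i %/ q)%N | i < n] *+ q)%MM = m by [].
by apply/mnmP => l; rewrite mnmDE mulmnE !mnmE addnC -divn_eq.
Qed.

Lemma cartier_decomposition p :
  p = \sum_i cartier (mon i) p ^+ q * psX k (mon i).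
Proof.
apply/eqP; rewrite -subr_eq0 (char2_opp (ps_char2 n char2)); apply/eqP/cartier_inj => i.
rewrite cartierD cartier_sum (bigD1 i) //= cartierM // cartier_mon eqxx mulr1.
rewrite big1 => [|j ji]; last by rewrite cartierM // cartier_mon eq_sym (negbTE ji) mulr0.
by rewrite addr0 -[X in _ + X](char2_opp (ps_char2 n char2)) subrr.
Qed.

(** By [cartier_top] the coordinate at the largest box monomial determines all
    the other ones. *)
Definition top : 'X_{1..n} := [multinom q.-1 | i < n].

Lemma cartier_top i p : cartier top (psX k (top - mon i)%MM * p) = cartier (mon i) p.
Proof.
have le t : (mon i t <= top t)%N by rewrite mnmE -ltnS prednK ?expn_gt0.
apply: psP => l; rewrite !cartierE pscoeffXM ifT.
  congr (froot e (pscoeff p _)); apply/mnmP => t.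
  rewrite mnmBE !mnmDE mnmBE; have := le t; lia.
by apply/mnm_lepP => t; rewrite mnmBE mnmDE; lia.
Qed.

End Cartier.
(** * Fedder's criterion for a hypersurface *)

Section Fedder.
Variables (n : nat) (k : closedFieldType) (e N : nat) (mon : 'I_N -> 'X_{1..n}).
Local Notation q := (2 ^ e)%N.
Hypothesis char2 : 1 + 1 = 0 :> k.
Hypothesis mon_inj : injective mon.
Hypothesis mon_box : forall i l, (mon i l < q)%N.
Hypothesis mon_surj : forall m : 'X_{1..n}, (forall l, m l < q)%N -> exists i, mon i = m.
Local Notation A := (powerseries n k).
Variables (a : A) (a_proper : forall b, b * a != 1) (Z : 'M[k]_N).
Hypothesis a_order : pscoeff a 0%MM = 0.
Hypothesis a_neq0 : a <> 0.
Hypothesis aZ : represents mon a Z.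
Local Notation R := (principal_quotient a_proper).
Local Notation pi := (quot a_proper).
Local Notation cartier := (@cartier n k e).
Local Notation top := (top n e).
Import classical_sets.
Local Open Scope classical_set_scope.

Lemma pi_a b : pi (a * b) = 0.
Proof. by apply/quot_eq0; exists b; rewrite mulrC. Qed.

(** A coordinate of [a ^ (q - 1) r] that is a unit gives a splitting. *)
Lemma fedder_splits r : coords mon (a ^+ q.-1 * r) <> 0 -> frobenius_splits q (pi r : R).
Proof.
move=> r0; have [i ri] : exists i, pscoeff (a ^+ q.-1 * r) (mon i) <> 0.
  apply: contrapT => no; apply: r0; apply/colP => i; rewrite !mxE.
  by apply: contrapT => ri; apply: no; exists i.
pose F p := cartier (mon i) (a ^+ q.-1 * p).
have F0 : pscoeff (F r) 0%MM != 0.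
  rewrite cartierE; have -> : (mon i + 0 *+ q)%MM = mon i.
    by apply/mnmP => t; rewrite mnmDE mulmnE mnm0E addn0.
  by apply/eqP => /froot_eq0; apply: ri.
have [v vF] := ps_unit F0.
have FM x p : F (x ^+ q * p) = x * F p by rewrite /F mulrCA cartierM.
have FD p p' : F (p + p') = F p + F p' by rewrite /F mulrDr cartierD.
have Fpi p p' : pi p = pi p' -> pi (F p) = pi (F p').
  move/quot_eq=> [b ppE]; have -> : p = p' + b * a by rewrite -ppE addrC subrK.
  rewrite FD rmorphD /F -[RHS]addr0; congr (_ + _).
  have -> : a ^+ q.-1 * (b * a) = a ^+ q * b.
    by rewrite -[in RHS](@prednK q) ?expn_gt0 // exprSr; ring.
  by rewrite cartierM // pi_a.
have [lft lftK] := choice (@quot_surj A a a_proper).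
exists (fun y => pi (v * F (lft y))); split=> [x y|x y|x].
- rewrite -rmorphD -mulrDr -FD.
  rewrite [LHS]rmorphM [RHS]rmorphM; congr (_ * _); apply: Fpi.
  by rewrite rmorphD !lftK.
- rewrite -[in RHS](lftK x) -rmorphM [in RHS]mulrCA -(FM (lft x)).
  rewrite [LHS]rmorphM [RHS]rmorphM; congr (_ * _); apply: Fpi.
  by rewrite rmorphM rmorphXn !lftK.
have -> : pi (v * F (lft (x ^+ q * pi r))) = pi (v * F (lft x ^+ q * r)).
  rewrite [LHS]rmorphM [RHS]rmorphM; congr (_ * _); apply: Fpi.
  by rewrite rmorphM rmorphXn !lftK.
by rewrite FM mulrCA vF mulr1 lftK.
Qed.

(** A splitting is given on the coordinates by lifts [b i] of its values on
    the basis, hence lifts to [p |-> cartier top (c p)]; as it vanishes on the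
    multiples of [a], the ideal [(a)] contains the coordinates of [c a], and
    [c] is a multiple of [a ^ (q - 1)]. *)
Lemma fedder_nonsplit r : coords mon (a ^+ q.-1 * r) = 0 -> ~ frobenius_splits q (pi r : R).
Proof.
move=> r0 [phi [phiD phiM phir]].
have phi0 : phi 0 = 0 by apply: (addrI (phi 0)); rewrite -phiD !addr0.
have /choice[b bE] : forall i, exists b, pi b = phi (pi (psX k (mon i))).
  by move=> i; apply: quot_surj.
pose c : A := \sum_i b i ^+ q * psX k (top - mon i)%MM.
pose T p := cartier top (c * p).
have topq i : (top i < q)%N by rewrite mnmE prednK ?expn_gt0.
have TE p : T p = \sum_i b i * cartier (mon i) p.
  rewrite /T mulr_suml cartier_sum //; apply: eq_bigr => i _.
  by rewrite -mulrA cartierM // cartier_top.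
have phiE p : phi (pi p) = pi (T p).
  rewrite [in LHS](cartier_decomposition char2 mon_inj mon_box mon_surj p) TE !rmorph_sum.
  rewrite (big_morph phi phiD phi0); apply: eq_bigr => i _.
  by rewrite !rmorphM rmorphXn phiM bE mulrC.
have /choice[s sE] : forall i, exists s, cartier (mon i) (c * a) = s * a.
  move=> i; apply/quot_eq0; rewrite -cartier_top // mulrCA -/(T _) -phiE.
  by rewrite mulrC pi_a phi0.
have cE : c * a = a ^+ q * \sum_i s i ^+ q * psX k (mon i).
  rewrite [LHS](cartier_decomposition char2 mon_inj mon_box mon_surj) mulr_sumr.
  by apply: eq_bigr => i _; rewrite sE exprMn; ring.
have {}cE : c = a ^+ q.-1 * \sum_i s i ^+ q * psX k (mon i).
  have /ps_domain[/eqP|//] : (c - a ^+ q.-1 * \sum_i s i ^+ q * psX k (mon i)) * a = 0.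
    rewrite mulrBl cE -[X in a ^+ X](@prednK q) ?expn_gt0 // exprSr.
    by move: (\sum_i _) => S; ring.
  by rewrite subr_eq0 => /eqP.
have [g gE] := coords_decomposition mon_surj r0.
have T0 : pscoeff (T r) 0%MM = 0.
  rewrite /T cE mulrAC gE mulr_suml cartier_sum // pscoeff_sum big1 // => i _.
  rewrite psX_exp -mulrA cartierM // pscoeff_mul0 /= mcoeffX mnm1_eq0.
  exact: mul0r.
have := phir 1; rewrite expr1n mul1r phiE -(rmorph1 pi) => /quot_eq[d].
move/(congr1 (fun f : A => pscoeff f 0%MM)).
rewrite pscoeffB pscoeff_mul0 a_order T0 mulr0 pscoeff1 eqxx sub0r => /eqP.
by rewrite oppr_eq0 oner_eq0.
Qed.

Lemma splitting_span p :
  in_span mon (kermx (Z ^+ q.-1)^T) p <-> coords mon (a ^+ q.-1 * p) = 0.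
Proof.
rewrite (representsX _ aZ) /in_span /=; split=> [/sub_kermxP E|E].
  by apply: trmx_inj; rewrite trmx_mul trmx0.
by apply/sub_kermxP; rewrite /rcoords -trmx_mul E trmx0.
Qed.

Lemma splitting_ideal_quotient :
  @splitting_ideal R q = pi @` in_span mon (kermx (Z ^+ q.-1)^T).
Proof.
apply/seteqP; split=> [y|_ [p /splitting_span p0 <-]]; last exact: fedder_nonsplit.
have [p <-] := quot_surj y => nsplit; exists p => //; apply/splitting_span.
by apply: contrapT => /fedder_splits.
Qed.

Lemma splitting_length :
  is_quotient_length (@splitting_ideal R q) (\rank (Z ^+ q.-1)).
Proof.
rewrite splitting_ideal_quotient.
have -> : \rank (Z ^+ q.-1) = (N - \rank (kermx (Z ^+ q.-1)^T))%N.
  by rewrite mxrank_ker mxrank_tr subKn // rank_leq_row.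
have spanE := splitting_span.
apply: (quotient_length mon_inj mon_box); first split.
- by apply/spanE; rewrite mulr0; apply/colP => i; rewrite !mxE.
- by move=> x y /spanE x0 /spanE y0; apply/spanE; rewrite mulrDr coordsD x0 y0 addr0.
- by move=> b x /spanE x0; apply/spanE; rewrite mulrCA; apply: (coordsM0 mon_box mon_surj).
apply/spanE; rewrite -exprSr prednK ?expn_gt0 //.
exact: (nonunit_power char2 mon_box).
Qed.

End Fedder.
(** * The recursion for the lengths *)

Section OddBlocksOfQuartic.

Lemma odd_blocksS q r :
  odd_blocks q.+1 r = odd_blocks q r + (-1) ^+ q * mult q * (r q)%:Z.
Proof. exact: big_ord_recr. Qed.

Lemma odd_blocks_pairs Q r : odd_blocks (Q.+1 * 2) r
  = \sum_(j < Q.+1) ((r (2 * j)%N)%:Z + (r (2 * j + 2)%N)%:Z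
       - 2 * (r (2 * j + 1)%N)%:Z) - (r (2 * Q.+1)%N)%:Z.
Proof.
elim: Q => [|Q IH].
  by rewrite /odd_blocks !big_ord_recr !big_ord0 /= /mult /= muln0 muln1; ring.
rewrite [in RHS]big_ord_recr /=.
have -> : odd_blocks (Q.+2 * 2) r = odd_blocks (Q.+1 * 2) r
    + 2 * (r (2 * Q.+1)%N)%:Z - 2 * (r (2 * Q.+1 + 1)%N)%:Z.
  have -> : (Q.+2 * 2 = (2 * Q.+1).+2)%N by lia.
  rewrite [(Q.+1 * 2)%N]mulnC !odd_blocksS exprS exprM sqrrN !expr1n addn1.
  by rewrite mulr1 mul1r mulN1r mulNr [mult (2 * _)]/mult muln_eq0.
rewrite IH; have -> : (2 * Q.+2 = 2 * Q.+1 + 2)%N by lia.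
ring.
Qed.

Variable k : fieldType.
Hypothesis char2 : 1 + 1 = 0 :> k.
Local Notation rk A := (fun l => \rank (A ^+ l)).

Lemma quartic_odd_blocks1 alpha : odd_blocks 2 (rk (quartic_mx 2 alpha : 'M[k]_ _)) = 8.
Proof.
rewrite !odd_blocksS [odd_blocks 0 _]big_ord0 quartic_mx2; cbv beta.
by rewrite [0 ^+ 1]expr1 mxrank0 mulr0 addr0 add0r [0 ^+ 0]expr0 -idmxE mxrank1.
Qed.

Variables (iota : {rmorphism 'F_2 -> k}) (alpha : k).
Hypothesis m_gt1 : (1 < degF2 iota alpha)%N.
Hypothesis bracketE : forall n j : nat, (1 <= n)%N -> (j < 2 ^ n)%N ->
  bracket iota n j alpha =
    (e_ n.+1 (quartic_xyz alpha ^+ (2 * j + 1)))%:R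
    - 2^-1 * ((e_ n.+1 (quartic_xyz alpha ^+ (2 * j)))%:R
              + (e_ n.+1 (quartic_xyz alpha ^+ (2 * j + 2)))%:R).

(** The length [e_(n+1)] is the corank of the power of the matrix, so twice the
    bracket is a second difference of ranks centered at an odd power, and the
    sum of these second differences is the alternating sum. *)
Lemma quartic_odd_blocks n : (0 < n)%N ->
  odd_blocks (2 ^ n.+1) (rk (quartic_mx (2 ^ n.+1) alpha))
    = (2 ^ n.+2 * (3 + (degF2 iota alpha %| n)))%:Z.
Proof.
move=> n0; set r := rk _.
have r_le l : (r l <= 8 ^ n.+1)%N.
  apply: leq_trans (rank_leq_row _) _.
  by rewrite -!expnMn.
have eE l : (e_ n.+1 (quartic_xyz alpha ^+ l))%:R = (8 ^ n.+1)%:R - (r l)%:R :> rat.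
  by rewrite e_quartic natrB //; apply: r_le.
have S := bracket_sum (degF2 iota (AS_root alpha) == degF2 iota alpha) m_gt1 n0.
have -> : (2 ^ n.+1 = (2 ^ n).-1.+1 * 2)%N by rewrite prednK ?expn_gt0 // expnSr.
rewrite odd_blocks_pairs prednK ?expn_gt0 //.
have -> : r (2 * 2 ^ n)%N = 0%N.
  by rewrite /r -expnS quartic_mx_nilp // mxrank0.
rewrite subr0; apply: (@intr_inj rat).
rewrite rmorph_sum /=.
transitivity (2 * (2 ^ n.+1 * (3 + (degF2 iota alpha %| n)))%:R : rat); last first.
  by rewrite -natrM mulnA -expnS.
rewrite -S mulr_sumr; apply: eq_bigr => j _.
have := bracketE n0 (ltn_ord j); rewrite /bracket => ->.
rewrite !eE !rmorphD rmorphN rmorphM /=.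
have h : 2 * 2^-1 = 1 :> rat by rewrite divff.
move: (r _) (r _) (r _) (8 ^ _)%N => a b c d.
rewrite -!pmulrn; lra.
Qed.

End OddBlocksOfQuartic.

Section Recursion.
Variables (k : fieldType) (char2 : 1 + 1 = 0 :> k) (alpha beta : k).
Local Notation rk A := (fun l => \rank (A ^+ l)).

Definition split_rank (e : nat) : int :=
  rank_sum (2 ^ e) (rk (ksum (quartic_mx (2 ^ e) alpha) (quartic_mx (2 ^ e) beta))).

Lemma split_rank0 : split_rank 0 = 1.
Proof.
rewrite /split_rank expn0 /rank_sum big_ord_recr big_ord0 /= /mult /=.
by rewrite expr0 -idmxE mxrank1.
Qed.

Lemma split_rankS e : split_rank e.+1 = 128 * split_rank e
  - odd_blocks (2 ^ e.+1) (rk (quartic_mx (2 ^ e.+1) alpha))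
    * odd_blocks (2 ^ e.+1) (rk (quartic_mx (2 ^ e.+1) beta)).
Proof.
rewrite /split_rank (rank_sum_ksum_rec char2 (c := 8)
  (A' := quartic_mx (2 ^ e) alpha) (B' := quartic_mx (2 ^ e) beta)) //.
1-4: exact: quartic_mx_nilp.
all: by move=> l; rewrite expnSr rank_quartic_mx_double.
Qed.

End Recursion.
(** * The limits *)

Section Limit.
Variable R : realType.
Import classical_sets numFieldNormedType.Exports.
Local Open Scope classical_set_scope.
Local Notation t := (32^-1 : R).

Let t01 : 0 < t < 1.
Proof. by rewrite invr_gt0 ltr0n invf_lt1 ?ltr0n // ltr1n. Qed.

(** The sum of [t ^ N] over the multiples [N >= n] of [m]. *)
Definition tail (m n : nat) : R := t ^+ (m * (n.-1 %/ m).+1) / (1 - t ^+ m).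

Lemma tail_denom m : (0 < m)%N -> 0 < 1 - t ^+ m.
Proof.
case/andP: t01 => t0 t1 m0.
by rewrite subr_gt0 exprn_ilt1 ?ltW // -lt0n.
Qed.

Lemma tail_step m n : (0 < m)%N -> (0 < n)%N ->
  tail m n = tail m n.+1 + (m %| n)%:R * t ^+ n.
Proof.
move=> m0; case: n => // n _; rewrite /tail /= divnS //.
have := tail_denom m0; rewrite lt_def => /andP[d0 _].
case: (boolP (m %| n.+1)%N) => mn /=; last by rewrite mul0r addr0.
have -> : t ^+ n.+1 = t ^+ (m * (n %/ m).+1).
  by have := divnK mn; rewrite divnS // mn mulnC => {1}<-.
rewrite [(m * _.+2)%N]mulnS exprD.
by move: (t ^+ m) (t ^+ (m * _)) d0 => u v d0; field.
Qed.

Lemma tail_cvg m : (0 < m)%N -> (tail m n @[n --> \oo] --> (0 : R^o)).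
Proof.
move=> m0; have d0 := tail_denom m0; case/andP: t01 => t0 t1.
have g0 : (fun n : nat => t ^+ n / (1 - t ^+ m) : R^o) @ \oo --> (0 : R^o).
  rewrite -[X in _ --> X](mul0r (1 - t ^+ m)^-1).
  apply: cvgMl; apply: cvg_expr; by rewrite ger0_norm ?ltW.
apply: (squeeze_cvgr _ (cvg_cst 0) g0); apply: nearW => n.
have -> : 0 <= tail m n by rewrite /tail divr_ge0 ?exprn_ge0 ?ltW.
rewrite /tail /= ler_pM2r ?invr_gt0 //.
apply: ler_wiXn2l; rewrite ?ltW //.
case: n => // n; rewrite /= mulnC; exact: ltn_ceil.
Qed.

Lemma tail1 m : (0 < m)%N -> tail m 1 / 8 = 1 / (2 ^+ (5 * m + 3) - 8).
Proof.
move=> m0; have := tail_denom m0; rewrite /tail div0n muln1.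
have -> : 2 ^+ (5 * m + 3) = 8 * 32 ^+ m :> R.
  by rewrite exprD exprM -!(natrX _ 2) mulrC.
rewrite exprVn; set u : R := 32 ^+ m.
have u1 : 0 < u by rewrite exprn_gt0.
rewrite subr_gt0 invf_lt1 // => u2.
by field; rewrite ?gt_eqF //; lra.
Qed.

Variables (ma mb : nat) (E : nat -> int).
Hypotheses (ma0 : (0 < ma)%N) (mb0 : (0 < mb)%N).
Hypotheses (E0 : E 1%N = 64).
Hypothesis ES : forall n, (0 < n)%N -> E n.+1 = 128 * E n
  - (2 ^ n.+2 * (3 + (ma %| n)))%:Z * (2 ^ n.+2 * (3 + (mb %| n)))%:Z.

Local Notation d0 := (lcmn ma mb).
Let limit : R := 115 / 248 - 3 / (2 ^+ (5 * ma + 3) - 8)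
   - 3 / (2 ^+ (5 * mb + 3) - 8) - 1 / (2 ^+ (5 * d0 + 3) - 8).

(** The product [(3 + [ma | n]) (3 + [mb | n])] expands into indicators of the
    multiples of 1, [ma], [mb] and [lcm(ma, mb)], with coefficients 9, 3, 3
    and 1. *)
Lemma recursion_solution n : (0 < n)%N ->
  (E n)%:~R / 2 ^+ (n * 7)
    = limit + (9 * tail 1 n + 3 * tail ma n + 3 * tail mb n + tail d0 n) / 8.
Proof.
have l0 : (0 < d0)%N by rewrite lcmn_gt0 ma0.
elim: n => // -[_ _|n IH _].
  have lim : limit = 115 / 248 - 3 * (tail ma 1 / 8) - 3 * (tail mb 1 / 8) - tail d0 1 / 8.
    by rewrite /limit !tail1 // !mulrA !mulr1.
  have t1 : tail 1 1 = 31^-1.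
    by rewrite /tail div0n muln1 expr1; field.
  rewrite E0 lim mul1n t1 -(natrX _ 2 7); lra.
have {}IH := IH isT.
have ESn : (E n.+2)%:~R / 2 ^+ (n.+2 * 7) = (E n.+1)%:~R / 2 ^+ (n.+1 * 7)
    - (3 + (ma %| n.+1)%:R) * (3 + (mb %| n.+1)%:R) * t ^+ n.+1 / 8 :> R.
  have cast (c : bool) : ((2 ^ n.+3 * (3 + c))%N%:Z)%:~R = 2 ^+ n.+3 * (3 + c%:R) :> R.
    by rewrite -pmulrn natrM natrX natrD.
  rewrite ES // intrB !intrM !cast.
  have pow7 j : 2 ^+ (j * 7) = 32 ^+ j * (2 ^+ j) ^+ 2 :> R.
    rewrite mulnC exprM; have -> : 2 ^+ 7 = 32 * 2 ^+ 2 :> R.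
      by rewrite -!natrX -natrM.
    by rewrite exprMn -!exprM mulnC.
  rewrite !pow7 exprVn [2 ^+ n.+3]exprS [2 ^+ n.+2]exprS [32 ^+ n.+2]exprS.
  have u0 : 32 ^+ n.+1 != 0 :> R by rewrite expf_neq0 // pnatr_eq0.
  have v0 : 2 ^+ n.+1 != 0 :> R by rewrite expf_neq0 // pnatr_eq0.
  move: (32 ^+ n.+1) (2 ^+ n.+1) u0 v0 => u v u0 v0.
  by field; rewrite u0 v0.
rewrite ESn IH (tail_step (m := 1)) // (tail_step ma0) // (tail_step mb0) //.
rewrite (tail_step l0) // dvd1n dvdn_lcm.
by case: (ma %| n.+1)%N; case: (mb %| n.+1)%N => /=; lra.
Qed.

Lemma recursion_limit : (fun n => (E n)%:~R / 2 ^+ (n * 7) : R^o) @ \oo --> (limit : R^o).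
Proof.
have l0 : (0 < d0)%N by rewrite lcmn_gt0 ma0.
have H : (fun n => limit + (9 * tail 1 n + 3 * tail ma n + 3 * tail mb n + tail d0 n) / 8 : R^o)
    @ \oo --> (limit : R^o).
  rewrite -[X in _ --> X]addr0; apply: cvgD; first exact: cvg_cst.
  rewrite -[X in _ --> X](mul0r 8^-1); apply: cvgMl.
  rewrite -[X in _ --> X]addr0; apply: cvgD; last exact: tail_cvg.
  rewrite -[X in _ --> X]addr0; apply: cvgD.
    rewrite -[X in _ --> X]addr0; apply: cvgD.
      by rewrite -[X in _ --> X](mulr0 9); apply: cvgMr; apply: tail_cvg.
    by rewrite -[X in _ --> X](mulr0 3); apply: cvgMr; apply: tail_cvg.
  by rewrite -[X in _ --> X](mulr0 3); apply: cvgMr; apply: tail_cvg.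
apply: cvg_trans H; apply: near_eq_cvg; near=> n.
by rewrite recursion_solution //; near: n; exists 1%N.
Unshelve. all: end_near.
Qed.

Lemma recursion_limit_complement :
  (fun n => 2 - (E n)%:~R / 2 ^+ (n * 7) : R^o) @ \oo -->
    ((381 / 248 + 3 / (2 ^+ (5 * ma + 3) - 8) + 3 / (2 ^+ (5 * mb + 3) - 8)
       + 1 / (2 ^+ (5 * d0 + 3) - 8) : R) : R^o).
Proof.
set v : R := (X in _ --> (X : R^o)).
have -> : v = 2 - limit by rewrite /v /limit; lra.
by apply: cvgB; [apply: cvg_cst | apply: recursion_limit].
Qed.

End Limit.
(** * The hypersurface *)

Section HypersurfaceLengths.
Variables (k : closedFieldType) (char2 : 1 + 1 = 0 :> k) (alpha beta : k) (e : nat).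
Local Notation q := (2 ^ e)%N.
Local Notation w := ((q * (q * q)) * (q * (q * q)))%N.
Local Notation h := (ksum (quartic_mx q alpha) (quartic_mx q beta)).
Local Notation Z := (ksum (jordan k q *t jordan k q) h).
Local Notation S := (hypersurface alpha beta).

Lemma hypersurface_splitting_length : exists2 l,
  is_quotient_length (@splitting_ideal S q) l & l%:Z = split_rank alpha beta e.
Proof.
exists (\rank (Z ^+ q.-1)).
  apply: (splitting_length char2 (@mon8_inj _) (@mon8_box _) (@mon8_surj _)).
  - exact: hypersurface_eq0.
  - exact: hypersurface_eq_neq0.
  - exact: represents_hypersurface.
by apply: (rank_uv_top char2); apply: (ksum_nilp char2); apply: quartic_mx_nilp.
Qed.

Lemma hypersurface_frobenius_length : exists2 l,
  is_quotient_length (frobenius_power (@max_ideal S) q) l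
  & l%:Z = (2 ^ (e * 7) * 2)%N%:Z - split_rank alpha beta e.
Proof.
exists (q * q * w - \rank Z)%N.
  apply: (frobenius_power_length char2 (@mon8_inj _) (@mon8_box _) (@mon8_surj _)).
  - exact: hypersurface_eq0.
  - exact: represents_hypersurface.
rewrite -subzn ?rank_leq_row // corank_uv //; last first.
  by apply: (ksum_nilp char2); apply: quartic_mx_nilp.
congr (_ - _); rewrite expnM -[2 * _]/(2%:Z * _) -PoszM mulnC; congr Posz.
by congr (_ * 2)%N; rewrite !expnS expn0; lia.
Qed.

End HypersurfaceLengths.

Theorem theoremB (k : closedFieldType) (iota : {rmorphism 'F_2 -> k})
    (k_algebraic : forall x : k, algebraicOver iota x)
    (bracketE : forall alpha : k, alpha != 0 ->
       forall n j : nat, (1 <= n)%N -> (j < 2 ^ n)%N ->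
       bracket iota n j alpha =
         (e_ n.+1 (quartic_xyz alpha ^+ (2 * j + 1)))%:R
         - 2^-1 * ((e_ n.+1 (quartic_xyz alpha ^+ (2 * j)))%:R
                   + (e_ n.+1 (quartic_xyz alpha ^+ (2 * j + 2)))%:R))
    (R : realType) (alpha beta : k)
    (alpha_neq0 : alpha != 0) (beta_neq0 : beta != 0)
    (malpha_gt1 : (1 < degF2 iota alpha)%N)
    (mbeta_gt1 : (1 < degF2 iota beta)%N) :
  let ma := degF2 iota alpha in
  let mb := degF2 iota beta in
  [/\ is_krull_dim (hypersurface alpha beta) 7,
        is_HK_multiplicity (hypersurface alpha beta) 2
    (381 / 248 + 3 / (2 ^+ (5 * ma + 3) - 8) + 3 / (2 ^+ (5 * mb + 3) - 8)
       + 1 / (2 ^+ (5 * lcmn ma mb + 3) - 8) : R)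
  &   is_F_signature (hypersurface alpha beta) 2
    (115 / 248 - 3 / (2 ^+ (5 * ma + 3) - 8) - 3 / (2 ^+ (5 * mb + 3) - 8)
       - 1 / (2 ^+ (5 * lcmn ma mb + 3) - 8) : R)].
Proof.
move=> ma mb.
have char2 : 1 + 1 = 0 :> k.
  by rewrite -(rmorph1 iota) -rmorphD -[RHS](rmorph0 iota); congr (iota _); apply/val_inj.
have dim7 := hypersurface_krull_dim alpha beta.
have E1 : split_rank alpha beta 1 = 64.
  by rewrite split_rankS // split_rank0 !quartic_odd_blocks1.
have ES n : (0 < n)%N -> split_rank alpha beta n.+1 = 128 * split_rank alpha beta n
    - (2 ^ n.+2 * (3 + (ma %| n)))%:Z * (2 ^ n.+2 * (3 + (mb %| n)))%:Z.
  move=> n0; rewrite split_rankS // (quartic_odd_blocks char2 malpha_gt1 (bracketE _ alpha_neq0)) //.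
  by rewrite (quartic_odd_blocks char2 mbeta_gt1 (bracketE _ beta_neq0)).
have [ma0 mb0] := (ltnW malpha_gt1, ltnW mbeta_gt1).
split=> //.
- have /choice[l lP] : forall e, exists l,
      is_quotient_length (frobenius_power (@max_ideal (hypersurface alpha beta)) (2 ^ e)) l
      /\ l%:Z = (2 ^ (e * 7) * 2)%N%:Z - split_rank alpha beta e.
    by move=> e; have [l] := hypersurface_frobenius_length char2 alpha beta e; exists l.
  exists 7, l; split=> // [e|]; first by have [] := lP e.
  have -> : (fun e => (l e)%:R / 2%:R ^+ (e * 7)) =
      (fun e => 2 - (split_rank alpha beta e)%:~R / 2 ^+ (e * 7)) :> (nat -> R).
    apply/funext => e; have [_ /(congr1 (fun z => z%:~R : R)) le] := lP e.
    rewrite -[(l e)%:R]/((l e)%:Z%:~R) le rmorphB /= -pmulrn natrM natrX mulrBl.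
    by congr (_ - _); rewrite mulrAC divff ?mul1r // expf_neq0 // pnatr_eq0.
  exact: (recursion_limit_complement ma0 mb0 E1 ES).
have /choice[l lP] : forall e, exists l,
    is_quotient_length (@splitting_ideal (hypersurface alpha beta) (2 ^ e)) l
    /\ l%:Z = split_rank alpha beta e.
  by move=> e; have [l] := hypersurface_splitting_length char2 alpha beta e; exists l.
exists 7, l; split=> // [e|]; first by have [] := lP e.
have -> : (fun e => (l e)%:R / 2%:R ^+ (e * 7)) =
    (fun e => (split_rank alpha beta e)%:~R / 2 ^+ (e * 7)) :> (nat -> R).
  by apply/funext => e; have [_ <-] := lP e.
exact: (recursion_limit ma0 mb0 E1 ES).
Qed.
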